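(* Suppose that for some $R>r>0$, $\left\|\sum_{\iota\in I}e^{\varphi_\iota}\right\|_{\mathcal{H}_R}\le \Phi$ for a finite constant $\Phi$, and $g_\iota(\mathcal{E}_R)\subset\mathcal{E}_r$ for every $\iota\in I$. Let $\vec\nu_N,\vec h_N\in\mathbb{R}^N$ be leading left and right eigenvectors of the matrix $L_N$, and let $$\vec\mu_N^{\,j}=\frac{1}{\sum_{i=1}^N \vec\nu_N^{\,i}\,\vec h_N^{\,i}}\;\vec\nu_N^{\,j}\,\vec h_N^{\,j},\qquad j=1,\dots,N.$$ Then there exists $K'$ such that for $N$ sufficiently large and all $\psi\in\mathcal{H}_R$, $$\left|\int\psi\,d\mu_\varphi-\sum_{j=1}^N\vec\mu_N^{\,j}\,\psi(x_{j,N})\right|\le K' e^{-(R-r)N}\|\psi\|_{\mathcal{H}_R}.$$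
   Context: Function spaces: for $r>0$, $\mathcal{E}_r\subset\mathbb{C}$ is the open ellipse centred at $0$ with semi-major axis $\cosh r$ (along the real axis) and semi-minor axis $\sinh r$; it contains $[-1,1]$. $\mathcal{H}_r$ is the Banach algebra of bounded analytic functions on $\mathcal{E}_r$ with norm $\|\psi\|_{\mathcal{H}_r}=\sup_{z\in\mathcal{E}_r}|\psi(z)|$. System: $I$ is an index set; $g_\iota:[-1,1]\to[-1,1]$ ($\iota\in I$) are the contractions of an iterated function system (equivalently, the inverse branches of a full-branch expanding map $f$), and $\varphi_\iota=\varphi\circ g_\iota$ are weights coming from a potential $\varphi$. The $g_\iota,\varphi_\iota$ are analytic, real on $[-1,1]$, and extend analytically to the ellipse on which the hypotheses are imposed. The transfer operator is $$\mathcal{L}_\varphi\psi(x)=\sum_{\iota\in I}e^{\varphi_\iota(x)}\psi(g_\iota(x)).$$ Equilibrium measure: $\mathcal{L}_\varphi$ has spectral radius $e^{P(\varphi)}$ on $\mathcal{H}_r$, where $P(\varphi)$ is the pressure (the supremum over $f$-invariant measures $\mu$ of $\int\varphi\,d\mu$ plus the entropy of $f$ with respect to $\mu$). The number $e^{P(\varphi)}$ is a simple isolated eigenvalue, with right eigenfunction $h_\varphi\in\mathcal{H}_r$ and left eigenvector $\nu_\varphi\in\mathcal{H}_r^*$. The equilibrium measure $\mu_\varphi$ (the invariant measure attaining the supremum) satisfies $\int\psi\,d\mu_\varphi=\nu_\varphi[\psi h_\varphi]/\nu_\varphi[h_\varphi]$ for $\psi\in\mathcal{H}_r$. Chebyshev-Lagrange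 discretisation: for $n=1,\dots,N$, the Chebyshev nodes are $x_{n,N}=\cos\left(\tfrac{2n-1}{2N}\pi\right)$ and the Lagrange polynomials are $\ell_{n,N}(x)=\prod_{m\ne n}\frac{x-x_{m,N}}{x_{n,N}-x_{m,N}}$. The matrix $L_N$ is the $N\times N$ matrix with $(j,k)$ entry $(\mathcal{L}_\varphi\ell_{k,N})(x_{j,N})$. A leading eigenvector is one for the leading eigenvalue (the eigenvalue of largest modulus). Superscripts $j$ on vectors denote the $j$th component. *)

(* Defs.v *)
(* MathComp-Analysis.  Complex numbers are K[i] for K : realType. *)
From HB Require Import structures.
From mathcomp Require Export all_boot all_order all_algebra finmap.
From mathcomp Require Export complex.
From mathcomp Require Export all_classical all_reals all_analysis.
From mathcomp.analysis.showcase Require summability.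
Set Implicit Arguments.
Unset Strict Implicit.
Unset Printing Implicit Defensive.
Import Order.TTheory GRing.Theory Num.Theory.
Export numFieldNormedType.Exports.
Import ComplexField.Normc.
Local Open Scope classical_set_scope.
Local Open Scope ring_scope.

Notation toC := (real_complex _).

Section Complex.
Context {K : realType}.
Local Notation C := K[i].

Definition expC (z : C) : C :=
  Complex (expR (complex.Re z) * cos (complex.Im z))
          (expR (complex.Re z) * sin (complex.Im z)).

Definition analytic_on (D : set C) (f : C -> C) : Prop :=
  forall z, D z -> exists (a : nat -> C) (e : K), 0 < e /\
    forall y, normc (y - z) < e ->
      series (fun k => a k * (y - z) ^+ k : C^o) @ \oo --> (f y : C^o).

Definition cosh (r : K) : K := (expR r + expR (- r)) / 2.
Definition sinh (r : K) : K := (expR r - expR (- r)) / 2.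

Definition ellipse (r : K) : set C :=
  [set z | (complex.Re z / cosh r) ^+ 2 + (complex.Im z / sinh r) ^+ 2 < 1].

End Complex.

(* Elements of the Banach algebra H_r are represented by functions on all of
   K[i]: only the values on [ellipse r] matter, and equality in H_r is equality
   on [ellipse r]. *)
Section BoundedAnalytic.
Context {K : realType}.
Local Notation C := K[i].

Definition inH (r : K) (psi : C -> C) : Prop :=
  analytic_on (ellipse r) psi /\
  exists M : K, forall z, ellipse r z -> normc (psi z) <= M.

Definition Hnorm (r : K) (psi : C -> C) : K :=
  sup [set normc (psi z) | z in ellipse r].

Definition eqH (r : K) (psi chi : C -> C) : Prop :=
  forall z, ellipse r z -> psi z = chi z.

(* [S] is the sum in the Banach space H_r of the family [u] of elements of H_r:
   the net of finite partial sums converges to [S] in norm. *)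
Definition H_has_sum (r : K) (I : choiceType) (u : I -> C -> C) (S : C -> C)
    : Prop :=
  [/\ forall i, inH r (u i), inH r S &
   forall e : K, 0 < e -> exists A0 : {fset I}, forall A : {fset I},
     (A0 `<=` A)%fset ->
     Hnorm r (fun z => summability.partial_sum (u^~ z) A - S z) <= e].

(* [lam - T] is a bijection of H_r with bounded inverse. *)
Definition resolvent_set (r : K) (T : (C -> C) -> (C -> C)) : set C :=
  [set lam | exists M : K, forall chi, inH r chi ->
     exists psi, [/\ inH r psi,
       eqH r (fun z => lam * psi z - T psi z) chi,
       Hnorm r psi <= M * Hnorm r chi &
       forall psi', inH r psi' ->
         eqH r (fun z => lam * psi' z - T psi' z) chi -> eqH r psi' psi]].

Definition spectrum (r : K) (T : (C -> C) -> (C -> C)) : set C :=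
  ~` resolvent_set r T.

Definition spectral_radius (r : K) (T : (C -> C) -> (C -> C)) : K :=
  sup [set normc lam | lam in spectrum r T].

Definition right_eigenfunction (r : K) (T : (C -> C) -> (C -> C)) (lam : C)
    (h : C -> C) : Prop :=
  [/\ inH r h, ~ eqH r h (fun=> 0) & eqH r (T h) (fun z => lam * h z)].

Definition inHdual (r : K) (nu : (C -> C) -> C) : Prop :=
  (forall (a : C) u v, inH r u -> inH r v ->
     nu (fun z => a * u z + v z) = a * nu u + nu v) /\
  exists M : K, forall u, inH r u -> normc (nu u) <= M * Hnorm r u.

Definition left_eigenvector (r : K) (T : (C -> C) -> (C -> C)) (lam : C)
    (nu : (C -> C) -> C) : Prop :=
  [/\ inHdual r nu, exists2 u, inH r u & nu u != 0 &
      forall u, inH r u -> nu (T u) = lam * nu u].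

(* Algebraic simplicity: all generalised eigenvectors are multiples of one
   eigenfunction. *)
Definition simple_eigenvalue (r : K) (T : (C -> C) -> (C -> C)) (lam : C)
    : Prop :=
  exists2 h, right_eigenfunction r T lam h &
    forall (n : nat) u, inH r u ->
      eqH r (iter n (fun v z => T v z - lam * v z) u) (fun=> 0) ->
      exists c : C, eqH r u (fun z => c * h z).

Definition isolated_in_spectrum (r : K) (T : (C -> C) -> (C -> C)) (lam : C)
    : Prop :=
  exists2 e : K, 0 < e &
    forall z, spectrum r T z -> normc (z - lam) < e -> z = lam.

End BoundedAnalytic.

Section System.
Context {K : realType} {I : choiceType}.
Local Notation C := K[i].

(* The unordered sum over [I] in K[i] is [summability.sum], the limit of the
   finite partial sums along the net of finite subsets of [I]. *)
Definition transfer (g w : I -> C -> C) (psi : C -> C) (x : C) : C :=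
  summability.sum (K := C)
    (fun i => expC (w i x) * psi (g i x) : C^o).

Definition on_reals (u : C -> C) (x : K) : K := complex.Re (u (toC x)).

(* The set on which the full-branch map f is defined by its inverse branches;
   it need not be all of [-1, 1]. *)
Definition branch_domain (g : I -> C -> C) : set K :=
  \bigcup_i (on_reals (g i) @` `[(-1)%R, 1%R]).

(* [g i] and [w i] are the analytic extensions to [ellipse R] of the branches
   and of the weights.  Two adjacent branches may share an endpoint, where [f]
   and [phi] cannot agree with both; there they follow one of the branches.
   Their values outside [branch_domain g] play no role. *)
Record full_branch_system (R : K) (g w : I -> C -> C) (f phi : K -> K) : Prop := {
  branch_analytic : forall i, analytic_on (ellipse R) (g i);
  weight_analytic : forall i, analytic_on (ellipse R) (w i);
  branch_real : forall i x, x \in `[(-1)%R, 1%R] ->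
    exists2 y, y \in `[(-1)%R, 1%R] & g i (toC x) = toC y;
  weight_real : forall i x, x \in `[(-1)%R, 1%R] -> complex.Im (w i (toC x)) = 0;
  branch_contraction : forall i, exists2 k : K, k < 1 &
    forall x y, x \in `[(-1)%R, 1%R] -> y \in `[(-1)%R, 1%R] ->
      `|on_reals (g i) x - on_reals (g i) y| <= k * `|x - y|;
  branch_disjoint : forall i j x y, i != j ->
    x \in `](-1)%R, 1%R[ -> y \in `](-1)%R, 1%R[ ->
    on_reals (g i) x != on_reals (g j) y;
  branch_inverse : forall i x, x \in `](-1)%R, 1%R[ ->
    f (on_reals (g i) x) = x;
  weight_potential : forall i x, x \in `](-1)%R, 1%R[ ->
    phi (on_reals (g i) x) = on_reals (w i) x;
  branch_selection : forall x, branch_domain g x ->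
    exists i y, [/\ y \in `[(-1)%R, 1%R], on_reals (g i) y = x, f x = y &
                    phi x = on_reals (w i) y];
  map_measurable : measurable_fun [set: measurableTypeR K]
                     (f : measurableTypeR K -> measurableTypeR K);
  potential_measurable : measurable_fun [set: measurableTypeR K]
                           (phi : measurableTypeR K -> measurableTypeR K)
}.

End System.

Section Pressure.
Context {K : realType}.

(* [c : K -> 'I_k] labels the atoms of a finite partition; the atoms of its
   n-th refinement under f are indexed by words of length n. *)
Definition cylinder (f : K -> K) (k : nat) (c : K -> 'I_k) (n : nat)
    (a : {ffun 'I_n -> 'I_k}) : set (measurableTypeR K) :=
  [set x | forall j : 'I_n, c (iter j f x) = a j].

Definition shannon (mu : probability (measurableTypeR K) K) (f : K -> K)
    (k : nat) (c : K -> 'I_k) (n : nat) : K :=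
  \sum_(a : {ffun 'I_n -> 'I_k})
    - (fine (mu (cylinder f c a)) * ln (fine (mu (cylinder f c a)))).

Definition partition_entropy (mu : probability (measurableTypeR K) K)
    (f : K -> K) (k : nat) (c : K -> 'I_k) : K :=
  limn (fun n => shannon mu f c n / n%:R).

Definition measurable_partition (k : nat) (c : K -> 'I_k) : Prop :=
  forall a, measurable (c @^-1` [set a] : set (measurableTypeR K)).

Definition entropy (mu : probability (measurableTypeR K) K) (f : K -> K)
    : \bar K :=
  ereal_sup [set e | exists k (c : K -> 'I_k),
    measurable_partition c /\ e = (partition_entropy mu f c)%:E].

Definition invariant (D : set K) (f : K -> K)
    (mu : probability (measurableTypeR K) K) : Prop :=
  mu D = 1%E /\
  forall A : set (measurableTypeR K), measurable A -> mu (f @^-1` A) = mu A.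

(* When the integral is -oo and the entropy +oo the sum is -oo, so that such
   measures do not contribute to the supremum. *)
Definition free_energy (D : set K) (f phi : K -> K)
    (mu : probability (measurableTypeR K) K) : \bar K :=
  (\int[mu]_(x in (D : set (measurableTypeR K))) (phi x)%:E + entropy mu f)%E.

Definition pressure (D : set K) (f phi : K -> K) : \bar K :=
  ereal_sup [set e | exists mu, invariant D f mu /\ e = free_energy D f phi mu].

Definition equilibrium (D : set K) (f phi : K -> K)
    (mu : probability (measurableTypeR K) K) : Prop :=
  invariant D f mu /\ free_energy D f phi mu = pressure D f phi.

Definition cintegral (mu : probability (measurableTypeR K) K)
    (psi : K[i] -> K[i]) : K[i] :=
  Complex
    (Rintegral mu `[(-1)%R, 1%R] (fun x : K => complex.Re (psi (toC x))))
    (Rintegral mu `[(-1)%R, 1%R] (fun x : K => complex.Im (psi (toC x)))).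

End Pressure.

Section Discretisation.
Context {K : realType}.
Local Notation C := K[i].

(* Indices run over 'I_N = {0, ..., N-1}, so i stands for n = i + 1. *)
Definition cheb_node (N : nat) (i : 'I_N) : K :=
  cos ((2 * i + 1)%:R / (2 * N)%:R * pi).

Definition lagrange (N : nat) (k : 'I_N) (z : C) : C :=
  \prod_(m < N | m != k)
    ((z - toC (cheb_node m)) / toC (cheb_node k - cheb_node m)).

Definition transfer_matrix (I : choiceType) (g w : I -> C -> C) (N : nat)
    : 'M[C]_N :=
  \matrix_(j, k) transfer g w (lagrange k) (toC (cheb_node j)).

Definition leading_eigenvalue (N : nat) (A : 'M[C]_N) (lam : C) : Prop :=
  eigenvalue A lam /\ forall m, eigenvalue A m -> normc m <= normc lam.

Definition leading_eigenvectors (N : nat) (A : 'M[C]_N)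
    (nu : 'rV[K]_N) (h : 'cV[K]_N) : Prop :=
  nu != 0 /\ h != 0 /\
  exists lam, [/\ leading_eigenvalue A lam,
    map_mx toC nu *m A = lam *: map_mx toC nu &
    A *m map_mx toC h = lam *: map_mx toC h].

Definition discrete_measure (N : nat) (nu : 'rV[K]_N) (h : 'cV[K]_N)
    (j : 'I_N) : K :=
  (\sum_(i < N) nu 0 i * h i 0)^-1 * (nu 0 j * h j 0).

End Discretisation.

(* Main.v *)
Require Import Defs.
From HB Require Import structures.
From mathcomp Require Import ring lra zify.
Import Order.TTheory GRing.Theory Num.Theory.
Import ComplexField.Normc.
Local Open Scope classical_set_scope.
Local Open Scope ring_scope.
Set Implicit Arguments.
Unset Strict Implicit.
Unset Printing Implicit Defensive.

(** Both integrals are quotients [nu (psi h) / nu h] for a left and a right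
    eigenvector: the equilibrium measure by hypothesis, the discrete one because
    the eigenvectors of the matrix are those of the operator
    [u |-> L (interpolant of u)] of finite rank, where [L] is the transfer
    operator.  So the theorem says that the eigenvectors of [L] are stable under
    this perturbation of [L].

    All operators act on the Banach space of bounded holomorphic functions on the
    large ellipse.  Since the branches map it into the small ellipse, [L u] depends
    only on values of [u] there, and there the interpolation error of [u] is
    [O(exp (- (R - r) N))] ([interp_err]): in the Joukowski coordinate the
    coefficients of the Chebyshev expansion of [u] decay like [exp (- R k)], the
    Chebyshev polynomials grow like [exp (r k)], and interpolation is exact below
    degree [N].  This bounds the norm of the perturbation
    ([hardy_transferN_near]) and shows that [L] is a limit of operators of finite
    rank, so that Fredholm's alternative holds ([fredholm_inverse]).

    Algebraic simplicity of the leading eigenvalue [lam] of [L] makes [L - lam]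
    boundedly invertible on the kernel of [nu] ([spectral_gap_exists]).  It follows
    that a perturbation of norm [d] has an eigenvalue within [O(d)] of [lam]
    ([eigenvalue_near]), and that the quotients for an eigenvalue of the
    perturbation close to [lam] differ by [O(d)] from those for [lam]
    ([eigen_quotient_near]).

    It remains to see that the leading eigenvalue of the matrix tends to [lam].  Its
    modulus is at least [lam - O(d)] by [eigenvalue_near].  It is real, as the
    matrix and its eigenvectors are.  Its limit points are therefore real
    eigenvalues of [L] of modulus at least [lam], which is the spectral radius: only
    [lam] and [- lam] qualify.  The latter is excluded because [L] is positive on
    the real interval ([no_negative_eigenvalue]): [L] has an eigenfunction that is
    positive on the interval ([eigen_gt0]), and an eigenfunction for [- lam] would
    touch multiples of it from alternating sides along the convergent orbit of a
    contraction.

    The theory of holomorphic functions starts from first-order expansions that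
    are uniform near a point.  Cauchy's formula is proved for Riemann sums over
    roots of unity ([cauchy_avg]), and their limit along an ultrafilter takes the
    place of the contour integral. *)

Arguments normc [R] x : simpl never.

(** * Complex numbers and means over the unit circle *)

Section ComplexNorm.
Context {K : realType}.
Local Notation C := K[i].
Local Notation Re := (@complex.Re K).
Local Notation Im := (@complex.Im K).
Implicit Types (x y z : C) (a b : K).

Lemma normcE z : `|z| = toC (normc z). Proof. by []. Qed.

Lemma normc_ge0 z : 0 <= normc z.
Proof. by case: z => u v; exact: sqrtr_ge0. Qed.

Lemma normcD x y : normc (x + y) <= normc x + normc y.
Proof. by have := ler_normD x y; rewrite !normcE -rmorphD lecR. Qed.

Lemma normcN z : normc (- z) = normc z.
Proof. by apply: (@complexI K); rewrite -!normcE normrN. Qed.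

Lemma normcB x y : normc (x - y) <= normc x + normc y.
Proof. by rewrite -[normc y]normcN normcD. Qed.

Lemma normc_distC x y : normc (x - y) = normc (y - x).
Proof. by rewrite -normcN opprB. Qed.

Lemma normcX z n : normc (z ^+ n) = normc z ^+ n.
Proof. by apply: (@complexI K); rewrite rmorphXn -!normcE normrX. Qed.

Lemma normc_real a : normc (toC a) = `|a|.
Proof. by rewrite /normc /= expr0n /= addr0 sqrtr_sqr. Qed.

Lemma normc_nat n : normc (n%:R : C) = n%:R.
Proof. by rewrite -[n%:R](rmorph_nat (real_complex K)) normc_real ger0_norm. Qed.

Lemma normc_eq0 z : (normc z == 0) = (z == 0).
Proof.
by apply/eqP/eqP => [/eq0_normc //|->]; rewrite normc0.
Qed.

Lemma normc_gt0 z : (0 < normc z) = (z != 0).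
Proof. by rewrite lt_def normc_ge0 andbT normc_eq0. Qed.

Lemma normc_sum (I : Type) (s : seq I) (P : pred I) (F : I -> C) :
  normc (\sum_(i <- s | P i) F i) <= \sum_(i <- s | P i) normc (F i).
Proof.
elim/big_ind2: _ => [|x a y b xa yb|//]; first by rewrite normc0.
by apply: le_trans (normcD _ _) _; exact: lerD.
Qed.

Lemma normc_sum_le (I : Type) (s : seq I) (P : pred I) (F : I -> C)
    (G : I -> K) : (forall i, P i -> normc (F i) <= G i) ->
  normc (\sum_(i <- s | P i) F i) <= \sum_(i <- s | P i) G i.
Proof. by move=> FG; apply: le_trans (normc_sum _ _ _) _; exact: ler_sum. Qed.

Lemma normc_sum_ord n (F : 'I_n -> C) a : (forall i, normc (F i) <= a) ->
  normc (\sum_(i < n) F i) <= n%:R * a.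
Proof.
move=> Fa; rewrite mulr_natl -[n in a *+ n]card_ord -sumr_const.
exact: normc_sum_le.
Qed.

Lemma Re_normc z : `|Re z| <= normc z.
Proof.
rewrite /normc; case: z => u v /=; rewrite -sqrtr_sqr ler_wsqrtr //.
by rewrite lerDl sqr_ge0.
Qed.

Lemma Im_normc z : `|Im z| <= normc z.
Proof.
rewrite /normc; case: z => u v /=; rewrite -sqrtr_sqr ler_wsqrtr //.
by rewrite lerDr sqr_ge0.
Qed.

Lemma sqr_normc z : normc z ^+ 2 = Re z ^+ 2 + Im z ^+ 2.
Proof. by rewrite /normc; case: z => u v /=; rewrite sqr_sqrtr // addr_ge0 // sqr_ge0. Qed.

Lemma normc_ReIm z : normc z <= `|Re z| + `|Im z|.
Proof.
rewrite -(@ler_pXn2r _ 2) ?nnegrE ?normc_ge0 ?addr_ge0 //.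
rewrite sqr_normc sqrrD !real_normK ?num_real //.
have : 0 <= `|Re z| * `|Im z| by rewrite mulr_ge0.
lra.
Qed.

Lemma ReD x y : Re (x + y) = Re x + Re y. Proof. by case: x; case: y. Qed.
Lemma ImD x y : Im (x + y) = Im x + Im y. Proof. by case: x; case: y. Qed.
Lemma ReN x : Re (- x) = - Re x. Proof. by case: x. Qed.
Lemma ImN x : Im (- x) = - Im x. Proof. by case: x. Qed.
Lemma ReB x y : Re (x - y) = Re x - Re y. Proof. by rewrite ReD ReN. Qed.
Lemma ImB x y : Im (x - y) = Im x - Im y. Proof. by rewrite ImD ImN. Qed.
Lemma Re_mul x y : Re (x * y) = Re x * Re y - Im x * Im y.
Proof. by case: x; case: y. Qed.
Lemma Im_mul x y : Im (x * y) = Re x * Im y + Im x * Re y.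
Proof. by case: x; case: y. Qed.
Lemma Re_real_mul a x : Re (toC a * x) = a * Re x.
Proof. by rewrite Re_mul /= mul0r subr0. Qed.

Lemma complexP x y : Re x = Re y -> Im x = Im y -> x = y.
Proof. by case: x; case: y => ? ? ? ? /= -> ->. Qed.

Lemma Re_sum (I : Type) (s : seq I) (P : pred I) (F : I -> C) :
  Re (\sum_(i <- s | P i) F i) = \sum_(i <- s | P i) Re (F i).
Proof. by apply: big_morph => //; exact: ReD. Qed.

Lemma Im_sum (I : Type) (s : seq I) (P : pred I) (F : I -> C) :
  Im (\sum_(i <- s | P i) F i) = \sum_(i <- s | P i) Im (F i).
Proof. by apply: big_morph => //; exact: ImD. Qed.

Lemma geom_le (q : K) m : 0 <= q -> q < 1 ->
  \sum_(0 <= k < m) q ^+ k <= (1 - q)^-1.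
Proof.
move=> q0 q1; rewrite big_mkord.
rewrite -[leRHS]mul1r ler_pdivlMr ?subr_gt0 // mulrC.
have : 0 <= q ^+ m by exact: exprn_ge0.
have -> : (1 - q) * \sum_(i < m) q ^+ i = 1 - q ^+ m.
  by rewrite -opprB mulNr -subrX1 opprB.
lra.
Qed.

Lemma normc_sum_geom (F : nat -> C) (c q : K) m : 0 <= c -> 0 <= q -> q < 1 ->
  (forall k, (k < m)%N -> normc (F k) <= c * q ^+ k) ->
  normc (\sum_(k < m) F k) <= c * (1 - q)^-1.
Proof.
move=> c0 q0 q1 Fc.
have h := @normc_sum_le _ (index_enum 'I_m) xpredT F (fun k => c * q ^+ k).
apply: le_trans (h _) _ => [i _|]; first exact/Fc/ltn_ord.
rewrite -mulr_sumr ler_wpM2l //.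
by have := geom_le m q0 q1; rewrite big_mkord.
Qed.

End ComplexNorm.

Section Ultralimit.
Context {K : realType}.
Local Notation C := K[i].
Local Notation Re := (@complex.Re K).
Local Notation Im := (@complex.Im K).

Implicit Types (u v : nat -> C) (B e a : K) (c l : C).

(** A free ultrafilter.  Along it every bounded sequence has a limit, which
    depends linearly on the sequence; it replaces subsequences in compactness
    arguments and limits whose existence would have to be proved. *)
Definition ultra_nat : set_system nat :=
  sval (cid (ultraFilterLemma eventually_filter)).

Lemma ultra_natP : UltraFilter ultra_nat.
Proof. by rewrite /ultra_nat; case: cid => U []. Qed.

#[local] Existing Instance ultra_natP.

Instance ultra_nat_proper : ProperFilter ultra_nat.
Proof. exact: ultra_proper. Qed.

Lemma ultra_nat_ge N : ultra_nat [set n | (N <= n)%N].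
Proof.
rewrite /ultra_nat; case: cid => U /= [_]; apply; exists N => // n /=.
Qed.

(** The limit of a bounded sequence along the ultrafilter, as a cut. *)
Definition rulim (u : nat -> K) : K :=
  sup [set a | ultra_nat [set n | a <= u n]].

Lemma rulimP (u : nat -> K) B e : (forall n, `|u n| <= B) -> 0 < e ->
  ultra_nat [set n | `|u n - rulim u| <= e].
Proof.
move=> uB e0; rewrite /rulim; set A := [set a : K | _].
have A_nonempty : A !=set0.
  exists (- B); rewrite /A /=; apply: filterS filterT => n _ /=.
  by have := uB n; rewrite ler_norml => /andP[].
have A_bounded : has_sup A.
  split=> //; exists B => a /= Aa.
  have [n /= an] := filter_ex Aa.
  by have := uB n; rewrite ler_norml => /andP[_]; exact: le_trans.
have [b Ab lb] : exists2 b, A b & sup A - e < b by exact: sup_adherent.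
have nA : ~ A (sup A + e / 2).
  by move=> H; have := ub_le_sup A_bounded.2 H; lra.
have [//|] := in_ultra_setVsetC [set n | sup A + e / 2 <= u n] ultra_natP.
move=> H; apply: filterS (filterI Ab H) => n /= [bn /negP].
rewrite -ltNge => un; rewrite ler_norml; lra.
Qed.

Definition ulim (u : nat -> C) : C :=
  Complex (rulim (Re \o u)) (rulim (Im \o u)).

Arguments ulim u : simpl never.

Lemma ulimP u B e : (forall n, normc (u n) <= B) -> 0 < e ->
  ultra_nat [set n | normc (u n - ulim u) <= e].
Proof.
move=> uB e0.
have e20 : 0 < e / 2 by lra.
have HR := @rulimP (Re \o u) B _ (fun n => le_trans (Re_normc _) (uB n)) e20.
have HI := @rulimP (Im \o u) B _ (fun n => le_trans (Im_normc _) (uB n)) e20.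
apply: filterS (filterI HR HI) => n /= [h1 h2].
apply: le_trans (normc_ReIm _) _.
rewrite ReB ImB /=; lra.
Qed.

Lemma ulim_unique u B l : (forall n, normc (u n) <= B) ->
  (forall e, 0 < e -> ultra_nat [set n | normc (u n - l) <= e]) -> ulim u = l.
Proof.
move=> uB ul; apply/eqP; rewrite -subr_eq0 -normc_eq0; apply/eqP/le_anti.
rewrite normc_ge0 andbT; apply/ler_addgt0Pl => e e0.
have e20 : 0 < e / 2 by lra.
have [n /= [h1 h2]] := filter_ex (filterI (ulimP uB e20) (ul _ e20)).
have -> : ulim u - l = (u n - l) - (u n - ulim u) by ring.
by apply: le_trans (normcB _ _) _; lra.
Qed.

Lemma eq_ulim u v : (forall n, u n = v n) -> ulim u = ulim v.
Proof. by move=> /funext ->. Qed.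

Lemma ulimD u v B (B' : K) : (forall n, normc (u n) <= B) ->
  (forall n, normc (v n) <= B') ->
  ulim (fun n => u n + v n) = ulim u + ulim v.
Proof.
move=> uB vB; apply: (@ulim_unique _ (B + B')) => [n|e e0].
  by apply: le_trans (normcD _ _) _; exact: lerD.
have e20 : 0 < e / 2 by lra.
apply: filterS (filterI (ulimP uB e20) (ulimP vB e20)) => n /= [h1 h2].
have -> : u n + v n - (ulim u + ulim v) = (u n - ulim u) + (v n - ulim v).
  by ring.
by apply: le_trans (normcD _ _) _; lra.
Qed.

Lemma ulimZ u B c : (forall n, normc (u n) <= B) ->
  ulim (fun n => c * u n) = c * ulim u.
Proof.
move=> uB; apply: (@ulim_unique _ (normc c * B)) => [n|e e0].
  by rewrite normcM ler_wpM2l ?normc_ge0.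
have c0 := normc_ge0 c.
have c1 : 0 < normc c + 1 by lra.
have e20 : 0 < e / (normc c + 1) by rewrite divr_gt0.
apply: filterS (ulimP uB e20) => n /=; rewrite ler_pdivlMr // => h1.
rewrite -mulrBr normcM.
have := normc_ge0 (u n - ulim u); nra.
Qed.

Lemma ulimM u v B B' : (forall n, normc (u n) <= B) ->
  (forall n, normc (v n) <= B') ->
  ulim (fun n => u n * v n) = ulim u * ulim v.
Proof.
move=> uB vB; apply: (@ulim_unique _ (B * B')) => [n|e e0].
  by rewrite normcM ler_pM ?normc_ge0.
have B0 : 0 <= B := le_trans (normc_ge0 _) (uB 0%N).
have V0 := normc_ge0 (ulim v).
have S0 : 0 < B + normc (ulim v) + 1 by lra.
have e20 : 0 < e / (B + normc (ulim v) + 1) by rewrite divr_gt0.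
apply: filterS (filterI (ulimP uB e20) (ulimP vB e20)) => n.
rewrite /= !ler_pdivlMr // => -[h1 h2].
have -> : u n * v n - ulim u * ulim v =
  u n * (v n - ulim v) + (u n - ulim u) * ulim v by ring.
apply: le_trans (normcD _ _) _; rewrite !normcM.
have := uB n; have := normc_ge0 (u n).
have := normc_ge0 (v n - ulim v); have := normc_ge0 (u n - ulim u).
move: h1 h2; set x := normc (u n - _); set y := normc (v n - _).
set p := normc (u n); set q := normc (ulim v) in V0 S0 e20 *.
move=> h1 h2 x0 y0 p0 pB.
have le1 : p * y <= B * y by rewrite ler_wpM2r.
have E1 : B * y <= B * (e / (B + q + 1)).
  by rewrite ler_wpM2l // ler_pdivlMr.
have E2 : x * q <= (e / (B + q + 1)) * q.
  by rewrite ler_wpM2r // ler_pdivlMr.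
have : (e / (B + q + 1)) * (B + q + 1) = e by rewrite divfK // gt_eqF.
move: E1 E2 e20; set k := e / _ => *; nra.
Qed.

Lemma ulim_le u B (B' : K) : (forall n, normc (u n) <= B) ->
  ultra_nat [set n | normc (u n) <= B'] -> normc (ulim u) <= B'.
Proof.
move=> uB uB'; apply/ler_addgt0Pl => e e0.
have [n /= [h1 h2]] := filter_ex (filterI (ulimP uB e0) uB').
have -> : ulim u = u n - (u n - ulim u) by ring.
by apply: le_trans (normcB _ _) _; lra.
Qed.

Lemma ulim_const c : ulim (fun=> c) = c.
Proof.
apply: (@ulim_unique _ (normc c)) => // e e0.
by apply: filterS filterT => n _ /=; rewrite subrr normc0 ltW.
Qed.

Lemma ulim_Re_ge u B a : (forall n, normc (u n) <= B) ->
  (forall n, a <= Re (u n)) -> a <= Re (ulim u).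
Proof.
move=> uB ua; apply/ler_addgt0Pl => e e0.
have [n h1] := filter_ex (ulimP uB e0); rewrite /= in h1.
have := le_trans (Re_normc _) h1; rewrite ReB ler_norml => /andP[].
by have := ua n; move=> *; lra.
Qed.

Lemma rulim_range (s : nat -> K) (a b : K) : (forall n, a <= s n <= b) ->
  a <= rulim s <= b /\ ulim (fun n => toC (s n)) = toC (rulim s).
Proof.
move=> sab.
have bnd n : normc (toC (s n)) <= `|a| + `|b|.
  rewrite normc_real; have /andP[h1 h2] := sab n.
  have := ler_norm b; have := ler_normr (- a) a; have := normr_ge0 a.
  have := ler_norm (- a); rewrite normrN ler_norml => *.
  have := normr_ge0 b; move=> *; apply/andP; split; lra.
have E : ulim (fun n => toC (s n)) = toC (rulim s).
  have I0 : complex.Im (ulim (fun n => toC (s n))) = 0.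
    have -> : (0 : K) = complex.Im (ulim (fun=> 0)) by rewrite ulim_const.
    by [].
  by apply: complexP.
split=> //; have -> : rulim s = Re (ulim (fun n => toC (s n))) by rewrite E.
apply/andP; split.
  by apply: ulim_Re_ge bnd _ => n /=; have /andP[] := sab n.
have := @ulim_Re_ge (fun n => -1 * toC (s n)) (`|a| + `|b|) (- b).
rewrite (ulimZ _ bnd) mulN1r ReN lerN2; apply=> n; rewrite mulN1r ?normcN //.
by rewrite ReN /= lerN2; have /andP[] := sab n.
Qed.

End Ultralimit.
#[global] Existing Instance ultra_nat_proper.

Arguments ulim {K} u : simpl never.

Section CircleMean.
Context {K : realType}.
Local Notation C := K[i].
Implicit Types (F G : C -> C) (B : K) (w z c l : C).

(** [exp (i t)]. *)
Definition cis (t : K) : C := Complex (cos t) (sin t).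

Lemma cisD s t : cis (s + t) = cis s * cis t.
Proof. by apply: complexP; rewrite ?Re_mul ?Im_mul /= ?cosD ?sinD //; ring. Qed.

Lemma normc_cis t : normc (cis t) = 1.
Proof. by rewrite /normc /= cos2Dsin2 sqrtr1. Qed.

Lemma cis_neq0 t : cis t != 0.
Proof. by rewrite -normc_eq0 normc_cis oner_neq0. Qed.

Lemma cisX t n : cis t ^+ n = cis (n%:R * t).
Proof.
elim: n => [|n IH].
  by rewrite mul0r /cis cos0 sin0; apply: complexP.
by rewrite exprS IH -cisD; congr cis; rewrite -natr1; ring.
Qed.

Lemma cis2pi : cis (2 * pi) = 1.
Proof.
have -> : 2 * pi = pi *+ 2 :> K by rewrite mulr_natl.
by apply: complexP; rewrite /cis /= ?cos2pi ?sin2pi.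
Qed.

Lemma cis_neq1 t : 0 < t -> t < 2 * pi -> cis t != 1.
Proof.
move=> t0 t1; apply/negP => /eqP [] cos1 _.
have s0 : 0 < sin (t / 2) by apply: sin_gt0_pi; apply/andP; split; lra.
have tE : t = t / 2 + t / 2 by field.
have := cos2Dsin2 (t / 2); move: cos1; rewrite {1}tE cosD; nra.
Qed.

(** The chord is at most the sum of its two legs, each at most the arc. *)
Lemma normc_cis_sub1 t : normc (cis t - 1) <= 2 * `|t|.
Proof.
apply: le_trans (normc_ReIm _) _; rewrite ReB ImB /= subr0.
have lip (f df : K -> K) (s : K) :
    (forall x : K, is_derive x (1 : K) f (df x)) ->
    (forall x, `|df x| <= 1) -> `|f s - f 0| <= `|s|.
  move=> fd dfle.
  have cf (a b : K) : {within `[a, b], continuous f}.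
    by apply: derivable_within_continuous => x _; apply: ex_derive.
  have [s0|s0|<-] := ltgtP 0 s; last by rewrite subrr normr0.
  - have [x _ ->] := @MVT _ f df _ _ s0 (fun x _ => fd x) (cf _ _).
    by rewrite normrM subr0 ler_piMl.
  - have [x _ E] := @MVT _ f df _ _ s0 (fun x _ => fd x) (cf _ _).
    by rewrite distrC E normrM sub0r normrN ler_piMl.
have := lip _ (fun x => - sin x) t (fun x => is_derive_cos x).
have := lip _ _ t (fun x => is_derive_sin x) (fun x => cos_max x).
rewrite cos0 sin0 subr0 => h2 h1.
have h3 : `|cos t - 1| <= `|t| by apply: h1 => x; rewrite normrN sin_max.
lra.
Qed.

Definition circ (n : nat) : C := cis (2 * pi / n%:R).

Lemma normc_circX n j : normc (circ n ^+ j) = 1.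
Proof. by rewrite normcX normc_cis expr1n. Qed.

Lemma circXn n : (0 < n)%N -> circ n ^+ n = 1.
Proof.
move=> n0; rewrite cisX -cis2pi; congr cis.
by rewrite mulrC divfK // pnatr_eq0 -lt0n.
Qed.

Lemma circX_neq1 n k : (0 < k < n)%N -> circ n ^+ k != 1.
Proof.
case/andP => k0 kn; have n0 : 0 < n%:R :> K by rewrite ltr0n; lia.
rewrite cisX; apply: cis_neq1.
  by rewrite mulr_gt0 ?ltr0n // divr_gt0 // mulr_gt0 ?pi_gt0.
rewrite mulrCA -[ltRHS]mulr1 ltr_pM2l ?mulr_gt0 ?pi_gt0 //.
  by rewrite mulrC ltr_pdivrMl // mulr1 ltr_nat.
Qed.

Lemma unity_sum_eq0 (z : C) n : z != 1 -> z ^+ n = 1 -> \sum_(j < n) z ^+ j = 0.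
Proof.
move=> z1 zn; have := subrX1 z n; rewrite zn subrr => /esym/eqP.
by rewrite mulf_eq0 subr_eq0 (negPf z1) /= => /eqP.
Qed.

Lemma circ_sum n k : (0 < k < n)%N -> \sum_(j < n) (circ n ^+ j) ^+ k = 0.
Proof.
move=> kn; under eq_bigr do rewrite exprAC.
apply: unity_sum_eq0; first exact: circX_neq1.
by rewrite exprAC circXn ?expr1n //; lia.
Qed.

Lemma circ_sumV n k : (0 < k < n)%N -> \sum_(j < n) (circ n ^+ j) ^- k = 0.
Proof.
move=> kn; under eq_bigr do rewrite exprAC -exprVn.
apply: unity_sum_eq0; first by rewrite invr_eq1 circX_neq1.
by rewrite exprVn exprAC circXn ?expr1n ?invr1 //; lia.
Qed.

Definition avg (n : nat) F : C := n%:R^-1 * \sum_(j < n) F (circ n ^+ j).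

Definition circle_le F B := forall w, normc w = 1 -> normc (F w) <= B.

Lemma circle_le_ge0 F B : circle_le F B -> 0 <= B.
Proof.
by move=> /(_ 1 (normc1 K)); apply: le_trans; exact: normc_ge0.
Qed.

Lemma avg_le F B n : circle_le F B -> normc (avg n F) <= B.
Proof.
move=> FB; have B0 := circle_le_ge0 FB.
have [->|n0] := posnP n; first by rewrite /avg big_ord0 mulr0 normc0.
have nK : 0 < n%:R :> K by rewrite ltr0n.
rewrite normcM normcV normc_nat mulrC ler_pdivrMr //.
have -> : B * n%:R = \sum_(j < n) B by rewrite sumr_const card_ord mulr_natr.
by apply: normc_sum_le => j _; apply: FB; exact: normc_circX.
Qed.

(** The mean over the unit circle.  Taking the limit along an ultrafilter makes
    it a linear functional on all bounded functions, so that no integrability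
    has to be proved. *)
Definition mean F : C := ulim (fun n => avg n F).

Lemma mean_le F B : circle_le F B -> normc (mean F) <= B.
Proof.
move=> FB; apply: (@ulim_le _ _ B) => [n|]; first exact: avg_le.
by apply: filterS filterT => n _ /=; exact: avg_le.
Qed.

Lemma eq_avg F G n : (forall w, normc w = 1 -> F w = G w) -> avg n F = avg n G.
Proof.
move=> FG; congr (_ * _); apply: eq_bigr => j _; apply: FG.
exact: normc_circX.
Qed.

Lemma eq_mean F G : (forall w, normc w = 1 -> F w = G w) -> mean F = mean G.
Proof. by move=> FG; apply: eq_ulim => n; exact: eq_avg. Qed.

Lemma avgD F G n : avg n (fun w => F w + G w) = avg n F + avg n G.
Proof. by rewrite /avg big_split mulrDr. Qed.

Lemma avgZ F c n : avg n (fun w => c * F w) = c * avg n F.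
Proof. by rewrite /avg -mulr_sumr mulrCA. Qed.

Lemma meanD F G B (B' : K) : circle_le F B -> circle_le G B' ->
  mean (fun w => F w + G w) = mean F + mean G.
Proof.
move=> FB GB; rewrite /mean -(@ulimD _ _ _ B B').
- by apply: eq_ulim => n; rewrite avgD.
- by move=> n; exact: avg_le.
- by move=> n; exact: avg_le.
Qed.

Lemma meanZ F c B : circle_le F B -> mean (fun w => c * F w) = c * mean F.
Proof.
move=> FB; rewrite /mean -(@ulimZ _ _ B).
- by apply: eq_ulim => n; rewrite avgZ.
- by move=> n; exact: avg_le.
Qed.

Lemma mean_lim F B l (D : K) N : circle_le F B ->
  (forall n, (N < n)%N -> normc (avg n F - l) <= D / n%:R) -> mean F = l.
Proof.
move=> FB Fl; apply: (@ulim_unique _ _ B) => [n|e e0]; first exact: avg_le.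
have ex : exists M : nat, (N < M)%N /\ D / e <= M%:R.
  exists (Num.truncn (D / e) + N.+1)%N; split; first by lia.
  have := @truncnS_gt _ (D / e); rewrite natrD -!natr1 => h.
  have : 0 <= N%:R :> K by []. 
  by move=> h'; lra.
have [M [NM MB]] := ex.
apply: filterS (ultra_nat_ge M) => n /= Mn.
apply: le_trans (Fl _ (leq_trans NM Mn)) _.
have n0 : 0 < n%:R :> K by rewrite ltr0n; lia.
rewrite ler_pdivrMr // mulrC -ler_pdivrMr //.
by apply: le_trans MB _; rewrite ler_nat.
Qed.

Lemma mean_const c : mean (fun=> c) = c.
Proof.
apply: (@mean_lim _ (normc c) _ 0 1) => [w _ //|n n1].
rewrite /avg sumr_const card_ord -[c *+ n]mulr_natl mulrA mulVf ?mul1r.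
  by rewrite subrr normc0 mul0r.
by rewrite pnatr_eq0; lia.
Qed.

Lemma mean_eventually0 F B N : circle_le F B ->
  (forall n, (N < n)%N -> avg n F = 0) -> mean F = 0.
Proof.
move=> FB F0; apply: (@ulim_unique _ _ B) => [n|e e0]; first exact: avg_le.
apply: filterS (ultra_nat_ge N.+1) => n /= Nn.
by rewrite F0 // subrr normc0 ltW.
Qed.

(** The averages over the [n]-th roots of unity vanish once [n > k > 0]. *)
Lemma mean_expV k : mean (fun w => w ^- k) = (k == 0%N)%:R.
Proof.
have b j : circle_le (fun w => w ^- j) 1.
  by move=> w w1; rewrite normcV normcX w1 expr1n invr1.
case: k => [|k] /=.
  by rewrite -[RHS]mean_const; apply: eq_mean => w _; rewrite expr0 invr1.
apply: (@mean_eventually0 _ 1 k.+1) => // n kn.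
by rewrite /avg circ_sumV ?mulr0.
Qed.

(** A geometrically convergent expansion may be integrated term by term. *)
Lemma mean_series F B G (t : nat -> C) (A q : K) : circle_le F B ->
  (forall w m, normc w = 1 ->
     normc (G w - \sum_(k < m) t k * w ^- k) <= A * q ^+ m) ->
  forall m, normc (mean (fun w => F w * G w)
     - \sum_(k < m) t k * mean (fun w => F w * w ^- k)) <= B * (A * q ^+ m).
Proof.
move=> FB GA m; have B0 := circle_le_ge0 FB.
have FkB k : circle_le (fun w => F w * w ^- k) B.
  move=> w w1; rewrite normcM normcV normcX w1 expr1n invr1 mulr1; exact: FB.
have sumE : forall p, exists2 D : K,
    circle_le (fun w => F w * \sum_(k < p) t k * w ^- k) D &
    mean (fun w => F w * \sum_(k < p) t k * w ^- k) =
      \sum_(k < p) t k * mean (fun w => F w * w ^- k).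
  elim=> [|p [D DB IH]].
    exists 0 => [w _|]; first by rewrite big_ord0 mulr0 normc0.
    rewrite big_ord0 -[RHS]mean_const; apply: eq_mean => w _.
    by rewrite big_ord0 mulr0.
  have DB' : circle_le (fun w => t p * (F w * w ^- p)) (normc (t p) * B).
    move=> w w1; rewrite normcM ler_wpM2l ?normc_ge0 //; exact: FkB.
  exists (D + normc (t p) * B) => [w w1|].
    rewrite big_ord_recr mulrDr /= mulrCA; apply: le_trans (normcD _ _) _.
    by apply: lerD; [exact: DB|exact: DB'].
  rewrite big_ord_recr /= -IH -(meanZ _ (FkB p)) -(meanD DB DB').
  by apply: eq_mean => w _; rewrite big_ord_recr mulrDr /= mulrCA.
have [D DB <-] := sumE m.
have DB' : circle_le (fun w => F w * (G w - \sum_(k < m) t k * w ^- k))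
    (B * (A * q ^+ m)).
  move=> w w1; rewrite normcM ler_pM ?normc_ge0 //; [exact: FB|exact: GA].
have -> : (fun w => F w * G w) =
    (fun w => F w * (\sum_(k < m) t k * w ^- k) +
              F w * (G w - \sum_(k < m) t k * w ^- k)).
  by apply/funext => w; rewrite -mulrDr addrC subrK.
rewrite (meanD DB DB') addrC addKr.
exact: mean_le.
Qed.

End CircleMean.

(** * Holomorphic functions *)

Section Holomorphic.
Context {K : realType}.
Local Notation C := K[i].
Implicit Types (f g : C -> C) (z y c d : C) (T B : K).

(** A first-order expansion with quadratic error.  A single constant bounds the
    slope, the error and the inverse of the radius of validity, so that it is
    enough to increase it. *)
Definition quad f T z := exists d, normc d <= T /\ forall y,
  normc (y - z) <= T^-1 ->
  normc (f y - f z - d * (y - z)) <= T * normc (y - z) ^+ 2.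

(** Holomorphy, as a first-order expansion that is uniform in a neighbourhood.
    In this form it passes to products and compositions by elementary estimates,
    it is what the Riemann sums of Cauchy's formula need, and it is equivalent to
    analyticity on open sets ([analytic_hol], [hol_analytic]). *)
Definition hol f z0 := exists T, 0 < T /\ forall z,
  normc (z - z0) <= T^-1 -> quad f T z.

Lemma quad_mono f T T' z : 0 < T -> T <= T' -> quad f T z -> quad f T' z.
Proof.
move=> T0 TT' [d [dT H]]; exists d; split=> [|y yz]; first exact: le_trans TT'.
apply: le_trans (H _ _) _; last by rewrite ler_wpM2r // sqr_ge0.
by apply: le_trans yz _; rewrite lef_pV2 ?posrE //; exact: lt_le_trans TT'.
Qed.

Lemma hol_mono f z0 T : 0 < T ->
  (forall z, normc (z - z0) <= T^-1 -> quad f T z) ->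
  forall T', T <= T' -> forall z, normc (z - z0) <= T'^-1 -> quad f T' z.
Proof.
move=> T0 H T' TT' z zz0; apply: (quad_mono T0 TT'); apply: H.
by apply: le_trans zz0 _; rewrite lef_pV2 ?posrE //; exact: lt_le_trans TT'.
Qed.

Lemma quad_lip f T z y : 1 <= T -> quad f T z -> normc (y - z) <= T^-1 ->
  normc (f y - f z) <= 2 * T * normc (y - z).
Proof.
move=> T1 [d [dT H]] yz.
have -> : f y - f z = (f y - f z - d * (y - z)) + d * (y - z) by ring.
apply: le_trans (normcD _ _) _; rewrite normcM.
have y0 := normc_ge0 (y - z).
have h := H _ yz.
have T0 : 0 < T by lra.
have i1 : T^-1 <= 1 by rewrite invf_le1.
have le1 : normc d * normc (y - z) <= T * normc (y - z) by rewrite ler_wpM2r.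
have le2 : T * normc (y - z) ^+ 2 <= T * normc (y - z).
  by rewrite ler_wpM2l ?(ltW T0) // expr2 ler_piMl //; lra.
lra.
Qed.

Lemma hol_ge1 f z0 : hol f z0 -> exists T, 1 <= T /\ forall z,
  normc (z - z0) <= T^-1 -> quad f T z.
Proof.
move=> [T [T0 H]]; exists (T + 1); split; first by lra.
by apply: (hol_mono T0 H); lra.
Qed.

Lemma eq_hol f g z0 e : 0 < e -> (forall y, normc (y - z0) < e -> f y = g y) ->
  hol f z0 -> hol g z0.
Proof.
move=> e0 fg [T [T0 H]].
have i0 : 0 < 3 / e by rewrite divr_gt0.
have S0 : 0 < T + 3 / e by lra.
have Se : 2 * (T + 3 / e)^-1 < e.
  rewrite ltr_pdivrMr // mulrDr [e * (3 / e)]mulrC divfK ?gt_eqF //.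
  by have := mulr_gt0 e0 T0; lra.
exists (T + 3 / e); split=> // z zz0.
have [|d [dT Hd]] := @hol_mono _ _ _ T0 H (T + 3 / e) _ z zz0; first by lra.
exists d; split=> // y yz.
rewrite -!fg; first exact: Hd.
  by have := invr_gt0 (T + 3/e); rewrite S0 => *; lra.
have -> : y - z0 = (y - z) + (z - z0) by ring.
apply: le_lt_trans (normcD _ _) _; lra.
Qed.

Lemma hol_const c z0 : hol (fun=> c) z0.
Proof.
exists 1; split=> // z _; exists 0; rewrite normc0; split=> // y _.
by rewrite mul0r !subrr normc0 mul1r sqr_ge0.
Qed.

Lemma hol_id z0 : hol (fun z => z) z0.
Proof.
exists 1; split=> // z _; exists 1; rewrite normc1; split=> // y _.
by rewrite mul1r subrr normc0 mul1r sqr_ge0.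
Qed.

Lemma hol_pair f g z0 : hol f z0 -> hol g z0 -> exists T, 1 <= T /\ forall z,
  normc (z - z0) <= T^-1 -> quad f T z /\ quad g T z.
Proof.
move=> /hol_ge1[T [T1 H]] /hol_ge1[S [S1 G]]; exists (T + S); split; first by lra.
move=> z zz0; split.
  by apply: (@hol_mono _ _ T _ H) zz0; lra.
by apply: (@hol_mono _ _ S _ G) zz0; lra.
Qed.

Lemma holD f g z0 : hol f z0 -> hol g z0 -> hol (fun z => f z + g z) z0.
Proof.
move=> hf hg; have [T [T1 H]] := hol_pair hf hg.
have T0 : 0 < T by lra.
exists (2 * T); split; first by lra.
have le1 : (2 * T)^-1 <= T^-1 by rewrite lef_pV2 ?posrE //; lra.
move=> z zz0; have [|[d [dT Hd]] [e [eT He]]] := H z; first by lra.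
exists (d + e); split=> [|y yz].
  by apply: le_trans (normcD _ _) _; lra.
have -> : f y + g y - (f z + g z) - (d + e) * (y - z) =
  (f y - f z - d * (y - z)) + (g y - g z - e * (y - z)) by ring.
apply: le_trans (normcD _ _) _.
have := Hd y (le_trans yz le1); have := He y (le_trans yz le1); lra.
Qed.

Lemma holM f g z0 : hol f z0 -> hol g z0 -> hol (fun z => f z * g z) z0.
Proof.
move=> hf hg; have [T [T1 H]] := hol_pair hf hg.
have T0 : 0 < T by lra.
have i1 : T^-1 <= 1 by rewrite invf_le1.
have i0 : 0 < T^-1 by rewrite invr_gt0.
pose B := normc (f z0) + normc (g z0) + 2 * T.
have B1 : 1 <= B.
  by rewrite /B; have := normc_ge0 (f z0); have := normc_ge0 (g z0); lra.
have [Hz0f Hz0g] : quad f T z0 /\ quad g T z0.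
  by apply: H; rewrite subrr normc0 ltW.
have bnd (h : C -> C) z : quad h T z0 -> normc (h z0) <= B - 2 * T ->
    normc (z - z0) <= T^-1 -> normc (h z) <= B.
  move=> hq hB zz0; have := quad_lip T1 hq zz0.
  have -> : h z = (h z - h z0) + h z0 by ring.
  have -> : h z - h z0 + h z0 - h z0 = h z - h z0 by ring.
  move=> h1; apply: le_trans (normcD _ _) _.
  have : 2 * T * normc (z - z0) <= 2 * T by rewrite ler_piMr //; lra.
  lra.
have fB z : normc (z - z0) <= T^-1 -> normc (f z) <= B.
  by apply: bnd => //; rewrite /B; have := normc_ge0 (g z0); lra.
have gB z : normc (z - z0) <= T^-1 -> normc (g z) <= B.
  by apply: bnd => //; rewrite /B; have := normc_ge0 (f z0); lra.
have TB : 1 <= T * B by rewrite mulr_ege1.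
have TT : 1 <= T * T by rewrite mulr_ege1.
pose S := 2 * T + 2 * (T * B) + 2 * T * T.
have le1 : S^-1 <= T^-1 / 2.
  by rewrite -invfM lef_pV2 ?posrE /S //; lra.
exists S; split; first by rewrite /S; lra.
move=> z zz0; have [|[d [dT Hd]] qg] := H z; first by lra.
have [e [eT He]] := qg.
have gz : normc (g z) <= B by apply: gB; lra.
have fz : normc (f z) <= B by apply: fB; lra.
exists (d * g z + f z * e); split=> [|y yz].
  apply: le_trans (normcD _ _) _; rewrite !normcM.
  have h1 : normc d * normc (g z) <= T * B by rewrite ler_pM ?normc_ge0.
  have h2 : normc (f z) * normc e <= B * T by rewrite ler_pM ?normc_ge0.
  rewrite /S; lra.
have yzT : normc (y - z) <= T^-1 by lra.
have gy : normc (g y) <= B.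
  apply: gB; have -> : y - z0 = (y - z) + (z - z0) by ring.
  apply: le_trans (normcD _ _) _; lra.
have -> : f y * g y - f z * g z - (d * g z + f z * e) * (y - z) =
  (f y - f z - d * (y - z)) * g y + d * (y - z) * (g y - g z)
   + f z * (g y - g z - e * (y - z)) by ring.
apply: le_trans (normcD _ _) _; apply: le_trans (lerD (normcD _ _) (lexx _)) _.
rewrite !normcM.
have h1 := Hd y yzT; have h2 := He y yzT; have h3 := quad_lip T1 qg yzT.
set D := normc (y - z) in h1 h2 h3 *.
have D0 : 0 <= D by exact: normc_ge0.
have k1 : normc (f y - f z - d * (y - z)) * normc (g y) <= T * D ^+ 2 * B.
  by rewrite ler_pM ?normc_ge0.
have k2 : normc d * D * normc (g y - g z) <= T * D * (2 * T * D).
  by rewrite ler_pM ?normc_ge0 ?mulr_ge0 ?normc_ge0 // ler_pM ?normc_ge0.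
have k3 : normc (f z) * normc (g y - g z - e * (y - z)) <= B * (T * D ^+ 2).
  by rewrite ler_pM ?normc_ge0.
have D20 : 0 <= D ^+ 2 by rewrite sqr_ge0.
have : 0 <= T * D ^+ 2 by rewrite mulr_ge0 // ltW.
by rewrite /S => ?; lra.
Qed.

Lemma holZ f z0 c : hol f z0 -> hol (fun z => c * f z) z0.
Proof. by move=> hf; apply: holM => //; exact: hol_const. Qed.

Lemma hol_sum (I : Type) (s : seq I) (P : pred I) (F : I -> C -> C) z0 :
  (forall i, P i -> hol (F i) z0) -> hol (fun z => \sum_(i <- s | P i) F i z) z0.
Proof.
move=> HF; elim: s => [|i s IH].
  have -> : (fun z => \sum_(i <- [::] | P i) F i z) = (fun=> 0).
    by apply/funext => z; rewrite big_nil.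
  exact: hol_const.
have -> : (fun z => \sum_(j <- i :: s | P j) F j z) =
    (fun z => (if P i then F i z else 0) + \sum_(j <- s | P j) F j z).
  by apply/funext => z; rewrite big_cons; case: (P i); rewrite ?add0r.
have hi : hol (fun z => if P i then F i z else 0) z0.
  by case Pi: (P i); [exact: HF|exact: hol_const].
exact: (holD hi IH).
Qed.

Lemma hol_comp f g z0 : hol f z0 -> hol g (f z0) -> hol (fun z => g (f z)) z0.
Proof.
move=> /hol_ge1[T [T1 H]] /hol_ge1[S [S1 G]].
have T0 : 0 < T by lra.
have S0 : 0 < S by lra.
have i0 : 0 < T^-1 by rewrite invr_gt0.
have q0 : quad f T z0 by apply: H; rewrite subrr normc0 ltW.
have TS : 1 <= T * S by rewrite mulr_ege1.
have TTS : 1 <= T * T * S by rewrite !mulr_ege1.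
have TS_T : T <= T * S by rewrite ler_peMr // ltW.
pose W := 4 * (T * T * S) + 2 * (T * S).
have le1 : W^-1 <= T^-1 by rewrite lef_pV2 ?posrE /W //; lra.
have le2 : 2 * T * W^-1 <= S^-1.
  rewrite -[leRHS]mul1r ler_pdivlMr // mulrAC ler_pdivrMr /W; last by lra.
  lra.
exists W; split; first by rewrite /W; lra.
move=> z zz0; have zT : normc (z - z0) <= T^-1 by lra.
have qz := H z zT; have [d [dT Hd]] := qz.
have fz : normc (f z - f z0) <= S^-1.
  apply: le_trans (quad_lip T1 q0 zT) _; apply: le_trans _ le2.
  by rewrite ler_wpM2l //; lra.
have [e [eS He]] := G _ fz.
exists (e * d); split=> [|y yz].
  rewrite normcM; have : normc e * normc d <= S * T by rewrite ler_pM ?normc_ge0.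
  rewrite /W; lra.
have yT : normc (y - z) <= T^-1 by lra.
have fy : normc (f y - f z) <= 2 * T * normc (y - z) by exact: quad_lip qz yT.
have fyS : normc (f y - f z) <= S^-1.
  apply: le_trans fy _; apply: le_trans _ le2.
  by rewrite ler_wpM2l //; lra.
have -> : g (f y) - g (f z) - e * d * (y - z) =
  (g (f y) - g (f z) - e * (f y - f z)) + e * (f y - f z - d * (y - z)) by ring.
apply: le_trans (normcD _ _) _; rewrite normcM.
have h1 := He _ fyS; have h2 := Hd _ yT.
set D := normc (y - z) in fy h2 *.
have D0 : 0 <= D by exact: normc_ge0.
have k1 : S * normc (f y - f z) ^+ 2 <= S * (2 * T * D) ^+ 2.
  by rewrite ler_wpM2l ?(ltW S0) // lerXn2r ?nnegrE ?normc_ge0 // !mulr_ge0 // ltW.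
have k2 : normc e * normc (f y - f z - d * (y - z)) <= S * (T * D ^+ 2).
  by rewrite ler_pM ?normc_ge0.
have D20 : 0 <= D ^+ 2 by rewrite sqr_ge0.
have : 0 <= T * S * D ^+ 2 by rewrite mulr_ge0 //; lra.
by rewrite /W => ?; lra.
Qed.

(** * Cauchy's formula on closed curves *)

(** Sets on which ultralimits play the part of sequential compactness. *)
Definition ucompact (A : set C) := (exists B, forall z, A z -> normc z <= B) /\
  forall u : nat -> C, (forall n, A (u n)) -> A (ulim u).

(** Otherwise there are points where larger and larger constants fail, and their
    ultralimit contradicts [hol]. *)
Lemma hol_ucompact A f : ucompact A -> (forall z, A z -> hol f z) ->
  exists T, 1 <= T /\ forall z, A z -> quad f T z.
Proof.
move=> [[B AB] Alim] Af; apply: contrapT => no.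
have bad n : exists z, A z /\ ~ quad f (n.+1)%:R z.
  apply: contrapT => nobad; apply: no; exists (n.+1)%:R; split.
    by rewrite ler1n.
  move=> z Az; apply: contrapT => nq; apply: nobad; by exists z.
have [u Hu] := choice bad.
have uB n : normc (u n) <= B by apply: AB; case: (Hu n).
have [T [T0 HT]] := Af _ (Alim u (fun n => (Hu n).1)).
have i0 : 0 < T^-1 by rewrite invr_gt0.
have [n /= [h1 h2]] := filter_ex
  (filterI (ulimP uB i0) (ultra_nat_ge (Num.truncn T))).
have [_] := Hu n; apply.
apply: quad_mono T0 _ (HT _ h1).
by apply: ltW; apply: lt_le_trans (truncnS_gt _) _; rewrite ler_nat ltnS.
Qed.

(** The closed region swept by the segments from [z0] to the points of the
    curve [gam]. *)
Definition cone (gam : C -> C) z0 : set C :=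
  [set z | exists s w, [/\ 0 <= s <= 1, normc w = 1 &
                          z = z0 + toC s * (gam w - z0)]].

(** Images of the unit circle under these maps are circles and ellipses. *)
Definition lcurve c0 b c (w : C) := c0 + b * w + c * w^-1.

(** [w] times the derivative of [lcurve]. *)
Definition lcurve' b c (w : C) := b * w - c * w^-1.

Lemma normc_lcurve c0 b c w : normc w = 1 ->
  normc (lcurve c0 b c w) <= normc c0 + normc b + normc c.
Proof.
move=> w1; apply: le_trans (normcD _ _) _; rewrite normcM normcV w1 invr1 mulr1.
apply: lerD => //; apply: le_trans (normcD _ _) _; by rewrite normcM w1 mulr1.
Qed.

Lemma normc_lcurve' b c w : normc w = 1 ->
  normc (lcurve' b c w) <= normc b + normc c.
Proof.
move=> w1; apply: le_trans (normcB _ _) _.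
by rewrite !normcM normcV w1 invr1 !mulr1.
Qed.

Lemma normc_toC01 (s : K) : 0 <= s <= 1 -> normc (toC s) <= 1.
Proof. by case/andP => s0 s1; rewrite normc_real ger0_norm. Qed.

Lemma cone_ucompact c0 b c z0 : ucompact (cone (lcurve c0 b c) z0).
Proof.
set B := normc c0 + normc b + normc c.
have B0 : 0 <= B by rewrite !addr_ge0 ?normc_ge0.
have gB w : normc w = 1 -> normc (lcurve c0 b c w - z0) <= B + normc z0.
  move=> w1; apply: le_trans (normcB _ _) _.
  by rewrite lerD2r; exact: normc_lcurve.
split.
  exists (normc z0 + (B + normc z0)) => z [s [w [s01 w1 ->]]].
  apply: le_trans (normcD _ _) _; rewrite lerD2l normcM.
  rewrite -[leRHS]mul1r ler_pM ?normc_ge0 //; [exact: normc_toC01|exact: gB].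
move=> u Hu.
have [s Hs] := choice Hu; have [w Hw] := choice Hs.
have s01 n : 0 <= s n <= 1 by case: (Hw n).
have w1 n : normc (w n) = 1 by case: (Hw n).
have wi1 n : normc (w n)^-1 = 1 by rewrite normcV w1 invr1.
have wle n : normc (w n) <= 1 by rewrite w1.
have wile n : normc (w n)^-1 <= 1 by rewrite wi1.
have [r01 Es] := rulim_range s01.
have Ew : ulim w * ulim (fun n => (w n)^-1) = 1.
  rewrite -(ulimM wle wile) -[RHS](ulim_const 1); apply: eq_ulim => n.
  by rewrite mulfV // -normc_eq0 w1 oner_neq0.
have ew0 : ulim w != 0.
  by apply/eqP => E; move: Ew; rewrite E mul0r => /eqP; rewrite eq_sym oner_eq0.
have Ewi : ulim (fun n => (w n)^-1) = (ulim w)^-1.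
  by apply: (mulfI ew0); rewrite Ew mulfV.
have le1 v : (forall n, normc (v n : C) <= 1) -> normc (ulim v) <= 1.
  move=> v1; apply: (@ulim_le _ v 1) => //.
  by apply: filterS filterT => n _ /=.
exists (rulim s), (ulim w); split=> //.
  apply/eqP; rewrite eq_le le1 //=.
  have := le1 _ wile; rewrite Ewi normcV invf_le1 ?normc_gt0 //.
have -> : u = fun n => z0 + toC (s n) * (lcurve c0 b c (w n) - z0).
  by apply/funext => n; case: (Hw n).
have bw n : normc (b * w n) <= normc b by rewrite normcM w1 mulr1.
have cw n : normc (c * (w n)^-1) <= normc c by rewrite normcM wi1 mulr1.
have k0 (k : C) (n : nat) : normc k <= normc k by [].
have gE : ulim (fun n => lcurve c0 b c (w n) - z0) = lcurve c0 b c (ulim w) - z0.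
  rewrite (ulimD (fun n => normc_lcurve _ _ _ (w1 n)) (k0 (- z0))) ulim_const.
  congr (_ - _); rewrite /lcurve.
  have cbw n : normc (c0 + b * w n) <= normc c0 + normc b.
    by apply: le_trans (normcD _ _) _; rewrite lerD2l.
  rewrite (ulimD cbw cw) (ulimD (k0 c0) bw) ulim_const.
  by rewrite (ulimZ _ wle) (ulimZ _ wile) Ewi.
have sB n : normc (toC (s n)) <= 1 by exact: normc_toC01.
have gB' n : normc (lcurve c0 b c (w n) - z0) <= B + normc z0 by exact: gB.
have sgB n : normc (toC (s n) * (lcurve c0 b c (w n) - z0)) <= B + normc z0.
  by rewrite normcM -[leRHS]mul1r ler_pM ?normc_ge0.
by rewrite (ulimD (k0 z0) sgB) ulim_const (ulimM sB gB') Es gE.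
Qed.

End Holomorphic.

Section CauchyFormula.
Context {K : realType}.
Local Notation C := K[i].
Implicit Types (f g : C -> C) (z y c d : C) (T B : K).

Variables (f : C -> C) (c0 b c z0 : C) (eta : K).
Hypothesis f_hol : forall z, cone (lcurve c0 b c) z0 z -> hol f z.
Hypothesis eta_gt0 : 0 < eta.
Hypothesis eta_le : forall w, normc w = 1 -> eta <= normc (lcurve c0 b c w - z0).

Let gam : C -> C := lcurve c0 b c.
Let kap : C -> C := lcurve' b c.
Let p (s : K) (w : C) : C := z0 + toC s * (gam w - z0).

Lemma sum_circ_shift n (F : C -> C) : (0 < n)%N ->
  \sum_(j < n) F (circ n ^+ j.+1) = \sum_(j < n) F (circ n ^+ j).
Proof.
case: n => // n _; rewrite [RHS]big_ord_recl [LHS]big_ord_recr /=.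
by rewrite circXn // expr0 addrC; congr (_ + _).
Qed.

(** Cauchy's formula for Riemann sums over the [n]-th roots of unity.  The curve
    is contracted to [z0] in [n] radial steps, which carry the sum of
    [f (gam w) kap w / (gam w - z0)] to that of [f z0 kap w / (gam w - z0)].  One
    step changes the sum, up to [O(1/n)], by [1/n] times the sum of [f' kap] over
    a contracted curve.  The latter sum is bounded: multiplied by the angular
    step, of length of order [1/n], it is up to [O(1/n)] a sum of increments of
    [f] along a closed curve, which is zero.  So each of the [n] steps costs
    [O(1/n)], and the averages have another factor [1/n]. *)
Lemma cauchy_avg : exists D N, forall n, (N < n)%N ->
  normc (avg n (fun w => f (gam w) * (kap w / (gam w - z0)))
         - f z0 * avg n (fun w => kap w / (gam w - z0))) <= D / n%:R.
Proof.
have [T [T1 HT]] := hol_ucompact (cone_ucompact c0 b c z0) f_hol.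
have T0 : 0 < T by lra.
have exd (z : C) : exists dz : C, cone gam z0 z -> normc dz <= T /\ forall y,
    normc (y - z) <= T^-1 ->
    normc (f y - f z - dz * (y - z)) <= T * normc (y - z) ^+ 2.
  case: (pselect (cone gam z0 z)) => [/HT[d Hd]|nz]; first by exists d.
  by exists 0.
have [d Hd] := choice exd.
pose B := normc c0 + normc b + normc c + normc z0 + 1.
have [n0 [nb [nc nz]]] : [/\ 0 <= normc c0, 0 <= normc b & 0 <= normc c /\ 0 <= normc z0].
  by rewrite !normc_ge0.
have B0 : 1 <= B by rewrite /B; lra.
have gB w : normc w = 1 -> normc (gam w - z0) <= B.
  move=> w1; apply: le_trans (normcB _ _) _.
  have := normc_lcurve c0 b c w1; rewrite /B -/gam; lra.
have kB w : normc w = 1 -> normc (kap w) <= B.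
  by move=> w1; have := normc_lcurve' b c w1; rewrite /B -/kap; lra.
have pi1 : 1 <= (pi : K) by have := @pi_ge2 K; lra.
pose D := T * B ^+ 3 / eta + 4 * pi * (2 * T * B ^+ 2).
exists D, (maxn 1 (Num.truncn (4 * pi * B * T))) => n.
rewrite gtn_max => /andP[n1 nT].
have np : (0 < n)%N by exact: ltnW.
have nK : 0 < n%:R :> K by rewrite ltr0n.
have nC : (n%:R : C) != 0 by rewrite pnatr_eq0 -lt0n.
have nT' : 4 * pi * B * T <= n%:R.
  by apply: ltW; apply: lt_le_trans (truncnS_gt _) _; rewrite ler_nat.
set om : C := circ n; pose h : C := om - 1.
have w1 j : normc (om ^+ j) = 1 by exact: normc_circX.
have w0 j : om ^+ j != 0 by rewrite -normc_eq0 w1 oner_neq0.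
have om0 : om != 0 by have := w0 1%N; rewrite expr1.
have om1 : normc om = 1 by have := w1 1%N; rewrite expr1.
have h0 : h != 0 by rewrite subr_eq0 -[om]expr1; exact: circX_neq1.
have hle : normc h <= 4 * pi / n%:R.
  apply: le_trans (normc_cis_sub1 _) _.
  rewrite ger0_norm ?divr_ge0 ?mulr_ge0 ?pi_ge0 //; lra.
have hTB : B * normc h <= T^-1.
  apply: le_trans (_ : B * (4 * pi / n%:R) <= _); first by rewrite ler_wpM2l; lra.
  rewrite mulrA ler_pdivrMr // [leRHS]mulrC ler_pdivlMr //; lra.
have nTB : B / n%:R <= T^-1.
  apply: le_trans (_ : B * (4 * pi / n%:R) <= _).
    rewrite ler_wpM2l //; first by lra.
    by rewrite ler_peMl ?invr_ge0 ?ltW //; lra.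
  rewrite mulrA ler_pdivrMr // [leRHS]mulrC ler_pdivlMr //; lra.
have hh0 : 0 <= normc h by exact: normc_ge0.
have BB : 0 <= B by exact: le_trans B0.
(* Angular steps: the increments of f along the closed curve p s sum up to 0. *)
have angular (s : K) : 0 <= s <= 1 ->
    normc (\sum_(j < n) d (p s (om ^+ j)) * kap (om ^+ j))
      <= n%:R * (2 * T * B ^+ 2 * normc h).
  move=> s01; have /andP[s0 s1] := s01.
  have pc j : cone gam z0 (p s (om ^+ j)) by exists s, (om ^+ j).
  have [->|sn0] := eqVneq s 0.
    have -> : \sum_(j < n) d (p 0 (om ^+ j)) * kap (om ^+ j) =
        d z0 * (b * \sum_(j < n) (om ^+ j) ^+ 1 - c * \sum_(j < n) (om ^+ j) ^- 1).
      rewrite !mulr_sumr -sumrB mulr_sumr; apply: eq_bigr => j _.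
      by rewrite /p mul0r addr0 expr1.
    rewrite circ_sum // circ_sumV //.
    by rewrite !mulr0 subrr mulr0 normc0 mulr_ge0 ?(ltW nK) // !mulr_ge0 ?(ltW T0).
  have sp : 0 < s by rewrite lt_def sn0.
  have sC : toC s != 0 by rewrite fmorph_eq0.
  pose E j := f (p s (om ^+ j.+1)) - f (p s (om ^+ j))
     - d (p s (om ^+ j)) * (p s (om ^+ j.+1) - p s (om ^+ j)).
  have step j : p s (om ^+ j.+1) - p s (om ^+ j) =
      toC s * h * (b * om ^+ j - c / (om ^+ j.+1)).
    rewrite /p /gam /lcurve /h !exprS; field.
    by apply/andP; split.
  have stepk j : p s (om ^+ j.+1) - p s (om ^+ j) =
      toC s * h * kap (om ^+ j) + toC s * h * (c * h / (om ^+ j.+1)).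
    rewrite step /kap /lcurve' /h !exprS; field.
    by apply/andP; split.
  have stepB j : normc (p s (om ^+ j.+1) - p s (om ^+ j)) <= s * normc h * B.
    rewrite step !normcM normc_real (ger0_norm s0).
    rewrite ler_wpM2l ?mulr_ge0 //; apply: le_trans (normcB _ _) _.
    rewrite !normcM normcV !w1 invr1 !mulr1 /B; lra.
  have shB : s * normc h * B <= normc h * B.
    by rewrite -mulrA ler_piMl // mulr_ge0.
  have EB j : normc (E j) <= T * (s * normc h * B) ^+ 2.
    apply: le_trans ((Hd _ (pc j)).2 _ _) _.
      by apply: le_trans (stepB j) _; rewrite mulrC in hTB; lra.
    rewrite ler_wpM2l ?(ltW T0) // lerXn2r ?nnegrE ?normc_ge0 //.
    by rewrite !mulr_ge0.
  have S0 : \sum_(j < n) E j = - (toC s * h *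
      (\sum_(j < n) d (p s (om ^+ j)) * kap (om ^+ j) +
       \sum_(j < n) d (p s (om ^+ j)) * (c * h / (om ^+ j.+1)))).
    rewrite /E sumrB sumrB (@sum_circ_shift n (fun w => f (p s w))) // subrr sub0r.
    congr (- _); rewrite -big_split mulr_sumr; apply: eq_bigr => j _ /=.
    by rewrite stepk; ring.
  have S1 : normc (\sum_(j < n) E j) <= n%:R * (T * (s * normc h * B) ^+ 2).
    by apply: normc_sum_ord => j; exact: EB.
  have S2 : normc (\sum_(j < n) d (p s (om ^+ j)) * (c * h / (om ^+ j.+1)))
      <= n%:R * (T * (B * normc h)).
    apply: normc_sum_ord => j.
    rewrite normcM ler_pM ?normc_ge0 //; first by case: (Hd _ (pc j)).
    by rewrite !normcM normcV w1 invr1 mulr1 ler_wpM2r // /B; lra.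
  move: S1; rewrite S0 normcN !normcM normc_real (ger0_norm s0).
  set X := \sum_(j < n) _ in S2 *; set Y := \sum_(j < n) _ => S1.
  have sh0 : 0 < s * normc h by rewrite mulr_gt0 ?normc_gt0.
  have S3 : normc (Y + X) <= n%:R * (T * (s * normc h) * B ^+ 2).
    have E1 : n%:R * (T * (s * normc h * B) ^+ 2) =
       (s * normc h) * (n%:R * (T * (s * normc h) * B ^+ 2)) by ring.
    by rewrite E1 ler_pM2l in S1.
  have -> : Y = (Y + X) - X by ring.
  apply: le_trans (normcB _ _) _.
  have B2 : B <= B ^+ 2 by rewrite expr2 ler_peMl.
  have k1 : n%:R * (T * (s * normc h) * B ^+ 2) <= n%:R * (T * B ^+ 2 * normc h).
    have TB0 : 0 <= T * B ^+ 2 by rewrite mulr_ge0 ?sqr_ge0 ?(ltW T0).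
    have sh : s * normc h <= normc h by rewrite ler_piMl.
    by rewrite ler_wpM2l ?(ltW nK) // [leLHS]mulrAC ler_wpM2l.
  have k2 : n%:R * (T * (B * normc h)) <= n%:R * (T * B ^+ 2 * normc h).
    by rewrite ler_wpM2l ?(ltW nK) // -mulrA ler_wpM2l ?(ltW T0) // ler_wpM2r.
  lra.
pose A (s : K) := \sum_(j < n) f (p s (om ^+ j)) *
   (kap (om ^+ j) / (gam (om ^+ j) - z0)).
have gn0 w : normc w = 1 -> gam w - z0 != 0.
  by move=> ww; rewrite -normc_gt0; apply: lt_le_trans eta_gt0 _; exact: eta_le.
(* Radial steps, of length 1/n, towards the curve. *)
have radial (m : nat) : (m < n)%N ->
    normc (A (m.+1%:R / n%:R) - A (m%:R / n%:R)) <= D / n%:R.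
  move=> mn; set s := m%:R / n%:R; set s' := m.+1%:R / n%:R.
  have s01 : 0 <= s <= 1.
    rewrite /s divr_ge0 ?(ltW nK) //= ler_pdivrMr // mul1r ler_nat; exact: ltnW.
  have ss' : toC s' - toC s = n%:R^-1.
    rewrite -rmorphB /s' /s -mulrBl -natr1 addrAC subrr add0r mul1r.
    by rewrite fmorphV rmorph_nat.
  have pc j : cone gam z0 (p s (om ^+ j)) by exists s, (om ^+ j).
  have step j : p s' (om ^+ j) - p s (om ^+ j) = n%:R^-1 * (gam (om ^+ j) - z0).
    by rewrite -ss' /p; ring.
  have stepB j : normc (p s' (om ^+ j) - p s (om ^+ j)) <= B / n%:R.
    rewrite step normcM normcV normc_nat mulrC ler_wpM2r ?invr_ge0 ?(ltW nK) //.
    exact: gB.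
  pose E j := f (p s' (om ^+ j)) - f (p s (om ^+ j))
     - d (p s (om ^+ j)) * (p s' (om ^+ j) - p s (om ^+ j)).
  have EB j : normc (E j) <= T * (B / n%:R) ^+ 2.
    apply: le_trans ((Hd _ (pc j)).2 _ _) _.
      exact: le_trans (stepB j) nTB.
    rewrite ler_wpM2l ?(ltW T0) // lerXn2r ?nnegrE ?normc_ge0 //.
    by rewrite divr_ge0 ?(ltW nK).
  have -> : A s' - A s =
      \sum_(j < n) E j * (kap (om ^+ j) / (gam (om ^+ j) - z0)) +
      n%:R^-1 * \sum_(j < n) d (p s (om ^+ j)) * kap (om ^+ j).
    rewrite /A -sumrB mulr_sumr -big_split; apply: eq_bigr => j _ /=.
    rewrite /E step; field.
    by rewrite nC gn0.
  apply: le_trans (normcD _ _) _.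
  have S1 : normc (\sum_(j < n) E j * (kap (om ^+ j) / (gam (om ^+ j) - z0))) <=
     n%:R * (T * (B / n%:R) ^+ 2 * (B / eta)).
    apply: normc_sum_ord => j; rewrite normcM ler_pM ?normc_ge0 //.
    rewrite normcM ler_pM ?normc_ge0 //; first exact: kB.
    by rewrite normcV lef_pV2 ?posrE ?normc_gt0 ?gn0 // eta_le.
  have S2 : normc (n%:R^-1 * \sum_(j < n) d (p s (om ^+ j)) * kap (om ^+ j)) <=
      2 * T * B ^+ 2 * (4 * pi / n%:R).
    rewrite normcM normcV normc_nat mulrC ler_pdivrMr // mulrC.
    apply: le_trans (angular _ s01) _; rewrite ler_wpM2l ?(ltW nK) //.
    by rewrite ler_wpM2l // !mulr_ge0 ?(ltW T0).
  have E1 : n%:R * (T * (B / n%:R) ^+ 2 * (B / eta)) = T * B ^+ 3 / eta / n%:R.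
    by field; rewrite !gt_eqF.
  by rewrite /D mulrDl -E1; lra.
have total m : (m <= n)%N -> normc (A (m%:R / n%:R) - A 0) <= m%:R * (D / n%:R).
  elim: m => [|m IH] mn; first by rewrite !mul0r subrr normc0.
  have -> : A (m.+1%:R / n%:R) - A 0 =
    (A (m.+1%:R / n%:R) - A (m%:R / n%:R)) + (A (m%:R / n%:R) - A 0) by ring.
  have -> : m.+1%:R * (D / n%:R) = D / n%:R + m%:R * (D / n%:R).
    by rewrite -natr1 mulrDl mul1r addrC.
  apply: le_trans (normcD _ _) _; apply: lerD; first exact: radial.
  by apply: IH; exact: ltnW.
have := total n (leqnn n); rewrite divff ?gt_eqF // mulrCA divff ?gt_eqF // mulr1.
have -> : A 1 = \sum_(j < n) f (gam (om ^+ j)) *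
   (kap (om ^+ j) / (gam (om ^+ j) - z0)).
  by apply: eq_bigr => j _; rewrite /p mul1r addrC subrK.
have -> : A 0 = f z0 * \sum_(j < n) (kap (om ^+ j) / (gam (om ^+ j) - z0)).
  by rewrite mulr_sumr; apply: eq_bigr => j _; rewrite /p mul0r addr0.
move=> tot; rewrite /avg mulrCA -mulrBr normcM normcV normc_nat mulrC.
by rewrite ler_wpM2r ?invr_ge0 ?(ltW nK).
Qed.

End CauchyFormula.

(** * Power series expansions *)

Section Expansions.
Context {K : realType}.
Local Notation C := K[i].
Implicit Types (f g : C -> C) (z y c d : C) (T B M rho : K).

Lemma le_geom_eq0 (x A q : K) : 0 <= q < 1 -> (forall m, x <= A * q ^+ m) -> x <= 0.
Proof.
move=> /andP[q0 q1] H; apply/ler_addgt0Pl => e e0; rewrite addr0.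
have A0 : 0 < `|A| + 1 by have := normr_ge0 A; lra.
have lim : (fun n => q ^+ n) @ \oo --> (0 : K).
  by apply: cvg_expr; rewrite ger0_norm.
have /cvgrPdist_lt/(_ (e / (`|A| + 1)) (divr_gt0 e0 A0))[N _ HN] := lim.
have := HN N (leqnn N); rewrite sub0r normrN ger0_norm ?exprn_ge0 //.
rewrite ltr_pdivlMr // => h.
apply: le_trans (H N) _; apply: le_trans (ltW h).
rewrite mulrC ler_wpM2l ?exprn_ge0 //; have := ler_norm A; lra.
Qed.

(** The powers of [w^-1] other than the constant have mean zero. *)
Lemma mean_series0 (G : C -> C) (t : nat -> C) (A q : K) : 0 <= q < 1 ->
  (forall w m, normc w = 1 ->
     normc (G w - \sum_(k < m) t k * w ^- k) <= A * q ^+ m) ->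
  mean G = t 0%N.
Proof.
move=> q01 GA; apply/eqP; rewrite -subr_eq0 -normc_eq0 eq_le normc_ge0 andbT.
have one : circle_le (fun=> 1 : C) 1 by move=> w _; rewrite normc1.
apply: (@le_geom_eq0 _ (A * q) q) => // m.
have m1 (k : nat) : mean (fun w : C => 1 * w ^- k) = (k == 0%N)%:R.
  by rewrite -mean_expV; apply: eq_mean => w _; rewrite mul1r.
have := mean_series one GA m.+1.
have -> : mean (fun w => 1 * G w) = mean G.
  by apply: eq_mean => w _; rewrite mul1r.
rewrite big_ord_recl big1 => [|k _]; last by rewrite m1 /= mulr0.
by rewrite m1 /= mulr1 addr0 exprS mul1r mulrA.
Qed.

(** The form in which Cauchy's formula is used: an expansion of its kernel in
    powers of [w^-1] becomes an expansion of [f]. *)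
Lemma cauchy_expansion f c0 b c z0 eta M (t : nat -> C) (A q : K) :
  (forall z, cone (lcurve c0 b c) z0 z -> hol f z) -> 0 < eta ->
  (forall w, normc w = 1 -> eta <= normc (lcurve c0 b c w - z0)) ->
  circle_le (fun w => f (lcurve c0 b c w)) M ->
  0 <= q < 1 -> t 0%N = 1 ->
  (forall w m, normc w = 1 ->
    normc (lcurve' b c w / (lcurve c0 b c w - z0) - \sum_(k < m) t k * w ^- k)
      <= A * q ^+ m) ->
  forall m, normc (f z0 -
      \sum_(k < m) t k * mean (fun w => f (lcurve c0 b c w) * w ^- k))
    <= M * (A * q ^+ m).
Proof.
move=> fh eta0 etale fM q01 t0 kA m.
pose G w := lcurve' b c w / (lcurve c0 b c w - z0).
have [D [N HD]] := cauchy_avg fh eta0 etale.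
have GB : circle_le G ((normc b + normc c) / eta).
  move=> w w1; rewrite normcM ler_pM ?normc_ge0 ?normc_lcurve' //.
  rewrite normcV lef_pV2 ?posrE ?etale //.
  by apply: lt_le_trans eta0 _; exact: etale.
have FGB : circle_le (fun w => f (lcurve c0 b c w) * G w)
    (M * ((normc b + normc c) / eta)).
  by move=> w w1; rewrite normcM ler_pM ?normc_ge0 //; [exact: fM|exact: GB].
have fGB : circle_le (fun w => - f z0 * G w)
    (normc (f z0) * ((normc b + normc c) / eta)).
  by move=> w w1; rewrite normcM normcN ler_wpM2l ?normc_ge0 //; exact: GB.
have E : mean (fun w => f (lcurve c0 b c w) * G w) = f z0.
  have lim0 : mean (fun w => f (lcurve c0 b c w) * G w + - f z0 * G w) = 0.
    apply: (@mean_lim _ _ _ 0 D N) => [w w1|n Nn].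
      by apply: le_trans (normcD _ _) _; apply: lerD; [exact: FGB|exact: fGB].
    by rewrite avgD avgZ subr0 mulNr; exact: HD.
  move: lim0; rewrite (meanD FGB fGB) (meanZ _ GB).
  rewrite (mean_series0 q01 (kA : forall w m, normc w = 1 -> normc (G w - _) <= _)).
  by rewrite t0 mulr1 => /eqP; rewrite subr_eq0 => /eqP.
by rewrite -E; exact: mean_series fM kA m.
Qed.

(** Taylor expansion with remainder on the disc of centre [zc] and radius
    [rho]. *)
Definition taylor f zc rho M := forall z (m : nat), normc (z - zc) < rho ->
  normc (f z - \sum_(k < m) ((z - zc) / toC rho) ^+ k *
                 mean (fun w => f (lcurve zc (toC rho) 0 w) * w ^- k))
  <= M * ((1 - normc (z - zc) / rho)^-1 * (normc (z - zc) / rho) ^+ m).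

Lemma geometric_tail (a : C) (q : K) m : normc a <= q -> q < 1 ->
  normc ((1 - a)^-1 - \sum_(k < m) a ^+ k) <= (1 - q)^-1 * q ^+ m.
Proof.
move=> aq q1; have q0 : 0 <= q := le_trans (normc_ge0 _) aq.
have a1 : 1 - q <= normc (1 - a).
  by have := normcD (1 - a) a; rewrite subrK normc1; lra.
have a10 : 1 - a != 0 by rewrite -normc_gt0; lra.
have -> : (1 - a)^-1 - \sum_(k < m) a ^+ k = (1 - a)^-1 * a ^+ m.
  apply: (mulfI a10); rewrite mulrBr mulfV // mulrA mulfV // mul1r.
  by rewrite -[1 - a]opprB mulNr -subrX1 opprB opprB addrC subrK.
rewrite normcM normcV normcX ler_pM ?invr_ge0 ?exprn_ge0 ?normc_ge0 //.
  by rewrite lef_pV2 ?posrE //; lra.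
by rewrite lerXn2r ?nnegrE ?normc_ge0.
Qed.

Lemma hol_taylor f zc rho M : 0 < rho ->
  (forall z, normc (z - zc) <= rho -> hol f z) ->
  (forall z, normc (z - zc) <= rho -> normc (f z) <= M) ->
  taylor f zc rho M.
Proof.
move=> rho0 fh fM z m zr; set u := z - zc.
have rC : toC rho != 0 by rewrite fmorph_eq0 gt_eqF.
have nr : normc (toC rho) = rho by rewrite normc_real ger0_norm ?ltW.
have gE w : lcurve zc (toC rho) 0 w = zc + toC rho * w.
  by rewrite /lcurve mul0r addr0.
have q01 : 0 <= normc u / rho < 1.
  by rewrite divr_ge0 ?normc_ge0 ?(ltW rho0) // ltr_pdivrMr // mul1r.
have /andP[q0 q1] := q01.
have eta0 : 0 < rho - normc u by rewrite subr_gt0.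
have guE w : lcurve zc (toC rho) 0 w - z = toC rho * w - u.
  by rewrite gE /u; ring.
apply: (cauchy_expansion (eta := rho - normc u)) => //.
- move=> y [s [w [/andP[s0 s1] w1 ->]]]; apply: fh.
  have -> : z + toC s * (lcurve zc (toC rho) 0 w - z) - zc =
      (1 - toC s) * u + toC s * (toC rho * w) by rewrite gE /u; ring.
  apply: le_trans (normcD _ _) _; rewrite !normcM w1 nr -(rmorph1 (real_complex K)).
  rewrite -rmorphB !normc_real !ger0_norm ?subr_ge0 // mulr1.
  have : (1 - s) * normc u <= (1 - s) * rho by rewrite ler_wpM2l ?subr_ge0 // ltW.
  lra.
- move=> w w1; rewrite guE.
  by have := normcD (toC rho * w - u) u; rewrite subrK normcM w1 nr mulr1; lra.
- move=> w w1; apply: fM; rewrite gE addrC addKr normcM w1 nr mulr1 //.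
- move=> w p w1; have w0 : w != 0 by rewrite -normc_eq0 w1 oner_neq0.
  have gz : toC rho * w - u != 0.
    rewrite -normc_gt0.
    by have := normcD (toC rho * w - u) u; rewrite subrK normcM w1 nr mulr1; lra.
  have -> : lcurve' (toC rho) 0 w / (lcurve zc (toC rho) 0 w - z) =
      (1 - u / toC rho * w^-1)^-1.
    rewrite guE /lcurve' mul0r subr0.
    have -> : 1 - u / toC rho * w^-1 = (toC rho * w - u) / (toC rho * w).
      by field; rewrite rC w0.
    by rewrite invf_div.
  under eq_bigr => k _ do rewrite -exprVn -exprMn.
  apply: geometric_tail => //.
  by rewrite !normcM !normcV nr w1 invr1 mulr1.
Qed.

(** Term by term: the second-order remainder of [u ^+ k] at distance [d] is at
    most [k ^ 2 sig ^ (k - 2) d ^ 2] for [u] in the disc of radius [sig], and the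
    coefficients decay geometrically on a larger disc. *)
Lemma analytic_hol (D : set C) f : analytic_on D f -> forall z, D z -> hol f z.
Proof.
move=> fD z0 /fD[a [e [e0 fa]]].
have lim v : normc v < e -> forall del, 0 < del -> exists N, forall n, (N <= n)%N ->
    normc (f (z0 + v) - \sum_(k < n) a k * v ^+ k) <= del.
  move=> ve del del0; have := fa (z0 + v); rewrite addrC addKr => /(_ ve).
  rewrite addrC => /cvgrPdist_le/(_ (toC del)).
  rewrite ltcR => /(_ del0)[N _ HN]; exists N => n /HN.
  by rewrite /series /= big_mkord normcE lecR.
pose rho := e / 2; pose sig := rho / 4.
have rho0 : 0 < rho by rewrite /rho; lra.
have sig0 : 0 < sig by rewrite /sig; lra.
have [A A0 HA] : exists2 A, 0 <= A & forall k, normc (a k) * rho ^+ k <= A.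
  have re : normc (toC rho) < e.
    by rewrite normc_real ger0_norm ?(ltW rho0) // /rho; lra.
  have [N HN] := lim _ re 1 ltr01.
  exists (2 + \sum_(k < N) normc (a k) * rho ^+ k) => [|k].
    apply: addr_ge0 => //; apply: sumr_ge0 => k _.
    by rewrite mulr_ge0 ?normc_ge0 ?exprn_ge0 ?(ltW rho0).
  have s0 : 0 <= \sum_(k < N) normc (a k) * rho ^+ k.
    apply: sumr_ge0 => j _; by rewrite mulr_ge0 ?normc_ge0 ?exprn_ge0 ?(ltW rho0).
  have [kN|Nk] := ltnP k N.
    rewrite (bigD1 (Ordinal kN)) //= addrCA lerDl addr_ge0 //.
    apply: sumr_ge0 => j _; by rewrite mulr_ge0 ?normc_ge0 ?exprn_ge0 ?(ltW rho0).
  have h1 := HN k Nk; have h2 := HN k.+1 (leqW Nk).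
  move: h2; rewrite big_ord_recr /=.
  set s := \sum_(k < k) _ in h1 *; set x := f _ in h1 *; set y := _ * _ => h2.
  have : normc y <= 2.
    have -> : y = (x - s) - (x - (s + y)) by ring.
    apply: le_trans (normcB _ _) _; lra.
  rewrite /y normcM normcX normc_real ger0_norm ?(ltW rho0) //; lra.
(* Coefficientwise bounds for u, v in the disc of radius sig. *)
have aA k : normc (a k) * (2 * sig) ^+ k <= A * 2^-1 ^+ k.
  have -> : 2 * sig = rho * 2^-1 by rewrite /sig; field.
  by rewrite exprMn mulrA ler_wpM2r // exprn_ge0 // invr_ge0.
have k2 k : k%:R <= 2 ^+ k :> K.
  by rewrite -natrX ler_nat; exact: ltnW (ltn_expl k (ltnSn 1)).
have k4 k : k%:R ^+ 2 <= 4 * 2 ^+ k :> K.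
  rewrite -!natrX -natrM ler_nat; elim: k => // k IH.
  case: k IH => [//|[//|[//|k]]] IH; rewrite [(2 ^ _)%N]expnS.
  have : (k.+4 ^ 2 <= 2 * k.+3 ^ 2)%N by clear; rewrite -!mulnn; nia.
  by move: IH; clear; lia.
have mono u v k : normc u <= sig -> normc v <= sig ->
    sig ^+ 2 * normc (v ^+ k - u ^+ k - k%:R * u ^+ k.-1 * (v - u))
    <= k%:R ^+ 2 * sig ^+ k * normc (v - u) ^+ 2.
  move=> us vs; elim: k => [|k IH].
    by rewrite !expr0 subrr mul0r mul0r subr0 normc0 !(mulr0, mul0r, expr0n).
  have E : v ^+ k.+1 - u ^+ k.+1 - k.+1%:R * u ^+ k.+1.-1 * (v - u) =
      v * (v ^+ k - u ^+ k - k%:R * u ^+ k.-1 * (v - u)) +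
      k%:R * u ^+ k.-1 * (v - u) ^+ 2.
    case: k {IH} => [|k]; first by rewrite !expr0 !expr1; ring.
    by rewrite /= !exprS -!natr1; ring.
  rewrite E; set Q := v ^+ k - _ - _ in IH *.
  have D0 : 0 <= normc (v - u) ^+ 2 by rewrite sqr_ge0.
  have h1 : normc (v * Q + k%:R * u ^+ k.-1 * (v - u) ^+ 2) <=
      sig * normc Q + k%:R * sig ^+ k.-1 * normc (v - u) ^+ 2.
    apply: le_trans (normcD _ _) _; apply: lerD.
      by rewrite normcM ler_wpM2r ?normc_ge0.
    rewrite normcM [normc ((v - u) ^+ 2)]normcX ler_wpM2r // normcM normc_nat.
    by rewrite ler_wpM2l // normcX lerXn2r ?nnegrE ?normc_ge0 ?(ltW sig0).
  apply: le_trans (ler_wpM2l _ h1) _; first by rewrite sqr_ge0.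
  have h2 : sig * (sig ^+ 2 * normc Q) <=
      sig * (k%:R ^+ 2 * sig ^+ k * normc (v - u) ^+ 2).
    by rewrite ler_wpM2l ?(ltW sig0).
  have h3 : sig ^+ 2 * (k%:R * sig ^+ k.-1) = k%:R * sig ^+ k.+1.
    by case: k {IH E Q h1 h2} => [|k]; rewrite ?mul0r ?mulr0 //= !exprS; ring.
  have h4 : 0 <= sig ^+ k.+1 * normc (v - u) ^+ 2.
    by rewrite mulr_ge0 // exprn_ge0 ?(ltW sig0).
  have h5 : 0 <= k%:R * (sig ^+ k.+1 * normc (v - u) ^+ 2) by rewrite mulr_ge0.
  rewrite mulrDr (mulrA (sig ^+ 2) (k%:R * sig ^+ k.-1)) h3.
  have E3 : k.+1%:R = k%:R + 1 :> K by rewrite natr1.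
  have E4 : sig ^+ k.+1 = sig * sig ^+ k := exprS _ _.
  rewrite E3 E4; rewrite E4 in h4 h5.
  move: h2 h4 h5; set x := k%:R; set y := sig ^+ k; set D2 := _ ^+ 2.
  set S2 := sig ^+ 2; set nQ := normc Q; clear; move=> *.
  lra.
pose P m u := \sum_(k < m) a k * u ^+ k.
pose P' m u := \sum_(k < m) a k * (k%:R * u ^+ k.-1).
have sumA (c : K) (F : nat -> C) m : 
    (forall k, normc (F k) <= c * (A * 2^-1 ^+ k)) -> 0 <= c ->
    normc (\sum_(k < m) F k) <= c * (A * 2).
  move=> HF c0; have -> : c * (A * 2) = c * A * (1 - 2^-1)^-1 by field.
  apply: normc_sum_geom => [|||k _]; rewrite ?mulr_ge0 //; try lra.
  by rewrite -mulrA.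
have sig2 : 0 < sig ^+ 2 by rewrite exprn_gt0.
have si : 0 < sig^-1 by rewrite invr_gt0.
have PB u m : normc u <= sig -> normc (P m u) <= 1 * (A * 2).
  move=> us; apply: (sumA _ (fun k => a k * u ^+ k)) => // k.
  rewrite mul1r normcM normcX; apply: le_trans (aA k).
  rewrite ler_wpM2l ?normc_ge0 // lerXn2r ?nnegrE ?normc_ge0 ?mulr_ge0 ?(ltW sig0) //; lra.
have P'B u m : normc u <= sig -> normc (P' m u) <= sig^-1 * (A * 2).
  move=> us; apply: (sumA _ (fun k => a k * (k%:R * u ^+ k.-1))); last exact: ltW.
  move=> k; rewrite ler_pdivlMl //.
  apply: le_trans (aA k); rewrite normcM mulrCA ler_wpM2l ?normc_ge0 //.
  rewrite normcM normc_nat normcX exprMn.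
  have h1 : sig * normc u ^+ k.-1 * k%:R <= sig ^+ k * k%:R.
    case: k => [|k]; first by rewrite !mulr0.
    rewrite ler_wpM2r // exprS ler_wpM2l ?(ltW sig0) //.
    by rewrite lerXn2r ?nnegrE ?normc_ge0 ?(ltW sig0).
  have : sig ^+ k * k%:R <= sig ^+ k * 2 ^+ k.
    by rewrite ler_wpM2l // exprn_ge0 ?(ltW sig0).
  lra.
have QB u v m : normc u <= sig -> normc v <= sig ->
    normc (P m v - P m u - P' m u * (v - u))
      <= 4 * normc (v - u) ^+ 2 / sig ^+ 2 * (A * 2).
  move=> us vs.
  have -> : P m v - P m u - P' m u * (v - u) = \sum_(k < m)
      a k * (v ^+ k - u ^+ k - k%:R * u ^+ k.-1 * (v - u)).
    rewrite /P /P' mulr_suml -!sumrB; apply: eq_bigr => k _; ring.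
  apply: (sumA _ (fun k => a k * (v ^+ k - u ^+ k - k%:R * u ^+ k.-1 * (v - u)))).
    move=> k; rewrite [leRHS]mulrAC ler_pdivlMr // [leLHS]mulrC normcM [leLHS]mulrCA.
    apply: le_trans (ler_wpM2l (normc_ge0 _) (mono u v k us vs)) _.
    have D0 : 0 <= normc (v - u) ^+ 2 by rewrite sqr_ge0.
    have h1 : normc (a k) * (k%:R ^+ 2 * sig ^+ k) <= 4 * (A * 2^-1 ^+ k).
      apply: le_trans (_ : 4 * (normc (a k) * (2 * sig) ^+ k) <= _); last by rewrite ler_wpM2l.
      rewrite [leRHS]mulrCA ler_wpM2l ?normc_ge0 // [(2 * sig) ^+ k]exprMn (mulrA 4).
      by rewrite ler_wpM2r ?exprn_ge0 ?(ltW sig0).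
    by have := ler_wpM2r D0 h1; lra.
  by rewrite divr_ge0 ?sqr_ge0 // mulr_ge0 ?sqr_ge0.
have fE v : normc v <= sig -> f (z0 + v) = ulim (fun m => P m v).
  move=> vs; apply/esym/(@ulim_unique _ _ (1 * (A * 2))) => [m|del del0].
    exact: PB.
  have ve : normc v < e by apply: le_lt_trans vs _; rewrite /sig /rho; lra.
  have [N HN] := lim _ ve _ del0; apply: filterS (ultra_nat_ge N) => m /= Nm.
  by rewrite normc_distC; exact: HN.
pose T := 2 * sig^-1 + sig^-1 * (A * 2) + 8 * A / sig ^+ 2.
have p1 : 0 <= sig^-1 * (A * 2) by rewrite !mulr_ge0 ?(ltW si).
have p2 : 0 <= 8 * A / sig ^+ 2 by apply: divr_ge0; [exact: mulr_ge0|exact: ltW].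
have T0 : 0 < T by rewrite /T; lra.
have Ts : T^-1 <= sig / 2.
  have -> : sig / 2 = (2 * sig^-1)^-1 by rewrite invfM invrK mulrC.
  by rewrite lef_pV2 ?posrE ?mulr_gt0 // /T; lra.
exists T; split=> // z zz0; set u := z - z0.
have us : normc u <= sig by apply: le_trans zz0 _; lra.
exists (ulim (fun m => P' m u)); split=> [|y yz].
  apply: le_trans (_ : sig^-1 * (A * 2) <= _); last by rewrite /T; lra.
  apply: (@ulim_le _ _ (sig^-1 * (A * 2))) => [m|]; first exact: P'B.
  by apply: filterS filterT => m _ /=; exact: P'B.
pose v := y - z0.
have vs : normc v <= sig.
  have -> : v = (y - z) + u by rewrite /v /u; ring.
  apply: le_trans (normcD _ _) _; lra.
have yzE : y - z = v - u by rewrite /v /u; ring.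
have -> : f y = ulim (fun m => P m v).
  by rewrite -fE // /v addrC subrK.
have -> : f z = ulim (fun m => P m u).
  by rewrite -fE // /u addrC subrK.
have mu : forall m, normc (-1 * P m u) <= 1 * (A * 2).
  by move=> m; rewrite mulN1r normcN; exact: PB.
have mu' : forall m, normc (- (v - u) * P' m u) <= normc (v - u) * (sig^-1 * (A * 2)).
  by move=> m; rewrite normcM normcN ler_wpM2l ?normc_ge0 //; exact: P'B.
have mv m : normc (P m v) <= 1 * (A * 2) by exact: PB.
have mvu m : normc (P m v + -1 * P m u) <= 1 * (A * 2) + 1 * (A * 2).
  apply: le_trans (normcD _ _) _; apply: lerD; [exact: mv|exact: mu].
have -> : ulim (fun m => P m v) - ulim (fun m => P m u) -
    ulim (fun m => P' m u) * (y - z) =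
    ulim (fun m => (P m v + -1 * P m u) + - (v - u) * P' m u).
  rewrite (ulimD mvu mu') (ulimD mv mu) (ulimZ _ (fun m => PB u m us)).
  rewrite (ulimZ _ (fun m => P'B u m us)) yzE.
  by move: (ulim _) (ulim _) (ulim _) => x1 x2 x3; ring.
have fin m : normc ((P m v + -1 * P m u) + - (v - u) * P' m u) <=
    T * normc (y - z) ^+ 2.
  have -> : (P m v + -1 * P m u) + - (v - u) * P' m u =
     P m v - P m u - P' m u * (v - u) by ring.
  apply: le_trans (QB u v m us vs) _; rewrite yzE.
  have D0 : 0 <= normc (v - u) ^+ 2 by rewrite sqr_ge0.
  have -> : 4 * normc (v - u) ^+ 2 / sig ^+ 2 * (A * 2) =
     (8 * A / sig ^+ 2) * normc (v - u) ^+ 2 by ring.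
  by rewrite ler_wpM2r // /T; lra.
apply: (@ulim_le _ _ (T * normc (y - z) ^+ 2)) => //.
by apply: filterS filterT => m _ /=.
Qed.

Lemma taylor_analytic (D : set C) f :
  (forall z, D z -> exists rho M, 0 < rho /\ taylor f z rho M) -> analytic_on D f.
Proof.
move=> HD z0 /HD[rho [M [rho0 tf]]].
exists (fun k => (toC rho)^-1 ^+ k *
   mean (fun w => f (lcurve z0 (toC rho) 0 w) * w ^- k)), rho; split=> // y yz.
set q := normc (y - z0) / rho.
have q0 : 0 <= q by rewrite divr_ge0 ?normc_ge0 ?(ltW rho0).
have q1 : q < 1 by rewrite ltr_pdivrMr // mul1r.
have lim0 : (fun n => q ^+ n) @ \oo --> (0 : K).
  by apply: cvg_expr; rewrite ger0_norm.
apply/cvgrPdist_le => -[e e'] /=; rewrite ltcE => /andP[/eqP /= -> e0].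
pose A := `|M * (1 - q)^-1| + 1.
have A0 : 0 < A by rewrite /A; have := normr_ge0 (M * (1 - q)^-1); lra.
have /cvgrPdist_lt/(_ (e / A) (divr_gt0 e0 A0))[N _ HN] := lim0.
exists N => // n /HN; rewrite sub0r normrN ger0_norm ?exprn_ge0 //.
rewrite ltr_pdivlMr // => h.
rewrite normcE lecR /series /= big_mkord.
have := tf y n yz; rewrite -/q.
under eq_bigr => k _ do rewrite exprMn [(y - z0) ^+ k * _]mulrC -mulrA
  [(y - z0) ^+ k * _]mulrC mulrA.
move=> le1; apply: le_trans le1 _; apply: le_trans (ltW h).
rewrite mulrA mulrC ler_wpM2l ?exprn_ge0 //.
by rewrite /A; have := ler_norm (M * (1 - q)^-1); lra.
Qed.

Definition metric_open (D : set C) := forall z, D z -> exists2 e : K, 0 < e &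
  forall y, normc (y - z) < e -> D y.

Lemma hol_bounded f z0 : hol f z0 -> exists rho M, 0 < rho /\
  forall z, normc (z - z0) <= rho -> normc (f z) <= M.
Proof.
move=> /hol_ge1[T [T1 H]]; exists T^-1, (normc (f z0) + 2 * T).
have T0 : 0 < T by lra.
have i0 : 0 < T^-1 by rewrite invr_gt0.
have i1 : T^-1 <= 1 by rewrite invf_le1.
split=> // z zz0; have q0 : quad f T z0 by apply: H; rewrite subrr normc0 ltW.
have -> : f z = f z0 + (f z - f z0) by ring.
apply: le_trans (normcD _ _) _; rewrite lerD2l.
apply: le_trans (quad_lip T1 q0 zz0) _; rewrite ler_piMr //; lra.
Qed.

Lemma hol_analytic (D : set C) f : metric_open D -> (forall z, D z -> hol f z) ->
  analytic_on D f.
Proof.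
move=> Do fD; apply: taylor_analytic => z0 Dz0.
have [rho [M [rho0 fM]]] := hol_bounded (fD _ Dz0).
have [e e0 De] := Do _ Dz0.
pose s := Num.min rho (e / 2).
have s0 : 0 < s by rewrite lt_min rho0 /=; lra.
exists s, M; split=> //; apply: hol_taylor => // z; rewrite le_min => /andP[h1 h2].
  by apply: fD; apply: De; lra.
exact: fM.
Qed.

(** Weierstrass' theorem: the coefficients of a Taylor expansion are means, so
    the expansion with its remainder passes to the uniform limit. *)
Lemma uniform_limit_analytic (D : set C) f : metric_open D ->
  (forall e : K, 0 < e -> exists2 g, (forall z, D z -> hol g z) &
     forall z, D z -> normc (f z - g z) <= e) ->
  analytic_on D f.
Proof.
move=> Do appr; apply: taylor_analytic => z0 Dz0.
have [g0 g0h g0f] := appr 1 ltr01.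
have [rho [M [rho0 gM]]] := hol_bounded (g0h _ Dz0).
have [e e0 De] := Do _ Dz0.
pose s := Num.min rho (e / 2).
have s0 : 0 < s by rewrite lt_min rho0 /=; lra.
have sD z : normc (z - z0) <= s -> D z.
  by rewrite le_min => /andP[h1 h2]; apply: De; lra.
have fM z : normc (z - z0) <= s -> normc (f z) <= M + 1.
  move=> zs; have -> : f z = g0 z + (f z - g0 z) by ring.
  apply: le_trans (normcD _ _) _; apply: lerD; last exact/g0f/sD.
  by apply: gM; move: zs; rewrite le_min => /andP[].
exists s, (M + 2); split=> // z m zs.
set q := normc (z - z0) / s.
have q0 : 0 <= q by rewrite divr_ge0 ?normc_ge0 ?(ltW s0).
have q1 : q < 1 by rewrite ltr_pdivrMr // mul1r.
have iq0 : 0 < (1 - q)^-1 by rewrite invr_gt0; lra.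
have ns : normc (toC s) = s by rewrite normc_real ger0_norm ?(ltW s0).
have circ_s w : normc w = 1 -> normc (lcurve z0 (toC s) 0 w - z0) <= s.
  by move=> w1; rewrite /lcurve mul0r addr0 addrC addKr normcM w1 mulr1 ns.
apply/ler_addgt0Pl => del del0.
pose eps := Num.min 1 (del / (1 + (1 - q)^-1)).
have i10 : 0 < 1 + (1 - q)^-1 by lra.
have eps0 : 0 < eps by rewrite lt_min ltr01 divr_gt0.
have eps_del : eps * (1 + (1 - q)^-1) <= del.
  by rewrite -ler_pdivlMr // ge_min lexx orbT.
have eps1 : eps <= 1 by rewrite ge_min lexx.
have [g gh gf] := appr _ eps0.
have gM' y : normc (y - z0) <= s -> normc (g y) <= M + 2.
  move=> ys; have -> : g y = f y - (f y - g y) by ring.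
  apply: le_trans (normcB _ _) _; have := fM _ ys; have := gf _ (sD _ ys); lra.
have tg := @hol_taylor g z0 s (M + 2) s0 (fun y h => gh _ (sD _ h)) gM' z m zs.
move: tg; rewrite -/q; set Sg := \sum_(k < m) _ => tg.
set Sf := \sum_(k < m) _.
have -> : f z - Sf = (f z - g z) + (g z - Sg) + (Sg - Sf) by ring.
have bS : normc (Sg - Sf) <= eps * (1 - q)^-1.
  have -> : Sg - Sf = \sum_(k < m) ((z - z0) / toC s) ^+ k *
      (mean (fun w => g (lcurve z0 (toC s) 0 w) * w ^- k) -
       mean (fun w => f (lcurve z0 (toC s) 0 w) * w ^- k)).
    by rewrite /Sg /Sf -sumrB; apply: eq_bigr => k _; rewrite mulrBr.
  apply: (@normc_sum_geom _ (fun k => ((z - z0) / toC s) ^+ k *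
      (mean (fun w => g (lcurve z0 (toC s) 0 w) * w ^- k) -
       mean (fun w => f (lcurve z0 (toC s) 0 w) * w ^- k)))) => [|||k _] //.
    exact: ltW.
    rewrite normcM normcX normcM normcV ns -/q mulrC ler_wpM2r ?exprn_ge0 //.
    have wk (w : C) : normc w = 1 -> normc (w ^- k) = 1.
      by move=> w1; rewrite normcV normcX w1 expr1n invr1.
    have gB : circle_le (fun w => g (lcurve z0 (toC s) 0 w) * w ^- k) (M + 2).
      by move=> w w1; rewrite normcM wk // mulr1; apply: gM'; exact: circ_s.
    have fB : circle_le (fun w => f (lcurve z0 (toC s) 0 w) * w ^- k) (M + 1).
      by move=> w w1; rewrite normcM wk // mulr1; apply: fM; exact: circ_s.
    have fB' : circle_le (fun w => -1 * (f (lcurve z0 (toC s) 0 w) * w ^- k)) (M + 1).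
      by move=> w w1; rewrite mulN1r normcN; exact: fB.
    rewrite -mulN1r -(meanZ _ fB) -(meanD gB fB'); apply: mean_le => w w1.
    rewrite mulN1r -mulrBl normcM wk // mulr1 normc_distC; apply: gf.
    exact/sD/circ_s.
apply: le_trans (normcD _ _) _; apply: le_trans (lerD (normcD _ _) (lexx _)) _.
have Dz : D z by apply: sD; exact: ltW.
have := gf _ Dz; rewrite /q in tg bS eps_del *; lra.
Qed.

End Expansions.

(** * Ellipses *)

Section Ellipse.
Context {K : realType}.
Local Notation C := K[i].
Local Notation Re := (@complex.Re K).
Local Notation Im := (@complex.Im K).
Implicit Types (r R rho s : K) (z y w : C).

Lemma cosh_gt1 R : 0 < R -> 1 < cosh R.
Proof.
move=> R0; rewrite /cosh expRN.
have e1 : 1 < expR R by rewrite expR_gt1.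
have e0 : 0 < expR R by lra.
have : 0 < (expR R - 1) ^+ 2 / expR R by rewrite divr_gt0 // exprn_gt0 //; lra.
have -> : (expR R - 1) ^+ 2 / expR R = expR R + (expR R)^-1 - 2 by field; lra.
lra.
Qed.

Lemma sinh_gt0 R : 0 < R -> 0 < sinh R.
Proof. by move=> R0; rewrite divr_gt0 // subr_gt0 ltr_expR; lra. Qed.

Lemma sinh_lt_cosh R : sinh R < cosh R.
Proof. by rewrite /sinh /cosh; have := expR_gt0 (- R); lra. Qed.

Lemma ltr_sinh r R : r < R -> sinh r < sinh R.
Proof.
move=> rR; rewrite /sinh.
have : expR r < expR R by rewrite ltr_expR.
have : expR (- R) < expR (- r) by rewrite ltr_expR; lra.
lra.
Qed.

Lemma ltr_cosh r R : 0 < r -> r < R -> cosh r < cosh R.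
Proof.
move=> r0 rR; have sr := ltr_sinh rR; have s0 := sinh_gt0 r0.
have cs t : cosh t ^+ 2 = 1 + sinh t ^+ 2 :> K.
  by rewrite /cosh /sinh expRN; field; rewrite gt_eqF // expR_gt0.
have c0 (t : K) : 0 < t -> 0 < cosh t by move=> /cosh_gt1 h; lra.
rewrite -(@ltr_pXn2r _ 2) ?nnegrE ?(ltW (c0 _ _)) //; last lra.
by rewrite !cs ltrD2l ltr_pXn2r ?nnegrE //; lra.
Qed.

Lemma ellipse_sub r R z : 0 < r -> r < R -> ellipse r z -> ellipse R z.
Proof.
move=> r0 rR; rewrite /ellipse /=; apply: le_lt_trans.
have R0 : 0 < R by lra.
have le (x a b : K) : 0 < a -> a < b -> (x / b) ^+ 2 <= (x / a) ^+ 2.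
  move=> a0 ab; rewrite !exprMn ler_wpM2l ?sqr_ge0 //.
  have b0 : 0 < b by lra.
  by rewrite lerXn2r ?nnegrE ?invr_ge0 ?ltW // ltf_pV2.
apply: lerD; apply: le.
- by have := cosh_gt1 r0; lra.
- exact: ltr_cosh.
- exact: sinh_gt0.
- exact: ltr_sinh.
Qed.

Lemma ellipse_segment R z y s : ellipse R z -> ellipse R y ->
  0 <= s <= 1 -> ellipse R (z + toC s * (y - z)).
Proof.
rewrite /ellipse /= => Ez Ey /andP[s0 s1].
have conv (a b : K) : (a + s * (b - a)) ^+ 2 <= (1 - s) * a ^+ 2 + s * b ^+ 2.
  have : 0 <= s * (1 - s) * (a - b) ^+ 2.
    by rewrite mulr_ge0 ?sqr_ge0 // mulr_ge0 // subr_ge0.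
  lra.
rewrite ReD ImD Re_real_mul [Im (_ * _)]Im_mul /= mul0r addr0 ReB ImB.
have E (a b c : K) : (a + s * (b - a)) / c = a / c + s * (b / c - a / c).
  by ring.
rewrite !E; apply: le_lt_trans (lerD (conv _ _) (conv _ _)) _.
move: Ez Ey; set a := _ ^+ 2; set b := _ ^+ 2; set c := _ ^+ 2.
set d := _ ^+ 2 => h1 h2.
have [->|sn0] := eqVneq s 0; first by lra.
have sp : 0 < s by rewrite lt_def sn0.
have : (1 - s) * (a + b) <= (1 - s) * 1 by rewrite ler_wpM2l //; lra.
have : s * (c + d) < s * 1 by rewrite ltr_pM2l.
lra.
Qed.

Lemma ellipse_open R : 0 < R -> metric_open (ellipse R : set C).
Proof.
move=> R0 z; rewrite /ellipse /=; set a := Re z / _; set b := Im z / _ => Ez.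
pose m := (1 - (a ^+ 2 + b ^+ 2)) / 8.
have s0 := sinh_gt0 R0; have sc := sinh_lt_cosh R; have c1 := cosh_gt1 R0.
have a20 := sqr_ge0 a; have b20 := sqr_ge0 b.
have m0 : 0 < m by rewrite /m; lra.
have m1 : m <= 1 by rewrite /m; lra.
exists (m * sinh R); first exact: mulr_gt0.
move=> y yz.
have close (x c : K) : sinh R <= c -> `|x| <= normc (y - z) -> `|x / c| <= m.
  move=> sc' xy; have c0 : 0 < c by lra.
  rewrite normrM normfV (gtr0_norm c0) ler_pdivrMr //.
  have : m * sinh R <= m * c by rewrite ler_wpM2l // ltW.
  lra.
have ha := @close (Re (y - z)) _ (ltW sc) (Re_normc _).
have hb := @close (Im (y - z)) _ (lexx _) (Im_normc _).
have -> : Re y / cosh R = a + Re (y - z) / cosh R by rewrite ReB /a; ring.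
have -> : Im y / sinh R = b + Im (y - z) / sinh R by rewrite ImB /b; ring.
move: ha hb; set x := Re _ / _; set x' := Im _ / _.
rewrite !ler_norml => /andP[h1 h2] /andP[h3 h4].
have sq (c t : K) : c ^+ 2 < 1 -> - m <= t -> t <= m ->
    (c + t) ^+ 2 <= c ^+ 2 + 3 * m.
  move=> c2 t1 t2.
  have c3 : c <= 1 by nra.
  have c4 : -1 <= c by nra.
  have : 0 <= (m - t) * (1 + c) by rewrite mulr_ge0; lra.
  have : 0 <= (m + t) * (1 - c) by rewrite mulr_ge0; lra.
  have : 0 <= (m - t) * (m + t) by rewrite mulr_ge0; lra.
  have : m * m <= m by rewrite ler_piMl //; lra.
  lra.
have a21 : a ^+ 2 < 1 by lra.
have b21 : b ^+ 2 < 1 by lra.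
apply: le_lt_trans (lerD (sq _ _ a21 h1 h2) (sq _ _ b21 h3 h4)) _; rewrite /m; lra.
Qed.

Definition joukowski w : C := (w + w^-1) / 2.

(** The circles about 0 are mapped to confocal ellipses. *)
Lemma ellipse_joukowski R w : 0 < R -> 1 <= normc w ->
  ellipse R (joukowski w) <-> normc w < expR R.
Proof.
move=> R0; set m := normc w => m1.
have s0 := sinh_gt0 R0; have c0 := cosh_gt1 R0.
have m0 : 0 < m by lra.
set u := Re w / m; set v := Im w / m.
have uv : u ^+ 2 + v ^+ 2 = 1.
  rewrite /u /v !exprMn -mulrDl -sqr_normc -/m exprVn divff //.
  by rewrite gt_eqF // exprn_gt0.
have EV : w^-1 = Complex (Re w / m ^+ 2) (- (Im w / m ^+ 2)).
  by rewrite /m sqr_normc; case: (w).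
have ER : Re (joukowski w) = u * ((m + m^-1) / 2).
  rewrite /joukowski; have -> : 2^-1 = toC 2^-1 :> C by rewrite fmorphV rmorph_nat.
  rewrite mulrC Re_real_mul ReD EV /= /u; field; lra.
have EI : Im (joukowski w) = v * ((m - m^-1) / 2).
  rewrite /joukowski; have -> : 2^-1 = toC 2^-1 :> C by rewrite fmorphV rmorph_nat.
  rewrite mulrC Im_mul ImD EV /= /v; field; lra.
rewrite /ellipse /= ER EI.
set al := (m + m^-1) / 2; set be := (m - m^-1) / 2.
have e1 : 1 < expR R by rewrite expR_gt1.
have e0 : 0 < expR R by lra.
have mi : 0 < m^-1 by rewrite invr_gt0.
have mi1 : m^-1 <= 1 by rewrite invf_le1.
have cE : cosh R = (expR R + (expR R)^-1) / 2 by rewrite /cosh expRN.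
have sE : sinh R = (expR R - (expR R)^-1) / 2 by rewrite /sinh expRN.
have be0 : 0 <= be by rewrite /be; lra.
have al0 : 0 <= al by rewrite /al; lra.
have u0 := sqr_ge0 u; have v0 := sqr_ge0 v.
have key (x y : K) : 1 <= x -> x < y -> x + x^-1 < y + y^-1 /\ x - x^-1 < y - y^-1.
  move=> x1 xy; have x0 : 0 < x by lra.
  have y0 : 0 < y by lra.
  have iy : y^-1 < x^-1 by rewrite ltf_pV2.
  split; last by lra.
  have -> : x^-1 = y^-1 + (y - x) / (x * y) by field; lra.
  have : (y - x) / (x * y) < y - x.
    rewrite ltr_pdivrMr ?mulr_gt0 // ltr_pMr ?subr_gt0 //.
    have : y <= x * y by rewrite ler_peMl //; lra.
    by move=> ?; lra.
  by move=> ?; lra.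
have E (p q c : K) : (p * q / c) ^+ 2 = p ^+ 2 * (q / c) ^+ 2.
  by rewrite -mulrA exprMn.
rewrite (E u al) (E v be); split=> [H|me].
  rewrite ltNge; apply/negP => em; move: H; rewrite ltNge => /negP; apply.
  have [h1 h2] : cosh R <= al /\ sinh R <= be.
    rewrite cE sE /al /be; move: em; rewrite le_eqVlt => /orP[/eqP ->//|em].
    by have [] := key _ _ (ltW e1) em; lra.
  have k1 : 1 <= (al / cosh R) ^+ 2.
    by rewrite exprn_ege1 // ler_pdivlMr ?mul1r; lra.
  have k2 : 1 <= (be / sinh R) ^+ 2.
    by rewrite exprn_ege1 // ler_pdivlMr ?mul1r; lra.
  have : u ^+ 2 * 1 <= u ^+ 2 * (al / cosh R) ^+ 2 by rewrite ler_wpM2l.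
  have : v ^+ 2 * 1 <= v ^+ 2 * (be / sinh R) ^+ 2 by rewrite ler_wpM2l.
  lra.
have [h1 h2] : al < cosh R /\ be < sinh R.
  by rewrite cE sE /al /be; have [] := key _ _ m1 me; lra.
have k1 : (al / cosh R) ^+ 2 < 1.
  rewrite exprn_ilt1 //; first by rewrite divr_ge0 //; lra.
  by rewrite ltr_pdivrMr ?mul1r; lra.
have k2 : (be / sinh R) ^+ 2 < 1.
  rewrite exprn_ilt1 //; first by rewrite divr_ge0 // ltW.
  by rewrite ltr_pdivrMr ?mul1r.
have [u1|u1] := eqVneq (u ^+ 2) 0.
  rewrite u1 mul0r add0r; rewrite u1 add0r in uv; by rewrite uv mul1r.
have up : 0 < u ^+ 2 by rewrite lt_def u1.
have : u ^+ 2 * (al / cosh R) ^+ 2 < u ^+ 2 * 1 by rewrite ltr_pM2l.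
have : v ^+ 2 * (be / sinh R) ^+ 2 <= v ^+ 2 * 1 by rewrite ler_wpM2l // ltW.
lra.
Qed.

(** The two preimages of a point are inverse to each other. *)
Lemma joukowski_onto z : exists2 w, 1 <= normc w & z = joukowski w.
Proof.
pose s : C := sqrtC (z ^+ 2 - 1).
have s2 : s ^+ 2 = z ^+ 2 - 1 by exact: sqrtCK.
have prod1 : (z + s) * (z - s) = 1 by rewrite mulrC -subr_sqr s2 subKr.
have zs0 : z + s != 0.
  by apply/eqP => E; move: prod1; rewrite E mul0r => /eqP; rewrite eq_sym oner_eq0.
have inv : (z + s)^-1 = z - s by apply: (mulfI zs0); rewrite mulfV // prod1.
have inv' : (z - s)^-1 = z + s by rewrite -inv invrK.
have := congr1 (@normc K) prod1; rewrite normcM normc1 => n1.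
have [h|h] := lerP 1 (normc (z + s)).
  by exists (z + s) => //; rewrite /joukowski inv; field.
exists (z - s); last by rewrite /joukowski inv'; field.
have := normc_ge0 (z + s); have := normc_ge0 (z - s).
move: n1 h; move: (normc _) (normc _) => a b; nra.
Qed.

Lemma ellipseP R z : 0 < R -> ellipse R z <->
  exists w, [/\ 1 <= normc w, normc w < expR R & z = joukowski w].
Proof.
move=> R0; split=> [Ez|[w [w1 wR ->]]]; last exact/ellipse_joukowski.
have [w w1 E] := joukowski_onto z; exists w; split=> //.
by apply/(ellipse_joukowski R0 w1); rewrite -E.
Qed.

Lemma ellipse_real R (x : K) : 0 < R -> -1 <= x <= 1 -> ellipse R (toC x).
Proof.
move=> R0 x1; rewrite /ellipse /= mul0r expr0n addr0 /=.
have c1 := cosh_gt1 R0.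
have : `|x / cosh R| < 1.
  rewrite normrM normfV (@gtr0_norm _ (cosh R)) ?ltr_pdivrMr; try lra.
  have : `|x| <= 1 by rewrite ler_norml.
  by move=> ?; lra.
rewrite -(real_normK (num_real (x / _))) => h.
by rewrite exprn_ilt1.
Qed.

Lemma joukowski_cis t : joukowski (cis t) = toC (cos t).
Proof.
have ci : (cis t)^-1 = cis (- t).
  apply: (mulfI (cis_neq0 t)); rewrite mulfV ?cis_neq0 // -cisD subrr.
  by apply: complexP; rewrite /cis /= ?cos0 ?sin0.
rewrite /joukowski ci; have -> : 2^-1 = toC 2^-1 :> C by rewrite fmorphV rmorph_nat.
by apply: complexP; rewrite mulrC ?Re_real_mul ?Im_mul ?ReD ?ImD /= ?cosN ?sinN; field.
Qed.

End Ellipse.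

(** * Chebyshev polynomials and interpolation *)

Section Chebyshev.
Context {K : realType}.
Local Notation C := K[i].
Implicit Types (r R rho s : K) (z y w : C) (k m n N : nat).

(** Two consecutive polynomials, as the recurrence has two terms. *)
Fixpoint cheb2 k : {poly C} * {poly C} :=
  if k is k'.+1 then let: (p, q) := cheb2 k' in (q, 2%:P * 'X * q - p)
  else (1, 'X).

Definition cheb k := (cheb2 k).1.

Lemma cheb0 : cheb 0 = 1. Proof. by []. Qed.
Lemma cheb1 : cheb 1 = 'X. Proof. by []. Qed.
Lemma chebSS k : cheb k.+2 = 2%:P * 'X * cheb k.+1 - cheb k.
Proof. by rewrite /cheb /=; case: (cheb2 k). Qed.

Lemma size_cheb k : (size (cheb k) <= k.+1)%N.
Proof.
suff [] : (size (cheb k) <= k.+1)%N /\ (size (cheb k.+1) <= k.+2)%N by [].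
elim: k => [|k [IH1 IH2]]; first by rewrite cheb0 cheb1 size_poly1 size_polyX.
split=> //; rewrite chebSS.
apply: leq_trans (size_polyD _ _) _; rewrite size_polyN geq_max; apply/andP; split.
  rewrite -mulrA; apply: leq_trans (size_polyMleq _ _) _.
  have h1 : (size (2%:P : {poly C}) <= 1)%N by exact: size_polyC_leq1.
  have h2 : (size ('X * cheb k.+1)%R <= k.+3)%N.
    by apply: leq_trans (size_polyMleq _ _) _; rewrite size_polyX.
  by rewrite -[leqRHS]/(1 + k.+3).-1; have := leq_add h1 h2; lia.
by apply: leq_trans IH1 _; lia.
Qed.

(** This is [cos (k t)] as a polynomial in [cos t], continued to complex [t]. *)
Lemma cheb_joukowski k w : w != 0 ->
  (cheb k).[joukowski w] = (w ^+ k + w ^- k) / 2.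
Proof.
move=> w0.
suff [] : (cheb k).[joukowski w] = (w ^+ k + w ^- k) / 2 /\
   (cheb k.+1).[joukowski w] = (w ^+ k.+1 + w ^- k.+1) / 2 by [].
elim: k => [|k [IH1 IH2]].
  split; first by rewrite cheb0 hornerE !expr0 invr1; field.
  by rewrite cheb1 hornerX expr1.
split=> //; rewrite chebSS hornerD hornerN !hornerM hornerC hornerX IH1 IH2.
rewrite /joukowski !exprS.
by field; rewrite expf_neq0.
Qed.

Lemma cheb_le k r w : 0 < r -> 1 <= normc w -> normc w <= expR r ->
  normc (cheb k).[joukowski w] <= expR r ^+ k.
Proof.
move=> r0 w1 wr; have w0 : w != 0 by rewrite -normc_gt0; lra.
rewrite cheb_joukowski // normcM normcV normc_nat.
have e1 : 1 <= normc w ^+ k by rewrite exprn_ege1.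
have h1 : normc w ^+ k <= expR r ^+ k.
  by rewrite lerXn2r ?nnegrE ?normc_ge0 ?expR_ge0.
have h2 : (normc w ^+ k)^-1 <= 1 by rewrite invf_le1 //; lra.
have := normcD (w ^+ k) (w ^- k); rewrite normcV !normcX.
rewrite ler_pdivrMr //; lra.
Qed.

Lemma cheb_add n k w : w != 0 ->
  (cheb (n + k)).[joukowski w] + (cheb (maxn n k - minn n k)).[joukowski w] =
  2 * (cheb n).[joukowski w] * (cheb k).[joukowski w].
Proof.
move=> w0; wlog nk : n k / (k <= n)%N => [H|].
  case/orP: (leq_total k n) => nk; first exact: H.
  by rewrite addnC maxnC minnC [in RHS]mulrAC; exact: H.
rewrite (maxn_idPl nk) (minn_idPr nk).
have {1 3}-> : n = (n - k + k)%N by rewrite subnK.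
rewrite !cheb_joukowski // !exprD; field.
by rewrite !expf_neq0.
Qed.

(** Generating function of the Chebyshev polynomials, which is the kernel of
    Cauchy's formula on an ellipse. *)
Definition cheb_kernel_coef rho z k : C :=
  if k == 0%N then 1 else 2 * (cheb k).[z] / toC rho ^+ k.

(** With [x = w0 / (rho w)] and [y = 1 / (rho w w0)] the kernel is
    [1 / (1 - x) + 1 / (1 - y) - 1], a sum of two geometric series, and
    [x ^ k + y ^ k] is a multiple of the Chebyshev polynomial. *)
Lemma cheb_kernel rho w0 w m : 1 <= normc w0 -> normc w0 < rho -> normc w = 1 ->
  normc (lcurve' (toC rho / 2) ((toC rho)^-1 / 2) w /
           (lcurve 0 (toC rho / 2) ((toC rho)^-1 / 2) w - joukowski w0)
         - \sum_(k < m) cheb_kernel_coef rho (joukowski w0) k * w ^- k)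
  <= 3 * (1 - normc w0 / rho)^-1 * (normc w0 / rho) ^+ m.
Proof.
move=> w01 w0r w1; set q := normc w0 / rho.
set b := toC rho / 2; set c := (toC rho)^-1 / 2.
have rho0 : 0 < rho by lra.
have rC : toC rho != 0 by rewrite fmorph_eq0 gt_eqF.
have nr : normc (toC rho) = rho by rewrite normc_real ger0_norm ?ltW.
have nw : w != 0 by rewrite -normc_gt0 w1.
have nw0 : w0 != 0 by rewrite -normc_gt0; lra.
have q1 : q < 1 by rewrite /q ltr_pdivrMr ?mul1r.
have q0 : 0 <= q by rewrite divr_ge0 ?normc_ge0 ?ltW.
pose x := w0 / (toC rho * w); pose y := w0^-1 / (toC rho * w).
have nx : normc x <= q by rewrite /x !normcM normcV normcM nr w1 mulr1.
have ny : normc y <= q.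
  rewrite /y !normcM !normcV normcM nr w1 mulr1 /q ler_wpM2r ?invr_ge0 ?(ltW rho0) //.
  have : (normc w0)^-1 <= 1 by rewrite invf_le1 //; lra.
  lra.
have x1 : 1 - x != 0.
  by rewrite -normc_gt0; have := normcD (1 - x) x; rewrite subrK normc1; lra.
have y1 : 1 - y != 0.
  by rewrite -normc_gt0; have := normcD (1 - y) y; rewrite subrK normc1; lra.
have xE : 1 - x = (toC rho * w - w0) / (toC rho * w).
  by rewrite /x; field; rewrite rC nw.
have yE : 1 - y = (toC rho * w * w0 - 1) / (toC rho * w * w0).
  by rewrite /y; field; rewrite rC nw nw0.
have x1' : toC rho * w - w0 != 0.
  by apply: contra_neq x1 => E; rewrite xE E mul0r.
have y1' : toC rho * w * w0 - 1 != 0.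
  by apply: contra_neq y1 => E; rewrite yE E mul0r.
have -> : lcurve' b c w / (lcurve 0 b c w - joukowski w0) =
    (1 - x)^-1 + (1 - y)^-1 - 1.
  have -> : lcurve 0 b c w - joukowski w0 = (toC rho * w - w0) *
      (toC rho * w * w0 - 1) / (2 * toC rho * w * w0).
    by rewrite /lcurve /joukowski /b /c; field; rewrite rC nw nw0.
  rewrite xE yE /lcurve' /b /c; field.
  by rewrite rC nw nw0 x1' y1'.
have i1 : 1 <= (1 - q)^-1 by rewrite invf_ge1; lra.
have gx := geometric_tail m nx q1; have gy := geometric_tail m ny q1.
case: m gx gy => [|m].
  rewrite !big_ord0 !subr0 expr0 !mulr1 => gx gy.
  apply: le_trans (normcB _ _) _; rewrite normc1.
  have := normcD (1 - x)^-1 (1 - y)^-1; lra.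
move=> gx gy.
have -> : \sum_(k < m.+1) cheb_kernel_coef rho (joukowski w0) k * w ^- k =
    \sum_(k < m.+1) x ^+ k + \sum_(k < m.+1) y ^+ k - 1.
  rewrite !big_ord_recl /= !expr0 invr1 mulr1 /cheb_kernel_coef /=.
  have -> : \sum_(i < m) 2 * (cheb (bump 0 i)).[joukowski w0] / toC rho ^+ bump 0 i
      / w ^+ bump 0 i = \sum_(i < m) x ^+ bump 0 i + \sum_(i < m) y ^+ bump 0 i.
    rewrite -big_split; apply: eq_bigr => i _ /=.
    rewrite cheb_joukowski // /x /y !(exprMn, exprVn); field.
    by rewrite !expf_neq0.
  ring.
set X := \sum_(k < m.+1) x ^+ k in gx *; set Y := \sum_(k < m.+1) y ^+ k in gy *.
have -> : (1 - x)^-1 + (1 - y)^-1 - 1 - (X + Y - 1) =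
  ((1 - x)^-1 - X) + ((1 - y)^-1 - Y) by ring.
apply: le_trans (normcD _ _) _.
have : 0 <= (1 - q)^-1 * q ^+ m.+1 by rewrite mulr_ge0 ?exprn_ge0 //; lra.
lra.
Qed.

(** The coefficients as means over the ellipse on which the Joukowski coordinate
    has absolute value [rho]. *)
Definition cheb_coef (f : C -> C) rho k : C :=
  (if k == 0%N then 1 else 2) / toC rho ^+ k *
  mean (fun w => f (lcurve 0 (toC rho / 2) ((toC rho)^-1 / 2) w) * w ^- k).

Lemma ellipse_curve R rho w : 0 < R -> 1 <= rho -> rho < expR R ->
  normc w = 1 -> ellipse R (lcurve 0 (toC rho / 2) ((toC rho)^-1 / 2) w).
Proof.
move=> R0 rho1 rhoR w1.
have rho0 : 0 < rho by lra.
have nr : normc (toC rho) = rho by rewrite normc_real ger0_norm ?ltW.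
apply/ellipseP => //; exists (toC rho * w).
rewrite !normcM nr w1 mulr1; split=> //.
rewrite /lcurve /joukowski invfM; field.
by rewrite -!normc_eq0 w1 nr oner_neq0 gt_eqF.
Qed.

Lemma cheb_coef_le f R rho B k : 0 < R -> 1 < rho -> rho < expR R ->
  (forall z, ellipse R z -> normc (f z) <= B) ->
  normc (cheb_coef f rho k) <= 2 * B / rho ^+ k.
Proof.
move=> R0 rho1 rhoR fB.
have rho0 : 0 < rho by lra.
have nr : normc (toC rho) = rho by rewrite normc_real ger0_norm ?ltW.
have mB : normc (mean (fun w => f (lcurve 0 (toC rho / 2) ((toC rho)^-1 / 2) w) * w ^- k)) <= B.
  apply: mean_le => w w1; rewrite normcM normcV normcX w1 expr1n invr1 mulr1.
  by apply: fB; apply: ellipse_curve => //; exact: ltW.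
have B0 := le_trans (normc_ge0 _) mB.
rewrite /cheb_coef normcM normcM normcV normcX nr mulrAC.
rewrite ler_wpM2r ?invr_ge0 ?exprn_ge0 ?(ltW rho0) //.
by apply: ler_pM; rewrite ?normc_ge0 //; case: ifP; rewrite ?normc1 ?normc_nat ?ler1n.
Qed.

Lemma cheb_expansion f R rho w B m : 0 < R -> 1 < rho -> rho < expR R ->
  (forall z, ellipse R z -> hol f z) ->
  (forall z, ellipse R z -> normc (f z) <= B) ->
  1 <= normc w -> normc w < rho ->
  normc (f (joukowski w) -
         \sum_(k < m) cheb_coef f rho k * (cheb k).[joukowski w])
  <= B * (3 * (1 - normc w / rho)^-1 * (normc w / rho) ^+ m).
Proof.
move=> R0 rho1 rhoR fh fB w1 wr; set q := normc w / rho.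
have rho0 : 0 < rho by lra.
have rC : toC rho != 0 by rewrite fmorph_eq0 gt_eqF.
have nr : normc (toC rho) = rho by rewrite normc_real ger0_norm ?ltW.
have nw : w != 0 by rewrite -normc_gt0; lra.
have q1 : q < 1 by rewrite /q ltr_pdivrMr ?mul1r.
have q0 : 0 <= q by rewrite divr_ge0 ?normc_ge0 ?ltW.
have Ew : ellipse R (joukowski w) by apply/ellipseP => //; exists w; split=> //; lra.
have crv y : normc y = 1 -> ellipse R (lcurve 0 (toC rho / 2) ((toC rho)^-1 / 2) y).
  by move=> y1; apply: ellipse_curve => //; exact: ltW.
have -> : \sum_(k < m) cheb_coef f rho k * (cheb k).[joukowski w] =
  \sum_(k < m) cheb_kernel_coef rho (joukowski w) k *
    mean (fun y => f (lcurve 0 (toC rho / 2) ((toC rho)^-1 / 2) y) * y ^- k).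
  apply: eq_bigr => k _; rewrite /cheb_coef /cheb_kernel_coef.
  case: eqP => [->|_]; last by ring.
  have -> : (cheb 0).[joukowski w] = 1 by rewrite cheb0 hornerE.
  by rewrite expr0; field.
pose eta := (rho - normc w) * (rho - 1) / (2 * rho).
have eta0 : 0 < eta by rewrite divr_gt0 ?mulr_gt0 ?subr_gt0.
apply: (cauchy_expansion (eta := eta)) => //.
- by move=> z [s [y [s01 y1 ->]]]; apply: fh; apply: ellipse_segment => //; exact: crv.
- move=> y y1; have ny : y != 0 by rewrite -normc_gt0 y1.
  have -> : lcurve 0 (toC rho / 2) ((toC rho)^-1 / 2) y - joukowski w =
    (toC rho * y - w) * (toC rho * y - w^-1) / (2 * toC rho * y).
    by rewrite /lcurve /joukowski; field; rewrite rC ny nw.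
  rewrite !normcM normcV !normcM normc_nat nr y1 mulr1 /eta.
  rewrite ler_wpM2r ?invr_ge0 ?mulr_ge0 ?(ltW rho0) //.
  have h1 : rho - normc w <= normc (toC rho * y - w).
    by have := normcD (toC rho * y - w) w; rewrite subrK normcM nr y1; lra.
  have h2 : rho - 1 <= normc (toC rho * y - w^-1).
    have := normcD (toC rho * y - w^-1) w^-1; rewrite subrK normcM nr y1 normcV.
    have : (normc w)^-1 <= 1 by rewrite invf_le1 //; lra.
    lra.
  by apply: ler_pM; lra.
- by move=> y y1; apply: fB; exact: crv.
- by rewrite q0 q1.
- by move=> y p y1; exact: cheb_kernel.
Qed.

End Chebyshev.

Section Interpolation.
Context {K : realType}.
Local Notation C := K[i].
Implicit Types (r R rho s : K) (z y w : C) (k m n N : nat) (f : C -> C).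

Definition node_angle N (j : 'I_N) : K := (2 * j + 1)%:R / (2 * N)%:R * pi.

Lemma node_angle_bounds N (j : 'I_N) : 0 <= node_angle j <= pi.
Proof.
have jN := ltn_ord j; have pi0 := @pi_ge0 K.
have N0 : 0 < (2 * N)%:R :> K by rewrite ltr0n; lia.
rewrite /node_angle mulr_ge0 ?divr_ge0 //= ?(ltW N0) //.
rewrite ler_piMl // ler_pdivrMr // mul1r ler_nat; lia.
Qed.

Lemma cheb_node_inj N : injective (@cheb_node K N).
Proof.
move=> i j /cos_inj => /(_ _ _)/wrap[].
- by rewrite in_itv /=; exact: node_angle_bounds.
- by rewrite in_itv /=; exact: node_angle_bounds.
have pi0 : (pi : K) != 0 by rewrite gt_eqF // pi_gt0.
move=> /(mulIf pi0).
have N0 : (2 * N)%:R != 0 :> K.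
  by rewrite pnatr_eq0; have := ltn_ord i; lia.
move=> /(mulIf (invr_neq0 N0)) /eqP; rewrite eqr_nat => /eqP ij.
by apply: val_inj => /=; lia.
Qed.

Lemma cheb_node_joukowski N (j : 'I_N) :
  toC (cheb_node j) = joukowski (cis (node_angle j)).
Proof. by rewrite joukowski_cis. Qed.

Lemma cheb_node_bounds N (j : 'I_N) : -1 <= (cheb_node j : K) <= 1.
Proof. by rewrite cos_geN1 cos_le1. Qed.

Lemma ellipse_node N (j : 'I_N) R : 0 < R -> ellipse R (toC (cheb_node j)).
Proof. by move=> R0; apply: ellipse_real => //; exact: cheb_node_bounds. Qed.

Lemma cheb_node_root N (j : 'I_N) : (cheb N).[toC (cheb_node j : K)] = 0.
Proof.
rewrite cheb_node_joukowski cheb_joukowski ?cis_neq0 // -exprVn.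
have ci t : (cis t)^-1 = cis (- t) :> C.
  apply: (mulfI (cis_neq0 t)); rewrite mulfV ?cis_neq0 // -cisD subrr.
  by apply: complexP; rewrite /cis /= ?cos0 ?sin0.
rewrite ci !cisX.
have N0 : (2 * N)%:R != 0 :> K.
  by rewrite pnatr_eq0; have := ltn_ord j; lia.
have N0' : N%:R != 0 :> K.
  by rewrite pnatr_eq0; have := ltn_ord j; lia.
have aE : N%:R * node_angle j = j%:R * pi + pi / 2.
  by rewrite /node_angle natrD !natrM; field; rewrite N0'.
have cos0 : cos (N%:R * node_angle j) = 0.
  rewrite aE cosDpihalf mulr_natl.
  suff -> : sin (pi *+ j) = 0 :> K by rewrite oppr0.
  elim: (nat_of_ord j) => [|n IH]; first by rewrite mulr0n sin0.
  by rewrite mulrSr sinDpi IH oppr0.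
rewrite mulrN /cis cosN sinN cos0.
have -> : Complex 0 (sin (N%:R * node_angle j)) +
   Complex 0 (- sin (N%:R * node_angle j)) = 0 :> C.
  by apply: complexP; rewrite ?ReD ?ImD /= ?addr0 ?subrr.
by rewrite mul0r.
Qed.

(** As [T_N] vanishes at the nodes, so does [T_(N + k) + T_|N - k| = 2 T_N T_k],
    which lowers the degree. *)
Lemma cheb_alias N k : (0 < N)%N -> exists (e : C) k',
  [/\ normc e <= 1, (k' < N)%N, (k' <= k)%N &
   forall j : 'I_N, (cheb k).[toC (cheb_node j : K)] =
                    e * (cheb k').[toC (cheb_node j : K)]].
Proof.
move=> N0; elim/ltn_ind: k => k IH.
have [kN|Nk] := ltnP k N.
  by exists 1, k; split=> // [|j]; rewrite ?normc1 ?mul1r.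
have red (j : 'I_N) : (cheb k).[toC (cheb_node j : K)] =
    - (cheb (maxn N (k - N) - minn N (k - N))).[toC (cheb_node j : K)].
  apply/eqP; rewrite -addr_eq0; apply/eqP.
  have := @cheb_add K N (k - N) (cis (node_angle j)) (cis_neq0 _).
  rewrite -cheb_node_joukowski cheb_node_root mulr0 mul0r.
  by rewrite (subnKC Nk).
case: (eqVneq k N) => [kE|kN].
  exists 0, 0%N; split=> // [|j]; first by rewrite normc0.
  by rewrite kE cheb_node_root mul0r.
have lt : (maxn N (k - N) - minn N (k - N) < k)%N by lia.
have [e [k' [e1 k'N k'k H]]] := IH _ lt.
exists (- e), k'; split=> // [||j]; first by rewrite normcN.
  by lia.
by rewrite red H mulNr.
Qed.

Definition interp N f z : C :=
  \sum_(j < N) f (toC (cheb_node j)) * lagrange j z.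

Lemma lagrange_node N (k j : 'I_N) :
  lagrange k (toC (cheb_node j : K)) = (j == k)%:R.
Proof.
rewrite /lagrange; case: eqP => [->|/eqP jk].
  rewrite big1 // => m mk; rewrite -rmorphB divff // fmorph_eq0 subr_eq0.
  by apply: contra_neq mk => /cheb_node_inj.
rewrite (bigD1 j) /=; last by rewrite jk.
by rewrite subrr !mul0r.
Qed.

Lemma interp_node N f (j : 'I_N) :
  interp N f (toC (cheb_node j)) = f (toC (cheb_node j)).
Proof.
rewrite /interp (bigD1 j) //= lagrange_node eqxx mulr1 big1 ?addr0 // => k kj.
by rewrite lagrange_node eq_sym (negPf kj) mulr0.
Qed.

Lemma eq_interp N f g z :
  (forall j : 'I_N, f (toC (cheb_node j)) = g (toC (cheb_node j))) ->
  interp N f z = interp N g z.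
Proof. by move=> fg; apply: eq_bigr => j _; rewrite fg. Qed.

Lemma interp_poly N (p : {poly C}) z : (size p <= N)%N ->
  interp N (fun y => p.[y]) z = p.[z].
Proof.
move=> pN.
pose L (k : 'I_N) : {poly C} :=
  \prod_(m < N | m != k) ((toC (cheb_node k - cheb_node m))^-1 *:
    ('X - (toC (cheb_node m))%:P)).
have LE (k : 'I_N) y : (L k).[y] = lagrange k y.
  rewrite /L horner_prod; apply: eq_bigr => m _.
  by rewrite hornerZ hornerXsubC mulrC.
have Lsize (k : 'I_N) : (size (L k) <= N)%N.
  apply: leq_trans (size_poly_prod_leq _ _) _.
  have : (\sum_(m < N | m != k) size ((toC (cheb_node k - cheb_node m : K))^-1 *:
      ('X - (toC (cheb_node m))%:P))%R <= \sum_(m < N | m != k) 2)%N.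
    apply: leq_sum => m _; apply: leq_trans (size_scale_leq _ _) _.
    by rewrite size_XsubC.
  rewrite sum_nat_const.
  have -> : #|[pred i | i != k]| = N.-1.
    have := cardC1 k; rewrite card_ord => <-; exact: eq_card.
  have := ltn_ord k; set X := \sum_(_ < _ | _) _; lia.
pose q := \sum_(j < N) p.[toC (cheb_node j)] *: L j - p.
have qE y : q.[y] = interp N (fun y => p.[y]) y - p.[y].
  rewrite /q hornerD hornerN horner_sum; congr (_ - _).
  by apply: eq_bigr => j _; rewrite hornerZ LE.
suff q0 : q = 0.
  by apply/eqP; rewrite -subr_eq0 -qE q0 horner0.
apply: (@roots_geq_poly_eq0 _ _ [seq toC (cheb_node j : K) | j <- enum 'I_N]).
- apply/allP => _ /mapP[j _ ->]; rewrite rootE qE interp_node subrr //.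
- rewrite map_inj_uniq ?enum_uniq // => i j /complexI; exact: cheb_node_inj.
- rewrite size_map size_enum_ord.
  apply: leq_trans (size_polyD _ _) _; rewrite size_polyN geq_max pN andbT.
  apply: leq_trans (size_sum _ _ _) _; apply/bigmax_leqP => j _.
  exact: leq_trans (size_scale_leq _ _) (Lsize j).
Qed.

(** Interpolation is exact in degree below [N]; in higher degree it returns, up
    to a factor, a Chebyshev polynomial of lower degree. *)
Lemma interp_cheb_err N k r w : (0 < N)%N -> 0 < r -> 1 <= normc w ->
  normc w <= expR r ->
  normc (interp N (fun y => (cheb k).[y]) (joukowski w) -
         (cheb k).[joukowski w]) <= (if (k < N)%N then 0 else 2 * expR r ^+ k).
Proof.
move=> N0 r0 w1 wr; case: ifP => [kN|_].
  rewrite interp_poly ?subrr ?normc0 //.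
  exact: leq_trans (size_cheb _) kN.
have [e [k' [e1 k'N k'k H]]] := cheb_alias k N0.
rewrite (@eq_interp N _ (fun y => (e *: cheb k').[y])); last first.
  by move=> j; rewrite H hornerZ.
rewrite interp_poly; last first.
  by apply: leq_trans (size_scale_leq _ _) _; exact: leq_trans (size_cheb _) k'N.
rewrite hornerZ; apply: le_trans (normcB _ _) _; rewrite normcM.
have h1 := cheb_le k r0 w1 wr; have h2 := cheb_le k' r0 w1 wr.
have h3 : expR r ^+ k' <= expR r ^+ k.
  by rewrite ler_weXn2l // ltW // expR_gt1.
have := normc_ge0 (cheb k').[joukowski w]; have := normc_ge0 e.
set x := normc e in e1 *; set a := normc _ in h1 *; set b := normc _ in h2 *.
nra.
Qed.

Lemma interpB N f g z :
  interp N (fun y => f y - g y) z = interp N f z - interp N g z.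
Proof. by rewrite /interp -sumrB; apply: eq_bigr => j _; rewrite mulrBl. Qed.

Lemma interp_sum N n (c : nat -> C) (F : nat -> C -> C) z :
  interp N (fun y => \sum_(k < n) c k * F k y) z =
  \sum_(k < n) c k * interp N (F k) z.
Proof.
rewrite /interp; under eq_bigr => j _ do rewrite mulr_suml.
rewrite exchange_big; apply: eq_bigr => k _ /=.
by rewrite mulr_sumr; apply: eq_bigr => j _; rewrite mulrA.
Qed.

(** The errors for the terms of the Chebyshev expansion add up to a geometric
    series starting at degree [N].  The expansion is truncated at [m], and the
    truncation error tends to zero as [N] is fixed and [m] grows. *)
Lemma interp_err_rho f R r rho w B N : 0 < r -> expR r < rho -> rho < expR R ->
  (forall z, ellipse R z -> hol f z) ->
  (forall z, ellipse R z -> normc (f z) <= B) ->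
  (0 < N)%N -> 1 <= normc w -> normc w <= expR r ->
  normc (interp N f (joukowski w) - f (joukowski w)) <=
    4 * B * ((expR r / rho) ^+ N / (1 - expR r / rho)).
Proof.
move=> r0 rrho rhoR fh fB N0 w1 wr.
have rR : r < R by rewrite -ltr_expR; lra.
have R0 : 0 < R by lra.
have er1 : 1 < expR r by rewrite expR_gt1.
have rho0 : 0 < rho by lra.
have rho1 : 1 < rho by lra.
have wrho : normc w < rho by lra.
set t := expR r / rho.
have t1 : t < 1 by rewrite /t ltr_pdivrMr // mul1r.
have t0 : 0 <= t by rewrite divr_ge0 ?expR_ge0 ?(ltW rho0).
set q := normc w / rho.
have q1 : q < 1 by rewrite /q ltr_pdivrMr // mul1r.
have q0 : 0 <= q by rewrite divr_ge0 ?normc_ge0 ?(ltW rho0).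
have B0 : 0 <= B.
  by apply: le_trans (normc_ge0 _) (fB (toC 0) _); apply: ellipse_real => //; lra.
pose A := 3 * (1 - q)^-1.
have iq0 : 0 < (1 - q)^-1 by rewrite invr_gt0; lra.
have A0 : 0 <= A by rewrite mulr_ge0 // ltW.
pose fm m y := \sum_(k < m) cheb_coef f rho k * (cheb k).[y].
pose Lam := \sum_(j < N) normc (lagrange j (joukowski w)).
have Lam0 : 0 <= Lam by apply: sumr_ge0 => j _; exact: normc_ge0.
rewrite -subr_le0; apply: (@le_geom_eq0 _ _ ((Lam + 1) * (B * A)) q).
  by rewrite q0 q1.
move=> m; rewrite lerBlDr.
(* for fixed N a crude bound for the interpolation operator is enough here *)
have e1 : normc (interp N f (joukowski w) - interp N (fm m) (joukowski w))
    <= Lam * (B * A * q ^+ m).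
  rewrite -interpB /interp mulr_suml; apply: normc_sum_le => j _.
  rewrite normcM mulrC ler_wpM2l ?normc_ge0 //.
  rewrite cheb_node_joukowski.
  have n1 : normc (cis (node_angle j)) = 1 by exact: normc_cis.
  have := @cheb_expansion K f R rho (cis (node_angle j)) B m R0 rho1 rhoR fh fB.
  rewrite n1 lexx => /(_ isT rho1) h; apply: le_trans h _.
  rewrite -[B * A * _]mulrA ler_wpM2l //.
  have pq : 1 / rho <= q by rewrite /q ler_wpM2r ?invr_ge0 ?(ltW rho0).
  have p0 : 0 <= 1 / rho by rewrite divr_ge0 ?(ltW rho0).
  move: pq p0; move: (1 / rho) => p pq p0.
  apply: ler_pM; rewrite ?exprn_ge0 //.
  - by rewrite mulr_ge0 // invr_ge0; lra.
  - by rewrite /A ler_wpM2l // lef_pV2 ?posrE; lra.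
  - by rewrite lerXn2r ?nnegrE.
have e2 : normc (f (joukowski w) - fm m (joukowski w)) <= B * A * q ^+ m.
  by have := @cheb_expansion K f R rho w B m R0 rho1 rhoR fh fB w1 wrho; rewrite mulrA.
have e3 : normc (interp N (fm m) (joukowski w) - fm m (joukowski w)) <=
    4 * B * (t ^+ N / (1 - t)).
  rewrite /fm (interp_sum N m (cheb_coef f rho) (fun k y => (cheb k).[y])) -sumrB.
  have [mN|Nm] := leqP m N.
    rewrite big1 ?normc0 => [|k _].
      by rewrite !mulr_ge0 ?exprn_ge0 // invr_ge0; lra.
    rewrite -mulrBr; have := @interp_cheb_err N k r w N0 r0 w1 wr.
    rewrite (leq_trans (ltn_ord k) mN) => h.
    have /eqP : normc (interp N (fun y => (cheb k).[y]) (joukowski w) -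
       (cheb k).[joukowski w]) = 0 by apply/eqP; rewrite eq_le h normc_ge0.
    by rewrite normc_eq0 => /eqP ->; rewrite mulr0.
  rewrite -(subnKC (ltnW Nm)) big_split_ord /= big1 ?add0r => [|k _]; last first.
    rewrite -mulrBr; have := @interp_cheb_err N k r w N0 r0 w1 wr.
    rewrite (ltn_ord k) => h.
    have /eqP : normc (interp N (fun y => (cheb k).[y]) (joukowski w) -
       (cheb k).[joukowski w]) = 0 by apply/eqP; rewrite eq_le h normc_ge0.
    by rewrite normc_eq0 => /eqP ->; rewrite mulr0.
  rewrite mulrA; apply: (@normc_sum_geom _ (fun k =>
     cheb_coef f rho (N + k) * interp N (fun y => (cheb (N + k)).[y]) (joukowski w)
     - cheb_coef f rho (N + k) * (cheb (N + k)).[joukowski w])) => //.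
    by rewrite !mulr_ge0 ?exprn_ge0.
  move=> k _; rewrite -mulrBr normcM.
  have h1 := @cheb_coef_le K f R rho B (N + k) R0 rho1 rhoR fB.
  have := @interp_cheb_err N (N + k) r w N0 r0 w1 wr.
  rewrite ltnNge leq_addr /= => h2.
  apply: le_trans (ler_pM (normc_ge0 _) (normc_ge0 _) h1 h2) _.
  by rewrite -[leRHS]mulrA -exprD /t expr_div_n le_eqVlt; apply/orP; left; apply/eqP; ring.
have -> : interp N f (joukowski w) - f (joukowski w) =
  (interp N f (joukowski w) - interp N (fm m) (joukowski w)) +
  (interp N (fm m) (joukowski w) - fm m (joukowski w)) -
  (f (joukowski w) - fm m (joukowski w)) by ring.
apply: le_trans (normcB _ _) _; apply: le_trans (lerD (normcD _ _) (lexx _)) _.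
move: e1 e2 e3; move: (normc _) (normc _) (normc _) => x1 x2 x3 e1 e2 e3.
lra.
Qed.

(** The previous bound, in the limit where [rho] tends to [expR R]. *)
Lemma interp_err f R r z B N : 0 < r -> r < R ->
  (forall z, ellipse R z -> hol f z) ->
  (forall z, ellipse R z -> normc (f z) <= B) ->
  (0 < N)%N -> ellipse r z ->
  normc (interp N f z - f z) <=
    4 * B * (expR (- ((R - r) * N%:R)) / (1 - expR (- (R - r)))).
Proof.
move=> r0 rR fh fB N0 /(ellipseP _ r0)[w [w1 wr ->]].
have R0 : 0 < R by lra.
have er0 := expR_gt0 r; have eR0 := expR_gt0 R.
have erR : expR r < expR R by rewrite ltr_expR.
have B0 : 0 <= B.
  by apply: le_trans (normc_ge0 _) (fB (toC 0) _); apply: ellipse_real => //; lra.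
set x := normc _.
pose t := expR (- (R - r)).
have tE : t = expR r / expR R by rewrite /t opprB expRD expRN.
have t1 : t < 1 by rewrite /t expR_lt1; lra.
have t0 : 0 < t by exact: expR_gt0.
have -> : expR (- ((R - r) * N%:R)) = t ^+ N.
  by rewrite /t -expRM_natr mulNr.
rewrite -/t.
have H s : t < s -> s < 1 -> x * (1 - s) <= 4 * B * s ^+ N.
  move=> ts s1; have s0 : 0 < s by lra.
  have := @interp_err_rho f R r (expR r / s) w B N r0.
  rewrite ltr_pdivlMr // -[ltRHS]mulr1 ltr_pM2l // => /(_ s1).
  rewrite ltr_pdivrMr // mulrC -ltr_pdivrMr // -tE => /(_ ts fh fB N0 w1 (ltW wr)).
  have -> : expR r / (expR r / s) = s by field; rewrite !gt_eqF.
  rewrite -/x.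
  rewrite mulrA ler_pdivlMr ?subr_gt0 //.
rewrite mulrA ler_pdivlMr ?subr_gt0 //.
(* continuity of s ^+ N at t *)
apply/ler_addgt0Pl => e e0.
have ct : {for t, continuous (fun s : K => 4 * B * s ^+ N + x * (s - t))}.
  apply: cvgD; first by apply: cvgM; [exact: cvg_cst|exact: exprn_continuous].
  by apply: cvgM; [exact: cvg_cst|apply: cvgB; [exact: cvg_id|exact: cvg_cst]].
have /cvgrPdist_lt/(_ e e0)[d /= d0 Hd] := ct.
pose s := Num.min (t + d / 2) ((t + 1) / 2).
have ts : t < s by rewrite lt_min; apply/andP; split; lra.
have s1 : s < 1 by rewrite gt_min; apply/orP; right; lra.
have sd : s <= t + d / 2 by rewrite ge_min lexx.
have := Hd s; rewrite subrr mulr0 addr0 => /(_ _)/wrap[].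
  by rewrite /ball_ /= distrC ger0_norm; lra.
rewrite ltr_norml => /andP[h1 _].
have := H s ts s1; lra.
Qed.

End Interpolation.

(** Identities between sums in an abelian group, by cancelling opposite
    summands. *)
Ltac zmodule := apply/eqP; rewrite -subr_eq0; apply/eqP;
  rewrite ?(opprD, opprB, opprK, oppr0, addr0, add0r) -[LHS]add0r ?addrA;
  repeat match goal with
  | |- _ - ?x = 0 => first [rewrite addrK | rewrite subrK | rewrite (addrAC _ x)]
  | |- _ + ?x = 0 => first [rewrite addrK | rewrite subrK | rewrite (addrAC _ (- x))]
  end; reflexivity.

(** * Operators approximable by operators of finite rank *)

Section BanachDefs.
Context {K : realType} {X : lmodType K[i]}.
Local Notation C := K[i].

(** A complete norm; completeness is only ever used for sequences whose steps
    decrease geometrically. *)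
Record banach_norm (nrm : X -> K) : Prop := {
  nrmD : forall u v, nrm (u + v) <= nrm u + nrm v;
  nrmZ : forall (a : C) u, nrm (a *: u) = normc a * nrm u;
  nrm_eq0 : forall u, nrm u = 0 -> u = 0;
  nrm_complete : forall (u : nat -> X) (c q : K), 0 <= q < 1 ->
    (forall n, nrm (u n.+1 - u n) <= c * q ^+ n) ->
    exists x, forall n, nrm (x - u n) <= c / (1 - q) * q ^+ n }.

Definition lin_op (T : X -> X) :=
  forall (a : C) u v, T (a *: u + v) = a *: T u + T v.

Definition lin_fun (phi : X -> C) :=
  forall (a : C) u v, phi (a *: u + v) = a * phi u + phi v.

Definition bounded_fun (nrm : X -> K) (phi : X -> C) :=
  lin_fun phi /\ exists c : K, forall u, normc (phi u) <= c * nrm u.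

(** Limits in norm of operators of finite rank. *)
Definition approximable (nrm : X -> K) (T : X -> X) := forall e : K, 0 < e ->
  exists n (D : X -> X) (phi : 'I_n -> X -> C) (f : 'I_n -> X),
  [/\ lin_op D, forall u, nrm (D u) <= e * nrm u,
      forall j, bounded_fun nrm (phi j) &
      forall u, T u = D u + \sum_(j < n) phi j u *: f j].

End BanachDefs.

Section LinearMaps.
Context {K : realType} {X : lmodType K[i]}.
Local Notation C := K[i].
Variables (T : X -> X) (phi : X -> C).
Hypothesis (linT : lin_op T) (linphi : lin_fun phi).

Lemma lin_opD u v : T (u + v) = T u + T v.
Proof. by have := linT 1 u v; rewrite !scale1r. Qed.

Lemma lin_op0 : T 0 = 0.
Proof. by apply: (addrI (T 0)); rewrite -lin_opD !addr0. Qed.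

Lemma lin_opZ a u : T (a *: u) = a *: T u.
Proof. by have := linT a u 0; rewrite lin_op0 !addr0. Qed.

Lemma lin_opB u v : T (u - v) = T u - T v.
Proof. by rewrite -[- v]scaleN1r lin_opD lin_opZ scaleN1r. Qed.

Lemma lin_op_sum (I : Type) (s : seq I) (P : pred I) (F : I -> X) :
  T (\sum_(i <- s | P i) F i) = \sum_(i <- s | P i) T (F i).
Proof. by apply: big_morph; [exact: lin_opD|exact: lin_op0]. Qed.

Lemma lin_funD u v : phi (u + v) = phi u + phi v.
Proof. by have := linphi 1 u v; rewrite scale1r mul1r. Qed.

Lemma lin_fun0 : phi 0 = 0.
Proof. by apply: (addrI (phi 0)); rewrite -lin_funD !addr0. Qed.

Lemma lin_funZ a u : phi (a *: u) = a * phi u.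
Proof. by have := linphi a u 0; rewrite lin_fun0 !addr0. Qed.

Lemma lin_funB u v : phi (u - v) = phi u - phi v.
Proof. by rewrite -[- v]scaleN1r lin_funD lin_funZ mulN1r. Qed.

Lemma lin_fun_sum (I : Type) (s : seq I) (P : pred I) (F : I -> X) :
  phi (\sum_(i <- s | P i) F i) = \sum_(i <- s | P i) phi (F i).
Proof. by apply: big_morph; [exact: lin_funD|exact: lin_fun0]. Qed.

End LinearMaps.

Section Fredholm.
Context {K : realType} {X : lmodType K[i]}.
Local Notation C := K[i].
Variable nrm : X -> K.
Hypothesis bX : banach_norm nrm.

Lemma nrmN u : nrm (- u) = nrm u.
Proof. by rewrite -scaleN1r (nrmZ bX) normcN normc1 mul1r. Qed.

Lemma nrm0 : nrm 0 = 0.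
Proof. by rewrite -(scale0r (0 : X)) (nrmZ bX) normc0 mul0r. Qed.

Lemma nrmB u v : nrm (u - v) <= nrm u + nrm v.
Proof. by rewrite -[nrm v]nrmN; exact: nrmD. Qed.

Lemma nrm_distC u v : nrm (u - v) = nrm (v - u).
Proof. by rewrite -nrmN opprB. Qed.

Lemma nrm_ge0 u : 0 <= nrm u.
Proof. have := nrmB u u; rewrite subrr nrm0; lra. Qed.

Lemma nrm_gt0 u : u != 0 -> 0 < nrm u.
Proof.
move=> u0; rewrite lt_def nrm_ge0 andbT; apply: contra_neq u0.
exact: (nrm_eq0 bX).
Qed.

Lemma nrm_sum (I : Type) (s : seq I) (P : pred I) (F : I -> X) :
  nrm (\sum_(i <- s | P i) F i) <= \sum_(i <- s | P i) nrm (F i).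
Proof.
elim/big_ind2: _ => [|x a y b xa yb|//]; first by rewrite nrm0.
by apply: le_trans (nrmD bX _ _) _; exact: lerD.
Qed.

Lemma nrm_geom_eq0 u (A q : K) : 0 <= q < 1 -> (forall m, nrm u <= A * q ^+ m) ->
  u = 0.
Proof.
move=> q01 H; apply: (nrm_eq0 bX); apply/eqP.
by rewrite eq_le nrm_ge0 andbT; exact: le_geom_eq0 q01 H.
Qed.

Lemma bounded_fun_gt0 phi : bounded_fun nrm phi ->
  exists2 c : K, 0 < c & forall u, normc (phi u) <= c * nrm u.
Proof.
move=> [_ [c Hc]]; exists (`|c| + 1) => [|u].
  by have := normr_ge0 c; lra.
apply: le_trans (Hc u) _; rewrite ler_wpM2r ?nrm_ge0 //.
have := ler_norm c; lra.
Qed.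

(** Neumann series. *)
Lemma neumann (D : X -> X) (q : K) (z : C) chi : lin_op D -> 0 <= q ->
  q < normc z -> (forall u, nrm (D u) <= q * nrm u) ->
  exists2 u, z *: u - D u = chi & nrm u <= (normc z - q)^-1 * nrm chi.
Proof.
move=> linD q0 qz DB.
have z0 : 0 < normc z by lra.
have zn0 : z != 0 by rewrite -normc_gt0.
pose t := q / normc z.
have t0 : 0 <= t by rewrite divr_ge0 ?normc_ge0.
have t1 : t < 1 by rewrite ltr_pdivrMr // mul1r.
pose U := fix U n := if n is m.+1 then z^-1 *: (chi + D (U m)) else 0.
have US n : z *: U n.+1 = chi + D (U n) by rewrite /= scalerA mulfV // scale1r.
have step n : nrm (U n.+1 - U n) <= nrm chi / normc z * t ^+ n.
  elim: n => [|n IH].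
    rewrite /= (lin_op0 linD) addr0 subr0 (nrmZ bX) normcV expr0 mulr1.
    by rewrite mulrC.
  have -> : U n.+2 - U n.+1 = z^-1 *: D (U n.+1 - U n).
    by rewrite (lin_opB linD) /= -scalerBr opprD addrACA subrr add0r.
  rewrite (nrmZ bX) normcV exprS.
  have h1 := DB (U n.+1 - U n).
  have h2 : q * nrm (U n.+1 - U n) <= q * (nrm chi / normc z * t ^+ n).
    by rewrite ler_wpM2l.
  have -> : nrm chi / normc z * (t * t ^+ n) =
     (normc z)^-1 * (q * (nrm chi / normc z * t ^+ n)) by rewrite /t; ring.
  by rewrite ler_wpM2l ?invr_ge0 ?normc_ge0 //; lra.
have [|u Hu] := nrm_complete bX _ step; first by rewrite t0 t1.
set A := _ / (1 - t) in Hu.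
have E : z *: u - D u = chi.
  apply/eqP; rewrite -subr_eq0; apply/eqP.
  apply: (@nrm_geom_eq0 _ (normc z * (A * t) + q * A) t); first by rewrite t0 t1.
  move=> n; have -> : z *: u - D u - chi =
      z *: (u - U n.+1) - D (u - U n).
    rewrite scalerBr US (lin_opB linD).
    zmodule.
  apply: le_trans (nrmB _ _) _; rewrite (nrmZ bX).
  have h1 : normc z * nrm (u - U n.+1) <= normc z * (A * t ^+ n.+1).
    by rewrite ler_wpM2l ?normc_ge0.
  have h2 : q * nrm (u - U n) <= q * (A * t ^+ n) by rewrite ler_wpM2l.
  have h3 := DB (u - U n).
  move: h1; rewrite exprS; lra.
exists u => //.
have : nrm (z *: u) <= nrm chi + q * nrm u.
  have -> : z *: u = chi + D u by rewrite -E subrK.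
  by apply: le_trans (nrmD bX _ _) _; rewrite lerD2l.
rewrite (nrmZ bX) => h; rewrite ler_pdivlMl ?subr_gt0 //; lra.
Qed.

(** The Fredholm alternative: modulo an invertible operator the equation is a
    finite linear system. *)
Lemma fredholm_finite n (D : X -> X) (q : K) (z : C) (phi : 'I_n -> X -> C)
    (f : 'I_n -> X) : lin_op D -> 0 <= q -> q < normc z ->
  (forall u, nrm (D u) <= q * nrm u) -> (forall j, bounded_fun nrm (phi j)) ->
  (forall u, z *: u - D u - \sum_(j < n) phi j u *: f j = 0 -> u = 0) ->
  exists2 M : K, 0 < M & forall chi, exists2 u,
    z *: u - D u - \sum_(j < n) phi j u *: f j = chi & nrm u <= M * nrm chi.
Proof.
move=> linD q0 qz DB phiB inj.
have linphi j : lin_fun (phi j) by case: (phiB j).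
have exf' j : exists u, z *: u - D u = f j.
  by have [u E _] := neumann (f j) linD q0 qz DB; exists u.
have [f' Hf'] := choice exf'.
have exc j : exists c, 0 < c /\ forall u, normc (phi j u) <= c * nrm u.
  by have [c] := bounded_fun_gt0 (phiB j); exists c.
have [c Hc] := choice exc.
pose A : 'M[C]_n := 1%:M - \matrix_(k, j) phi j (f' k).
have AE (v : 'rV[C]_n) j : (v *m A) 0 j = v 0 j - \sum_k v 0 k * phi j (f' k).
  rewrite mulmxBr mulmx1 !mxE; congr (_ - _); apply: eq_bigr => k _.
  by rewrite !mxE.
pose comb (v : 'rV[C]_n) := \sum_(k < n) v 0 k *: f' k.
have comb_phi v j : phi j (comb v) = \sum_(k < n) v 0 k * phi j (f' k).
  rewrite (lin_fun_sum (linphi j)); apply: eq_bigr => k _.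
  exact: (lin_funZ (linphi j)).
have comb_eq v : z *: comb v - D (comb v) = \sum_(k < n) v 0 k *: f k.
  rewrite (lin_op_sum linD) scaler_sumr -sumrB; apply: eq_bigr => k _.
  by rewrite (lin_opZ linD) scalerA mulrC -scalerA -scalerBr Hf'.
have unitA : A \in unitmx.
  rewrite unitmxE unitfE; apply/det0P => -[v v0 vA].
  have vE j : v 0 j = phi j (comb v).
    rewrite comb_phi; apply/eqP; rewrite -subr_eq0 -AE vA mxE //.
  have c0 : comb v = 0.
    apply: inj; rewrite comb_eq; apply/eqP; rewrite subr_eq0; apply/eqP.
    by apply: eq_bigr => k _; rewrite -vE.
  move: v0; rewrite -subr_eq0 subr0 => /eqP; apply; apply/rowP => j.
  by rewrite vE c0 (lin_fun0 (linphi j)) mxE.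
pose M1 := 1 + \sum_(k < n) \sum_(j < n) c j * normc (invmx A j k) * nrm (f' k).
have M10 : 1 <= M1.
  rewrite /M1 lerDl; apply: sumr_ge0 => k _; apply: sumr_ge0 => j _.
  by rewrite !mulr_ge0 ?normc_ge0 ?nrm_ge0 // ltW //; case: (Hc j).
exists (M1 * (normc z - q)^-1).
  by rewrite mulr_gt0 ?invr_gt0 ?subr_gt0 //; lra.
move=> chi; have [u0 E0 B0] := neumann chi linD q0 qz DB.
pose p : 'rV[C]_n := \row_j phi j u0.
pose a := p *m invmx A.
have aA : a *m A = p by rewrite /a -mulmxA mulVmx // mulmx1.
have aE j : phi j (u0 + comb a) = a 0 j.
  rewrite (lin_funD (linphi j)) comb_phi.
  have := AE a j; rewrite aA mxE => ->; by rewrite subrK.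
exists (u0 + comb a).
  under eq_bigr => j _ do rewrite aE.
  rewrite -comb_eq scalerDr (lin_opD linD) -E0.
  by rewrite opprD addrACA addrK.
have ak k : normc (a 0 k) <= \sum_(j < n) c j * normc (invmx A j k) * nrm u0.
  rewrite /a mxE; apply: normc_sum_le => j _; rewrite mxE normcM mulrAC.
  by rewrite ler_wpM2r ?normc_ge0 //; case: (Hc j).
have combB : nrm (comb a) <=
    (\sum_(k < n) \sum_(j < n) c j * normc (invmx A j k) * nrm (f' k)) * nrm u0.
  apply: le_trans (nrm_sum _ _ _) _; rewrite mulr_suml; apply: ler_sum => k _.
  rewrite (nrmZ bX); apply: le_trans (ler_wpM2r (nrm_ge0 _) (ak k)) _.
  rewrite !mulr_suml le_eqVlt; apply/orP; left; apply/eqP.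
  by apply: eq_bigr => j _; rewrite mulrAC.
apply: le_trans (nrmD bX _ _) _.
apply: le_trans (_ : M1 * nrm u0 <= _); first by rewrite /M1 mulrDl mul1r lerD2l.
by rewrite -mulrA ler_wpM2l //; lra.
Qed.

(** The term with [k] has rank one and joins the finite-rank part of [T]. *)
Lemma fredholm (T : X -> X) (z : C) (xi : X -> C) (k : X) :
  approximable nrm T -> z != 0 -> bounded_fun nrm xi ->
  (forall u, z *: u - T u + xi u *: k = 0 -> u = 0) ->
  exists2 M : K, 0 < M & forall chi, exists2 u,
    z *: u - T u + xi u *: k = chi & nrm u <= M * nrm chi.
Proof.
move=> Tapp z0 xiB inj.
have nz : 0 < normc z by rewrite normc_gt0.
have e0 : 0 < normc z / 2 by lra.
have [n [D [phi [f [linD DB phiB TE]]]]] := Tapp _ e0.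
pose phi' (j : 'I_n.+1) := if unlift ord0 j is Some i then phi i else xi.
pose f' (j : 'I_n.+1) := if unlift ord0 j is Some i then f i else - k.
have E u : z *: u - T u + xi u *: k =
    z *: u - D u - \sum_(j < n.+1) phi' j u *: f' j.
  rewrite big_ord_recl {1}/phi' {1}/f' unlift_none TE.
  have -> : \sum_(i < n) phi' (lift ord0 i) u *: f' (lift ord0 i) =
      \sum_(i < n) phi i u *: f i.
    by apply: eq_bigr => i _; rewrite /phi' /f' liftK.
  rewrite scalerN; move: (\sum_(j < n) _) => s; zmodule.
have phiB' j : bounded_fun nrm (phi' j) by rewrite /phi'; case: unlift.
have qz : normc z / 2 < normc z by lra.
have inj' u : z *: u - D u - \sum_(j < n.+1) phi' j u *: f' j = 0 -> u = 0.
  by rewrite -E; exact: inj.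
have [M M0 HM] := fredholm_finite linD (ltW e0) qz DB phiB' inj'.
exists M => // chi; have [u Eu Bu] := HM chi.
by exists u => //; rewrite E.
Qed.

Lemma fredholm_inverse (T : X -> X) (z : C) :
  lin_op T -> approximable nrm T -> z != 0 -> (forall u, T u = z *: u -> u = 0) ->
  exists2 M : K, 0 < M & (forall chi, exists u, z *: u - T u = chi) /\
    forall u, nrm u <= M * nrm (z *: u - T u).
Proof.
move=> linT Tapp z0 inj.
have zB : bounded_fun nrm (fun=> 0 : C).
  split=> [a u v|]; first by rewrite mulr0 addr0.
  by exists 0 => u; rewrite normc0 mul0r.
have inj' u : z *: u - T u + 0 *: (0 : X) = 0 -> u = 0.
  by rewrite scale0r addr0 => /eqP; rewrite subr_eq0 => /eqP /esym /inj.
have [M M0 HM] := fredholm Tapp z0 zB inj'; exists M => //; split=> [chi|u].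
  by have [u E _] := HM chi; exists u; move: E; rewrite scale0r addr0.
have [v E B] := HM (z *: u - T u); suff vu : v = u by rewrite -{1}vu.
have {}E : z *: v - T v = z *: u - T u by rewrite -E scale0r addr0.
apply/eqP; rewrite -subr_eq0; apply/eqP; apply: inj.
rewrite scalerBr (lin_opB linT) -[z *: v](subrK (T v)) E.
by rewrite addrAC [z *: u - _]addrC addrK addrC.
Qed.

End Fredholm.

(** * Perturbation of a simple eigenvalue *)

Lemma sum3_le1 (K : realType) (a b c d : K) : 0 <= a -> 0 <= b -> 0 <= c ->
  0 <= d -> (4 * a + 2 * b + 2 * c) * d <= 1 ->
  [/\ a * d <= 1 / 4, b * d <= 1 / 2 & c * d <= 1 / 2].
Proof.
move=> a0 b0 c0 d0 H.
have ad : 0 <= a * d by rewrite mulr_ge0.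
have bd : 0 <= b * d by rewrite mulr_ge0.
have cd : 0 <= c * d by rewrite mulr_ge0.
by split; lra.
Qed.

Section Perturbation.
Context {K : realType} {X : lmodType K[i]}.
Local Notation C := K[i].
Variables (nrm : X -> K) (T : X -> X) (nu : X -> C) (h : X) (lam : C).
Hypotheses (bX : banach_norm nrm) (linT : lin_op T) (lam_neq0 : lam != 0)
  (Th : T h = lam *: h) (nuB : bounded_fun nrm nu)
  (nuT : forall u, nu (T u) = lam * nu u).

Let linnu : lin_fun nu. Proof. by case: nuB. Qed.

(** The bordered operator [u |-> lam u - T u + xi(u) k] is invertible, so if
    [nu h] vanished then [h] would lie in the range of [T - lam]. *)
Lemma left_right_eigen_neq0 (xi : X -> C) (k : X) :
  approximable nrm T -> bounded_fun nrm xi -> xi h != 0 -> nu k != 0 ->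
  (forall u, T u = lam *: u -> exists c, u = c *: h) ->
  (forall u, T u <> lam *: u + h) -> nu h != 0.
Proof.
move=> Tapp xiB xih nuk S1 S2; apply/eqP => nuh.
have linxi : lin_fun xi by case: xiB.
have nuE u : nu (lam *: u - T u + xi u *: k) = xi u * nu k.
  rewrite (lin_funD linnu) (lin_funB linnu) !(lin_funZ linnu) nuT.
  by rewrite subrr add0r.
have inj u : lam *: u - T u + xi u *: k = 0 -> u = 0.
  move=> E; have := nuE u; rewrite E (lin_fun0 linnu) => /esym/eqP.
  rewrite mulf_eq0 (negPf nuk) orbF => /eqP xu.
  move: E; rewrite xu scale0r addr0 => /eqP; rewrite subr_eq0 => /eqP/esym/S1[c uc].
  move: xu; rewrite uc (lin_funZ linxi) => /eqP.
  by rewrite mulf_eq0 (negPf xih) orbF => /eqP ->; rewrite scale0r.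
have [M M0 HM] := fredholm bX Tapp lam_neq0 xiB inj.
have [u E _] := HM (- h).
have := nuE u; rewrite E -scaleN1r (lin_funZ linnu) nuh mulr0 => /esym/eqP.
rewrite mulf_eq0 (negPf nuk) orbF => /eqP xu.
apply: (S2 u); move: E; rewrite xu scale0r addr0 => /eqP.
by rewrite subr_eq addrC -subr_eq opprK => /eqP <-.
Qed.

(** [T - lam] is boundedly invertible on the complement [ker nu] of the
    eigenline. *)
Definition spectral_gap (M : K) := 0 < M /\
  (forall w, nu w = 0 -> exists y, [/\ nu y = 0, T y - lam *: y = w &
                                       nrm y <= M * nrm w]) /\
  forall y, nu y = 0 -> nrm y <= M * nrm (T y - lam *: y).

Hypothesis nuh : nu h = 1.

(** Adding [nu u *: h] makes [lam - T] injective, hence boundedly invertible,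
    and does not change it on [ker nu]. *)
Lemma spectral_gap_exists : approximable nrm T ->
  (forall u, T u = lam *: u -> exists c, u = c *: h) ->
  exists M, spectral_gap M.
Proof.
move=> Tapp S1.
have nuE u : nu (lam *: u - T u + nu u *: h) = nu u.
  rewrite (lin_funD linnu) (lin_funB linnu) !(lin_funZ linnu) nuT nuh.
  by rewrite subrr add0r mulr1.
have inj u : lam *: u - T u + nu u *: h = 0 -> u = 0.
  move=> E; have := nuE u; rewrite E (lin_fun0 linnu) => /esym nu0.
  move: E; rewrite nu0 scale0r addr0 => /eqP; rewrite subr_eq0 => /eqP/esym/S1[c uc].
  by move: nu0; rewrite uc (lin_funZ linnu) nuh mulr1 => ->; rewrite scale0r.
have [M M0 HM] := fredholm bX Tapp lam_neq0 nuB inj.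
exists M; split=> //; split=> [w nw|y ny].
  have [y E B] := HM (- w).
  have ny : nu y = 0.
    by rewrite -nuE E -scaleN1r (lin_funZ linnu) nw mulr0.
  exists y; split=> //; last by rewrite -[nrm w](nrmN bX).
  by move: E; rewrite ny scale0r addr0 => /eqP; rewrite -eqr_opp opprB opprK => /eqP.
have [v E B] := HM (lam *: y - T y); suff vy : v = y.
  by rewrite -{1}vy (nrm_distC bX).
have nv : nu v = 0.
  rewrite -nuE E (lin_funB linnu) (lin_funZ linnu) nuT ny; by rewrite mulr0 subrr.
have {}E : lam *: v - T v = lam *: y - T y by rewrite -E nv scale0r addr0.
apply/eqP; rewrite -subr_eq0; apply/eqP; apply: inj.
rewrite (lin_funB linnu) nv ny subrr scale0r addr0.
rewrite scalerBr (lin_opB linT) -[lam *: v](subrK (T v)) E; zmodule.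
Qed.

Variable M : K.
Hypothesis gap : spectral_gap M.

Let M0 : 0 < M. Proof. by case: gap. Qed.

(** With [E = T' - T], an eigenvector is sought as [h + v], [nu v = 0].  Applying
    [nu] shows that the eigenvalue is [lam + nu (E (h + v))], and what remains is
    [T v - lam v = nu (E (h + v)) (h + v) - E (h + v)], with a right-hand side in
    [ker nu]; inverting [T - lam] there makes it a fixed point equation for a
    contraction. *)
Lemma eigenvalue_near : exists (d0 C0 : K), [/\ 0 < d0, 0 < C0 &
  forall (T' : X -> X) (del : K), lin_op T' -> 0 <= del <= d0 ->
   (forall u, nrm (T' u - T u) <= del * nrm u) ->
   exists z u, [/\ u != 0, T' u = z *: u & normc (z - lam) <= C0 * del]].
Proof.
have [_ [gapS gapB]] := gap.
have [c c0 Hc] := bounded_fun_gt0 bX nuB.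
have nH0 := nrm_ge0 bX h.
pose H := nrm h + 1.
have H1 : 1 <= H by rewrite /H; lra.
pose k1 := M * H * (c * H + 1).
pose k2 := M * (2 * c * H + 1).
have cH : 0 < c * H by rewrite mulr_gt0 //; lra.
have k10 : 0 < k1 by rewrite !mulr_gt0 //; lra.
have k20 : 0 < k2 by rewrite mulr_gt0 //; lra.
pose d0 := (k1 + 2 * k2)^-1.
have d00 : 0 < d0 by rewrite invr_gt0; lra.
exists d0, (c * H); split=> // T' del linT' /andP[del0 deld] T'T.
have dk : del * (k1 + 2 * k2) <= 1.
  by rewrite -ler_pdivlMr ?mul1r //; lra.
have dk1 : del * k1 <= 1.
  have : 0 <= del * k2 by rewrite mulr_ge0 // ltW.
  by clearbody k1 k2; lra.
have dk2 : del * k2 <= 1 / 2.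
  have : 0 <= del * k1 by rewrite mulr_ge0 // ltW.
  by clearbody k1 k2; lra.
have [E EE] : exists E : X -> X, forall u, E u = T' u - T u by eexists.
have linE : lin_op E.
  by move=> a u v; rewrite !EE linT' linT scalerBr; zmodule.
have EB u : nrm (E u) <= del * nrm u by rewrite EE.
have exG w : exists y, nu w = 0 ->
    [/\ nu y = 0, T y - lam *: y = w & nrm y <= M * nrm w].
  case: (pselect (nu w = 0)) => [/gapS[y Hy]|nw]; first by exists y.
  by exists 0.
(* G inverts T - lam on the kernel of nu, and W is the right-hand side *)
have [G HG] := choice exG.
pose W v := nu (E (h + v)) *: (h + v) - E (h + v).
have W0 v : nu v = 0 -> nu (W v) = 0.
  move=> nv; rewrite /W (lin_funB linnu) (lin_funZ linnu) (lin_funD linnu h v).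
  by rewrite nuh nv addr0 mulr1 subrr.
have hvH v : nrm v <= 1 -> nrm (h + v) <= H.
  by move=> v1; apply: le_trans (nrmD bX _ _) _; rewrite /H; lra.
have EhB v : nrm v <= 1 -> nrm (E (h + v)) <= del * H.
  by move=> /hvH v1; apply: le_trans (EB _) _; rewrite ler_wpM2l.
have nuEB v : nrm v <= 1 -> normc (nu (E (h + v))) <= c * (del * H).
  move=> v1; apply: le_trans (Hc _) _; rewrite ler_wpM2l ?(ltW c0) //; exact: EhB.
have WB v : nrm v <= 1 -> M * nrm (W v) <= 1.
  move=> v1.
  have : nrm (W v) <= c * (del * H) * H + del * H.
    apply: le_trans (nrmB bX _ _) _; rewrite (nrmZ bX).
    apply: lerD; last exact: EhB.
    by apply: ler_pM; rewrite ?normc_ge0 ?(nrm_ge0 bX) //; [exact: nuEB|exact: hvH].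
  move=> h1; have : M * nrm (W v) <= M * (c * (del * H) * H + del * H).
    by rewrite ler_wpM2l // ltW.
  move: dk1; rewrite /k1 => *; lra.
have WL v v' : nrm v <= 1 -> nrm v' <= 1 ->
    M * nrm (W v - W v') <= 1 / 2 * nrm (v - v').
  move=> v1 v1'.
  have -> : W v - W v' = nu (E (v - v')) *: (h + v) +
      (nu (E (h + v')) *: (v - v') - E (v - v')).
    have -> : v - v' = (h + v) - (h + v') by rewrite opprD addrACA subrr add0r.
    rewrite /W (lin_opB linE) (lin_funB linnu) scalerBl [_ *: (_ - _)]scalerBr.
    zmodule.
  have D0 := nrm_ge0 bX (v - v').
  have t1 : nrm (nu (E (v - v')) *: (h + v)) <= c * (del * nrm (v - v')) * H.
    rewrite (nrmZ bX); apply: ler_pM; rewrite ?normc_ge0 ?(nrm_ge0 bX) ?hvH //.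
    by apply: le_trans (Hc _) _; rewrite ler_wpM2l ?(ltW c0).
  have t2 : nrm (nu (E (h + v')) *: (v - v')) <= c * (del * H) * nrm (v - v').
    by rewrite (nrmZ bX) ler_wpM2r // nuEB.
  have t3 := EB (v - v').
  have : nrm (nu (E (v - v')) *: (h + v) +
      (nu (E (h + v')) *: (v - v') - E (v - v'))) <=
      c * (del * nrm (v - v')) * H +
      (c * (del * H) * nrm (v - v') + del * nrm (v - v')).
    apply: le_trans (nrmD bX _ _) _; apply: lerD => //.
    by apply: le_trans (nrmB bX _ _) _; apply: lerD.
  move=> h1; apply: le_trans (ler_wpM2l (ltW M0) h1) _.
  have := ler_wpM2r D0 dk2; rewrite /k2; lra.
pose V := fix V n := if n is m.+1 then G (W (V m)) else 0.
have V0 n : nu (V n) = 0 /\ nrm (V n) <= 1.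
  elim: n => [|n [nV V1]]; first by rewrite /= (lin_fun0 linnu) (nrm0 bX).
  have [a _ b] := HG _ (W0 _ nV); split=> //=; apply: le_trans b _; exact: WB.
have GL v v' : nu v = 0 -> nu v' = 0 -> nrm v <= 1 -> nrm v' <= 1 ->
    nrm (G (W v) - G (W v')) <= 1 / 2 * nrm (v - v').
  move=> nv nv' v1 v1'.
  have [a1 b1 _] := HG _ (W0 _ nv); have [a2 b2 _] := HG _ (W0 _ nv').
  have n0 : nu (G (W v) - G (W v')) = 0 by rewrite (lin_funB linnu) a1 a2 subrr.
  apply: le_trans (gapB _ n0) _; apply: le_trans _ (WL v v' v1 v1').
  rewrite (lin_opB linT) scalerBr.
  have -> : T (G (W v)) - T (G (W v')) - (lam *: G (W v) - lam *: G (W v')) =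
     W v - W v'.
    by rewrite -[in RHS]b1 -[in RHS]b2; zmodule.
  by [].
have step n : nrm (V n.+1 - V n) <= 1 * (1 / 2) ^+ n.
  elim: n => [|n IH].
    by rewrite /= subr0 expr0 mulr1; have [_ /=] := V0 1%N.
  have [n0 b0] := V0 n; have [n1 b1] := V0 n.+1.
  apply: le_trans (GL (V n.+1) (V n) n1 n0 b1 b0) _.
  by rewrite exprS mul1r mul1r mul1r in IH *; lra.
have q01 : 0 <= (1 / 2 : K) < 1 by apply/andP; split; lra.
have [v Hv] := nrm_complete bX q01 step.
have {}Hv n : nrm (v - V n) <= 2 * (1 / 2) ^+ n.
  have := Hv n; have -> : 1 / (1 - 1 / 2) = 2 :> K by field.
  by [].
have nv : nu v = 0.
  apply/eqP; rewrite -normc_eq0 eq_le normc_ge0 andbT.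
  apply: (@le_geom_eq0 _ _ (c * 2) (1 / 2) q01) => n.
  have -> : nu v = nu (v - V n) by rewrite (lin_funB linnu) (V0 n).1 subr0.
  apply: le_trans (Hc _) _; rewrite -mulrA ler_wpM2l ?(ltW c0) //; exact: Hv.
have v1 : nrm v <= 1.
  rewrite -subr_le0; apply: (@le_geom_eq0 _ _ 2 (1 / 2) q01) => n.
  have := nrmD bX (v - V n) (V n); rewrite subrK.
  have := Hv n; have := (V0 n).2; lra.
have fixv : G (W v) = v.
  apply/eqP; rewrite -subr_eq0; apply/eqP.
  apply: (@nrm_geom_eq0 _ _ _ bX _ 2 (1 / 2) q01) => n.
  have [n0 b0] := V0 n.
  have -> : G (W v) - v = (G (W v) - V n.+1) - (v - V n.+1).
    by rewrite opprB addrA subrK.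
  apply: le_trans (nrmB bX _ _) _.
  have h1 : nrm (G (W v) - V n.+1) <= 1 / 2 * nrm (v - V n) by exact: GL.
  have h2 := Hv n; have h3 := Hv n.+1; rewrite exprS in h3.
  lra.
have [_ Tv _] := HG _ (W0 _ nv); rewrite fixv in Tv.
exists (lam + nu (E (h + v))), (h + v); split.
- apply/eqP => E0; have := congr1 nu E0.
  rewrite (lin_funD linnu) nuh nv addr0 (lin_fun0 linnu) => /eqP.
  by rewrite oner_eq0.
- have -> : T' (h + v) = T (h + v) + E (h + v) by rewrite EE; zmodule.
  rewrite (lin_opD linT) Th -[T v](subrK (lam *: v)) Tv scalerDl scalerDr /W.
  zmodule.
- by rewrite [lam + _]addrC addrK; have := nuEB v v1; lra.
Qed.

Variable c : K.
Hypotheses (c0 : 0 < c) (nu_le : forall u, normc (nu u) <= c * nrm u).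

Let H0 : 0 <= nrm h. Proof. exact: nrm_ge0. Qed.

Section Perturbed.
Variables (T' : X -> X) (del : K) (z : C).
Hypotheses (linT' : lin_op T') (del0 : 0 <= del)
  (T'T : forall u, nrm (T' u - T u) <= del * nrm u).

(** The component [v] of [h'] in [ker nu] satisfies
    [T v - lam v = (z - lam) h' - (T' - T) h']; by the gap it is small compared
    with [h'], and applying [nu] improves the bound for [z - lam] to [O(del)]. *)
Lemma right_eigenvector_near (h' : X) : M * del <= 1 / 4 ->
  M * normc (z - lam) <= 1 / 4 -> h' != 0 -> T' h' = z *: h' ->
  [/\ 0 < normc (nu h'), nrm h' <= 2 * (normc (nu h') * nrm h),
      normc (z - lam) <= 2 * c * nrm h * del &
      nrm (h' - nu h' *: h) <=
        M * (2 * c * nrm h + 1) * (2 * nrm h) * del * normc (nu h')].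
Proof.
move=> dM zM h'0 Eh'; have [_ [_ gapB]] := gap.
set a := nu h'; set v := h' - a *: h.
have nv : nu v = 0 by rewrite (lin_funB linnu) (lin_funZ linnu) nuh mulr1 subrr.
have Tv : T v - lam *: v = (z - lam) *: h' - (T' h' - T h').
  rewrite Eh' (lin_opB linT) (lin_opZ linT) Th scalerBl [lam *: v]scalerBr.
  rewrite !scalerA [lam * a]mulrC; zmodule.
have n0 := nrm_ge0 bX h'.
have vB : nrm v <= M * ((normc (z - lam) + del) * nrm h').
  apply: le_trans (gapB _ nv) _; rewrite ler_wpM2l ?(ltW M0) // Tv.
  by apply: le_trans (nrmB bX _ _) _; rewrite (nrmZ bX) mulrDl lerD2l.
have h'E : h' = a *: h + v by rewrite /v addrC subrK.
have h'B : nrm h' <= 2 * (normc a * nrm h).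
  have : nrm h' <= normc a * nrm h + nrm v.
    by rewrite {1}h'E; apply: le_trans (nrmD bX _ _) _; rewrite (nrmZ bX).
  have : (M * normc (z - lam) + M * del) * nrm h' <= 1 / 2 * nrm h'.
    by rewrite ler_wpM2r //; lra.
  move: vB; lra.
have na0 := normc_ge0 a.
have a0 : 0 < normc a.
  rewrite lt_def na0 andbT; apply/eqP => a0.
  move: h'B; rewrite a0 mul0r mulr0 => h1.
  have h'00 : h' = 0 by apply: (nrm_eq0 bX); apply/le_anti; rewrite h1 n0.
  by move: h'0; rewrite h'00 eqxx.
have zB : normc (z - lam) <= 2 * c * nrm h * del.
  have : (z - lam) * a = nu (T' h' - T h').
    have : nu (T v - lam *: v) = 0.
      by rewrite (lin_funB linnu) (lin_funZ linnu) nuT subrr.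
    by rewrite Tv (lin_funB linnu) (lin_funZ linnu) => /eqP; rewrite subr_eq0 => /eqP.
  move=> /(congr1 (@normc K)); rewrite normcM => Ez.
  have : normc (z - lam) * normc a <= c * (del * (2 * (normc a * nrm h))).
    rewrite Ez; apply: le_trans (nu_le _) _; rewrite ler_wpM2l ?(ltW c0) //.
    by apply: le_trans (T'T _) _; rewrite ler_wpM2l.
  have -> : c * (del * (2 * (normc a * nrm h))) = 2 * c * nrm h * del * normc a by ring.
  by rewrite ler_pM2r.
split=> //; apply: le_trans vB _.
have -> : M * (2 * c * nrm h + 1) * (2 * nrm h) * del * normc a =
  M * ((2 * c * nrm h * del + del) * (2 * (normc a * nrm h))) by ring.
rewrite ler_wpM2l ?(ltW M0) //; apply: ler_pM => //.
  by rewrite addr_ge0 ?normc_ge0.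
by rewrite lerD2r.
Qed.

(** An element of [ker nu] has the form [T y - lam y], and there [nu'] takes the
    value [(z - lam) nu' y - nu' ((T' - T) y)], which is small; so [nu'] is nearly
    a multiple of [nu]. *)
Lemma left_eigenvector_near (nu' : X -> C) (k : K) : 0 <= k ->
  normc (z - lam) <= k * del ->
  M * (k + 1) * (1 + c * nrm h) * del <= 1 / 2 ->
  bounded_fun nrm nu' -> (exists u, nu' u != 0) ->
  (forall u, nu' (T' u) = z * nu' u) ->
  0 < normc (nu' h) /\ forall u, normc (nu' u - nu u * nu' h) <=
    2 * c * (M * (k + 1) * (1 + c * nrm h)) * del * normc (nu' h) * nrm u.
Proof.
move=> k0 zB dC nu'B nu'n0 Enu'; have [_ [gapS _]] := gap.
have linnu' : lin_fun nu' by case: nu'B.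
have kerB (A : K) w : 0 <= A -> (forall u, normc (nu' u) <= A * nrm u) ->
    nu w = 0 -> normc (nu' w) <= A * (M * (k + 1) * del) * nrm w.
  move=> A0 nuA nw; have [y [ny Ty yB]] := gapS _ nw.
  have -> : nu' w = (z - lam) * nu' y - nu' (T' y - T y).
    rewrite -Ty !(lin_funB linnu') (lin_funZ linnu') Enu'; ring.
  apply: le_trans (normcB _ _) _; rewrite normcM.
  have y0 := nrm_ge0 bX y.
  have h1 : normc (z - lam) * normc (nu' y) <= k * del * (A * nrm y).
    by apply: ler_pM; rewrite ?normc_ge0.
  have h2 : normc (nu' (T' y - T y)) <= A * (del * nrm y).
    by apply: le_trans (nuA _) _; rewrite ler_wpM2l.
  have h3 : A * ((k + 1) * del) * nrm y <= A * ((k + 1) * del) * (M * nrm w).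
    by rewrite ler_wpM2l // mulr_ge0 // mulr_ge0 //; lra.
  lra.
have [C3 C3E] : exists x, x = M * (k + 1) * (1 + c * nrm h) by eexists.
rewrite -C3E in dC *.
have [b bE] : exists x, x = nu' h by eexists.
rewrite -bE.
have genB (A : K) u : 0 <= A -> (forall u, normc (nu' u) <= A * nrm u) ->
    normc (nu' u - nu u * b) <= A * (C3 * del) * nrm u.
  move=> A0 nuA; pose w := u - nu u *: h.
  have nw : nu w = 0 by rewrite (lin_funB linnu) (lin_funZ linnu) nuh mulr1 subrr.
  have -> : nu' u - nu u * b = nu' w.
    by rewrite bE (lin_funB linnu') (lin_funZ linnu').
  apply: le_trans (kerB A w A0 nuA nw) _.
  have wB : nrm w <= (1 + c * nrm h) * nrm u.
    apply: le_trans (nrmB bX _ _) _; rewrite (nrmZ bX) mulrDl mul1r lerD2l.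
    by rewrite mulrAC ler_wpM2r.
  have -> : A * (C3 * del) * nrm u =
      A * (M * (k + 1) * del) * ((1 + c * nrm h) * nrm u) by rewrite C3E; ring.
  rewrite ler_wpM2l // mulr_ge0 // mulr_ge0 // mulr_ge0 ?(ltW M0) //.
  exact: addr_ge0.
have [A1 A10 HA1] := bounded_fun_gt0 bX nu'B.
have b0 := normc_ge0 b.
have bc0 : 0 <= 2 * (normc b * c) by rewrite mulr_ge0 // mulr_ge0 // ltW.
(* any bound A for nu' improves to |b| c + A / 2 *)
have halving n u : normc (nu' u) <= (2 * (normc b * c) + A1 * (1 / 2) ^+ n) * nrm u.
  elim: n u => [|n IH] u.
    apply: le_trans (HA1 u) _; rewrite ler_wpM2r ?(nrm_ge0 bX) // expr0 mulr1.
    by rewrite lerDr.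
  have A0 : 0 <= 2 * (normc b * c) + A1 * (1 / 2) ^+ n.
    by apply: addr_ge0 => //; rewrite mulr_ge0 ?(ltW A10) // exprn_ge0.
  have := genB _ u A0 IH; set A := (_ + _) in A0 IH *.
  move=> h1; rewrite -[nu' u](subrK (nu u * b)).
  apply: le_trans (normcD _ _) _; rewrite normcM.
  have h2 : normc (nu u) * normc b <= c * nrm u * normc b.
    exact: ler_wpM2r b0 _ _ (nu_le u).
  have h3 : A * (C3 * del) * nrm u <= A * (1 / 2) * nrm u.
    by rewrite ler_wpM2r ?nrm_ge0 // ler_wpM2l.
  apply: le_trans (lerD (le_trans h1 h3) h2) _; rewrite /A exprS.
  by rewrite le_eqVlt; apply/orP; left; apply/eqP; field.
have nu'B' u : normc (nu' u) <= 2 * (normc b * c) * nrm u.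
  rewrite -subr_le0; apply: (@le_geom_eq0 _ _ (A1 * nrm u) (1 / 2)).
    by apply/andP; split; lra.
  move=> n; rewrite lerBlDr; apply: le_trans (halving n u) _.
  by rewrite mulrDl addrC mulrAC.
split=> [|u].
  rewrite lt_def b0 andbT; apply/eqP => b00.
  have [u /negP] := nu'n0; apply; rewrite -normc_eq0 eq_le normc_ge0 andbT.
  by have := nu'B' u; rewrite b00 mul0r mulr0 mul0r.
apply: le_trans (genB _ u bc0 nu'B') _.
by rewrite le_eqVlt; apply/orP; left; apply/eqP; ring.
Qed.

(** The quotient does not change when [h'] is divided by [nu h'] and [nu'] by
    [nu' h], after which both are close to [h] and [nu]. *)
Lemma quotient_near (h' : X) (nu' : X -> C) (C1 C4 : K) :
  lin_fun nu' -> 0 <= C1 -> 0 <= C4 ->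
  0 < normc (nu h') -> nrm h' <= 2 * (normc (nu h') * nrm h) ->
  nrm (h' - nu h' *: h) <= C1 * del * normc (nu h') ->
  0 < normc (nu' h) ->
  (forall u, normc (nu' u - nu u * nu' h) <= C4 * del * normc (nu' h) * nrm u) ->
  let C5 := C4 * (2 * nrm h) + c * C1 in C5 * del <= 1 / 2 ->
  forall (m : X -> X) (b : K), lin_op m -> 0 <= b ->
     (forall u, nrm (m u) <= b * nrm u) ->
   normc (nu (m h) - nu' (m h') / nu' h') <= 2 * C5 * (1 + c * nrm h) * del * b.
Proof.
move=> linnu' C10 C40; set a := nu h'; set v := h' - a *: h; set d := nu' h.
move=> a0 h'B vB d0 nu'C4 /=; set C5 := (_ + _) => dC5 m b linm b0 mB.
have C50 : 0 <= C5.
  apply: addr_ge0; last exact: mulr_ge0 (ltW c0) C10.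
  by apply: mulr_ge0 => //; exact: mulr_ge0.
have h'E : h' = a *: h + v by rewrite /v addrC subrK.
have an0 : a != 0 by rewrite -normc_gt0.
have dn0 : d != 0 by rewrite -normc_gt0.
have quot (m' : X -> X) (b' : K) : lin_op m' -> 0 <= b' ->
    (forall u, nrm (m' u) <= b' * nrm u) ->
    normc (nu' (m' h') / (a * d) - nu (m' h)) <= C5 * del * b'.
  move=> linm' b'0 m'B.
  have -> : nu' (m' h') / (a * d) - nu (m' h) =
      ((nu' (m' h') - nu (m' h') * d) + nu (m' v) * d) / (a * d).
    have -> : nu (m' h') = a * nu (m' h) + nu (m' v).
      rewrite {1}h'E (lin_opD linm') (lin_opZ linm') (lin_funD linnu).
      by rewrite (lin_funZ linnu).
    by field; rewrite an0 dn0.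
  rewrite normcM normcV normcM ler_pdivrMr ?mulr_gt0 //.
  apply: le_trans (normcD _ _) _; rewrite normcM.
  have h1 : normc (nu' (m' h') - nu (m' h') * d) <=
      C4 * del * normc d * (b' * (2 * (normc a * nrm h))).
    apply: le_trans (nu'C4 _) _; rewrite ler_wpM2l //.
      by rewrite !mulr_ge0 ?normc_ge0.
    by apply: le_trans (m'B _) _; rewrite ler_wpM2l.
  have h2 : normc (nu (m' v)) * normc d <= c * (b' * (C1 * del * normc a)) * normc d.
    rewrite ler_wpM2r ?normc_ge0 //.
    apply: le_trans (nu_le _) _; rewrite ler_wpM2l ?(ltW c0) //.
    by apply: le_trans (m'B _) _; rewrite ler_wpM2l.
  apply: le_trans (lerD h1 h2) _; rewrite /C5.
  by rewrite le_eqVlt; apply/orP; left; apply/eqP; ring.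
have id_lin : lin_op (fun u : X => u) by [].
have id_b (u : X) : nrm u <= 1 * nrm u by rewrite mul1r.
have qd := quot _ 1 id_lin ler01 id_b; rewrite nuh mulr1 in qd.
have qn := quot m b linm b0 mB.
move: qd qn; set D := nu' h' / (a * d); set Nn := nu' (m h') / (a * d) => qd qn.
have D2 : 1 / 2 <= normc D.
  have := normcD (1 - D) D; rewrite subrK normc1 [normc (1 - D)]normc_distC.
  by have := le_trans qd dC5; lra.
have Dp : 0 < normc D by apply: lt_le_trans D2.
have Dn0 : D != 0 by rewrite -normc_gt0.
have nu'h' : nu' h' != 0 by apply: contra_neq Dn0 => E0; rewrite /D E0 mul0r.
have -> : nu (m h) - nu' (m h') / nu' h' = (nu (m h) * (D - 1) - (Nn - nu (m h))) / D.
  by rewrite /Nn /D; field; rewrite nu'h' an0 dn0.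
rewrite normcM normcV ler_pdivrMr //.
apply: le_trans (normcB _ _) _; rewrite normcM.
have h1 : normc (nu (m h)) <= c * (b * nrm h).
  by apply: le_trans (nu_le _) _; rewrite ler_wpM2l ?(ltW c0).
have h2 : normc (nu (m h)) * normc (D - 1) <= c * (b * nrm h) * (C5 * del).
  by apply: ler_pM; rewrite ?normc_ge0.
apply: le_trans (lerD h2 qn) _.
apply: le_trans (_ : 2 * C5 * (1 + c * nrm h) * del * b * (1 / 2) <= _).
  by rewrite le_eqVlt; apply/orP; left; apply/eqP; field.
rewrite ler_wpM2l // !mulr_ge0 // addr_ge0 // mulr_ge0 //; exact: ltW.
Qed.

End Perturbed.

(** Eigenvectors of a perturbation [T'] are, up to factors and to an error
    proportional to the size of the perturbation, those of [T]; so are the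
    quotients that define the equilibrium measures. *)
Lemma eigen_quotient_near : exists (d1 e1 K1 : K), [/\ 0 < d1, 0 < e1 &
  forall (T' : X -> X) (del : K) (z : C) (h' : X) (nu' : X -> C),
   lin_op T' -> 0 <= del <= d1 ->
   (forall u, nrm (T' u - T u) <= del * nrm u) -> normc (z - lam) <= e1 ->
   h' != 0 -> T' h' = z *: h' ->
   bounded_fun nrm nu' -> (exists u, nu' u != 0) ->
   (forall u, nu' (T' u) = z * nu' u) ->
   forall (m : X -> X) (b : K), lin_op m -> 0 <= b ->
     (forall u, nrm (m u) <= b * nrm u) ->
   normc (nu (m h) - nu' (m h') / nu' h') <= K1 * del * b].
Proof.
pose kz := 2 * c * nrm h.
pose C1 := M * (kz + 1) * (2 * nrm h).
pose C3 := M * (kz + 1) * (1 + c * nrm h).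
pose C4 := 2 * c * C3.
pose C5 := C4 * (2 * nrm h) + c * C1.
have cH0 : 0 <= c * nrm h by rewrite mulr_ge0 // ltW.
have kz0 : 0 <= kz by rewrite /kz -mulrA mulr_ge0.
have M0' := ltW M0; have c0' := ltW c0.
have C10 : 0 <= C1 by apply: mulr_ge0; apply: mulr_ge0 => //; exact: addr_ge0.
have C30 : 0 <= C3.
  by apply: mulr_ge0; [apply: mulr_ge0 => //|]; exact: addr_ge0.
have C40 : 0 <= C4 by apply: mulr_ge0 => //; exact: mulr_ge0.
have C50 : 0 <= C5.
  apply: addr_ge0; last exact: mulr_ge0.
  by apply: mulr_ge0 => //; exact: mulr_ge0.
pose S := 4 * M + 2 * C3 + 2 * C5.
have S0 : 0 < S.
  by rewrite /S -addrA ltr_pwDl ?mulr_gt0 // addr_ge0 // mulr_ge0.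
exists S^-1, (4 * M)^-1, (2 * C5 * (1 + c * nrm h)).
split; [by rewrite invr_gt0 | by rewrite invr_gt0 mulr_gt0 |].
move=> T' del z h' nu' linT' /andP[del0 deld] T'T zlam h'0 Eh' nu'B nu'n0 Enu'.
have dS : S * del <= 1 by rewrite -ler_pdivlMl // mulr1.
have [dM dC3 dC5] := sum3_le1 M0' C30 C50 del0 dS.
have zM : M * normc (z - lam) <= 1 / 4.
  rewrite -ler_pdivlMl //; apply: le_trans zlam _.
  by rewrite le_eqVlt; apply/orP; left; apply/eqP; field; rewrite gt_eqF.
have [a0 h'B zB vB] := right_eigenvector_near del0 T'T dM zM h'0 Eh'.
have [d0 nu'C4] := left_eigenvector_near del0 T'T kz0 zB dC3 nu'B nu'n0 Enu'.
have linnu' : lin_fun nu' by case: nu'B.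
move=> m b linm b0 mB.
exact: (quotient_near del0 linnu' C10 C40 a0 h'B vB d0 nu'C4 dC5 linm b0 mB).
Qed.

End Perturbation.

Section LeadingEigenvalue.
Context {K : realType} {X : lmodType K[i]}.
Variables (nrm : X -> K) (T : X -> X) (lam tau : K) (Tn : nat -> X -> X)
  (del : nat -> K).
Hypotheses (bX : banach_norm nrm)
  (TB : forall u, nrm (T u) <= tau * nrm u)
  (TnT : forall n u, nrm (Tn n u - T u) <= del n * nrm u)
  (del_lim : forall e : K, 0 < e -> exists N, forall n, (N <= n)%N -> del n <= e).

(** A limit of eigenvalues of the approximating operators cannot lie in the
    resolvent set, hence must be [lam]. *)
Lemma real_eigenvalue_limit (C0 : K) : 0 <= C0 ->
  (forall z : K, lam <= `|z| -> z != lam -> exists2 M : K, 0 < M &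
     forall u, nrm u <= M * nrm (toC z *: u - T u)) ->
  forall e : K, 0 < e -> exists N, forall n, (N <= n)%N ->
    forall (z : K) u, u != 0 -> Tn n u = toC z *: u -> lam - C0 * del n <= `|z| ->
    `|z - lam| <= e.
Proof.
move=> C00 res e e0; apply: contrapT => no.
have [N1 HN1] := del_lim ltr01.
have bad k : exists nzu : (nat * K * X)%type, let: (n, z, u) := nzu in
    [/\ (k <= n)%N, u != 0 & Tn n u = toC z *: u] /\
    [/\ lam - C0 * del n <= `|z|, e < `|z - lam| & (N1 <= n)%N].
  apply: contrapT => nobad; apply: no; exists (maxn k N1) => n.
  rewrite geq_max => /andP[kn N1n] z u u0 Tu lz.
  rewrite leNgt; apply/negP => ez; apply: nobad; exists (n, z, u); split=> //.
have [s Hs] := choice bad.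
pose n_ k := (s k).1.1; pose z_ k := (s k).1.2; pose u_ k := (s k).2.
have {}Hs k : [/\ (k <= n_ k)%N, u_ k != 0 & Tn (n_ k) (u_ k) = toC (z_ k) *: u_ k] /\
    [/\ lam - C0 * del (n_ k) <= `|z_ k|, e < `|z_ k - lam| & (N1 <= n_ k)%N].
  by have := Hs k; rewrite /n_ /z_ /u_; case: (s k) => [[]].
have up k : 0 < nrm (u_ k) by apply: nrm_gt0 => //; case: (Hs k) => -[].
have zB k : `|z_ k| <= tau + 1.
  have [[_ _ Tu] [_ _ N1n]] := Hs k.
  rewrite -(ler_pM2r (up k)) -normc_real -(nrmZ bX) -Tu.
  have -> : Tn (n_ k) (u_ k) = T (u_ k) + (Tn (n_ k) (u_ k) - T (u_ k)) by zmodule.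
  apply: le_trans (nrmD bX _ _) _; rewrite mulrDl; apply: lerD; first exact: TB.
  by apply: le_trans (TnT _ _) _; rewrite ler_wpM2r ?(ltW (up k)) //; exact: HN1.
pose zs := rulim z_.
have near d : 0 < d -> exists k, `|z_ k - zs| <= d /\ del (n_ k) <= d.
  move=> d0; have [N HN] := del_lim d0.
  have [k /= [h1 h2]] := filter_ex (filterI (rulimP zB d0) (ultra_nat_ge N)).
  exists k; split=> //; apply: HN; apply: leq_trans h2 _.
  by case: (Hs k) => -[].
have zl : lam <= `|zs|.
  apply/ler_addgt0Pr => d d0.
  have d'0 : 0 < d / (C0 + 1) by rewrite divr_gt0 //; lra.
  have [k [h1 h2]] := near _ d'0.
  have [_ [h3 _ _]] := Hs k.
  have h4 : C0 * del (n_ k) <= C0 * (d / (C0 + 1)) by rewrite ler_wpM2l.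
  have h5 : (C0 + 1) * (d / (C0 + 1)) = d by rewrite mulrCA divff ?mulr1 // gt_eqF //; lra.
  have : `|z_ k| <= `|zs| + `|z_ k - zs| by have := ler_normD zs (z_ k - zs); rewrite addrC subrK.
  lra.
have zn : zs != lam.
  apply/eqP => E; have [k [h1 _]] := near _ e0.
  by have [_ [_ h2 _]] := Hs k; move: h1; rewrite E; lra.
have [M M0 HM] := res _ zl zn.
have d0 : 0 < (4 * M)^-1 by rewrite invr_gt0 mulr_gt0.
have [k [h1 h2]] := near _ d0.
have [[_ _ Tu] _] := Hs k.
have := HM (u_ k).
have -> : toC zs *: u_ k - T (u_ k) =
    toC (zs - z_ k) *: u_ k + (Tn (n_ k) (u_ k) - T (u_ k)).
  by rewrite Tu rmorphB scalerBl; zmodule.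
have h3 : nrm (toC (zs - z_ k) *: u_ k + (Tn (n_ k) (u_ k) - T (u_ k))) <=
    (4 * M)^-1 * nrm (u_ k) + (4 * M)^-1 * nrm (u_ k).
  apply: le_trans (nrmD bX _ _) _; apply: lerD.
    by rewrite (nrmZ bX) normc_real distrC ler_wpM2r ?(ltW (up k)).
  by apply: le_trans (TnT _ _) _; rewrite ler_wpM2r ?(ltW (up k)).
move=> h4; have := le_trans h4 (ler_wpM2l (ltW M0) h3).
have -> : M * ((4 * M)^-1 * nrm (u_ k) + (4 * M)^-1 * nrm (u_ k)) = nrm (u_ k) / 2.
  by field; rewrite gt_eqF.
by have := up k; lra.
Qed.

End LeadingEigenvalue.

(** * Unordered sums *)

Section UnorderedSum.
Context {K : realType} {I : choiceType}.
Local Notation C := K[i].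
Local Notation Re := (@complex.Re K).
Local Notation Im := (@complex.Im K).
Implicit Types (a : I -> C) (A B : {fset I}).

Lemma fsum_split (V : zmodType) (F : I -> V) A A0 : (A0 `<=` A)%fset ->
  \sum_(i <- A) F i = \sum_(i <- A0) F i + \sum_(i <- (A `\` A0)%fset) F i.
Proof.
move=> A0A; rewrite (big_fsetID _ (mem A0)) /=; congr (_ + _).
  congr (\sum_(i <- enum_fset _) F i); apply/fsetP => i; rewrite !inE /=.
  by case: (boolP (i \in A0)) => [/(fsubsetP A0A) ->|]; rewrite ?andbF ?andbT.
congr (\sum_(i <- enum_fset _) F i); apply/fsetP => i; rewrite !inE /=.
by rewrite andbC.
Qed.

Lemma partial_sumE (V : zmodType) (x : I -> V) A :
  summability.partial_sum x A = \sum_(i <- A) x i.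
Proof. by rewrite /summability.partial_sum big_seq_fsetE. Qed.

(** The terms in each of four half-planes add up without cancellation in their
    real or imaginary parts. *)
Lemma abs_sum_le a B (c : K) :
  (forall B', (B' `<=` B)%fset -> normc (\sum_(i <- B') a i) <= c) ->
  \sum_(i <- B) normc (a i) <= 4 * c.
Proof.
move=> Hc.
have half (f : C -> K) : {morph f : x y / x + y} -> f 0 = 0 ->
    (forall x, `|f x| <= normc x) -> \sum_(i <- B) `|f (a i)| <= 2 * c.
  move=> fD f0 fle.
  have fsum B' : f (\sum_(i <- B') a i) = \sum_(i <- B') f (a i).
    exact: (big_morph f fD f0).
  rewrite (big_fsetID _ (fun i => 0 <= f (a i))) /=.
  have h1 : \sum_(i <- [fset x in B | 0 <= f (a x)]%fset) `|f (a i)| <= c.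
    have -> : \sum_(i <- [fset x in B | 0 <= f (a x)]%fset) `|f (a i)| =
        f (\sum_(i <- [fset x in B | 0 <= f (a x)]%fset) a i).
      rewrite fsum big_seq [RHS]big_seq; apply: eq_bigr => i.
      by rewrite !inE /= => /andP[_ /ger0_norm].
    apply: le_trans (ler_norm _) _; apply: le_trans (fle _) _; apply: Hc.
    by apply/fsubsetP => i; rewrite !inE /= => /andP[].
  have h2 : \sum_(i <- [fset x in B | ~~ (0 <= f (a x))]%fset) `|f (a i)| <= c.
    have -> : \sum_(i <- [fset x in B | ~~ (0 <= f (a x))]%fset) `|f (a i)| =
        - f (\sum_(i <- [fset x in B | ~~ (0 <= f (a x))]%fset) a i).
      rewrite fsum -sumrN big_seq [RHS]big_seq; apply: eq_bigr => i.
      by rewrite !inE /= -ltNge => /andP[_ /ltr0_norm].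
    apply: le_trans (ler_norm _) _; rewrite normrN; apply: le_trans (fle _) _.
    by apply: Hc; apply/fsubsetP => i; rewrite !inE /= => /andP[].
  lra.
have hR := half Re (@ReD K) erefl (@Re_normc K).
have hI := half Im (@ImD K) erefl (@Im_normc K).
apply: le_trans (_ : \sum_(i <- B) (`|Re (a i)| + `|Im (a i)|) <= _).
  by apply: ler_sum => i _; exact: normc_ReIm.
rewrite big_split /=; lra.
Qed.

Definition abs_summable a := exists W : K, forall A,
  \sum_(i <- A) normc (a i) <= W.

Lemma ler_fsum (F : I -> K) A B : (forall i, 0 <= F i) -> (A `<=` B)%fset ->
  \sum_(i <- A) F i <= \sum_(i <- B) F i.
Proof.
by move=> F0 AB; rewrite (fsum_split F AB) lerDl; apply: sumr_ge0.
Qed.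

Lemma abs_summable_tail a (e : K) : abs_summable a -> 0 < e ->
  exists A0, forall B, [disjoint A0 & B]%fset -> \sum_(i <- B) normc (a i) <= e.
Proof.
move=> [W HW] e0.
pose E := [set s : K | exists A, s = \sum_(i <- A) normc (a i)].
have Esup : has_sup E.
  split; first by exists 0, fset0; rewrite big_seq_fset0.
  by exists W => _ [A ->].
have [_ [A0 ->] hA0] := sup_adherent e0 Esup.
exists A0 => B dAB.
have : E (\sum_(i <- (A0 `|` B)%fset) normc (a i)) by exists (A0 `|` B)%fset.
move=> /(ub_le_sup Esup.2); rewrite (fsum_split _ (fsubsetUl A0 B)).
have -> : ((A0 `|` B) `\` A0)%fset = B.
  rewrite fsetDUl fsetDv fset0U; apply/fsetDidPl.
  by rewrite fdisjoint_sym.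
lra.
Qed.

Lemma fsum_near a A0 A1 (e : K) :
  (forall B, [disjoint A0 & B]%fset -> \sum_(i <- B) normc (a i) <= e) ->
  (A0 `<=` A1)%fset ->
  normc (\sum_(i <- A1) a i - \sum_(i <- A0) a i) <= e.
Proof.
move=> HA A01; rewrite (fsum_split a A01) addrC addKr.
apply: le_trans (normc_sum _ _ _) _; apply: HA.
by rewrite fdisjoint_sym; apply/fdisjointP => i; rewrite inE => /andP[].
Qed.

(** The sums over finite sets outside which all sums of absolute values are at
    most [1 / (n + 1)] form a Cauchy sequence, whose limit is that of the net. *)
Lemma abs_summable_cvg a : abs_summable a -> forall e : K, 0 < e ->
  exists A0, forall A, (A0 `<=` A)%fset ->
    normc (\sum_(i <- A) a i - summability.sum (a : I -> C^o)) <= e.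
Proof.
move=> aS.
have [L HL] : exists L, forall e : K, 0 < e -> exists A0, forall A,
    (A0 `<=` A)%fset -> normc (\sum_(i <- A) a i - L) <= e.
  have ipos (n : nat) : 0 < (n.+1%:R : K)^-1 by rewrite invr_gt0 ltr0n.
  have ex (n : nat) := abs_summable_tail aS (ipos n).
  have [An HAn] := choice ex.
  pose u n := \sum_(i <- An n) a i.
  have near n A : (An n `<=` A)%fset ->
      normc (\sum_(i <- A) a i - u n) <= n.+1%:R^-1.
    by move=> /(fsum_near (HAn n)).
  have close n m : normc (u n - u m) <= n.+1%:R^-1 + m.+1%:R^-1.
    have -> : u n - u m = (\sum_(i <- (An n `|` An m)%fset) a i - u m) -
        (\sum_(i <- (An n `|` An m)%fset) a i - u n) by ring.
    apply: le_trans (normcB _ _) _; rewrite addrC; apply: lerD; apply: near.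
      exact: fsubsetUl.
    exact: fsubsetUr.
  have i1 n : (n.+1%:R : K)^-1 <= 1 by rewrite invf_le1 // ler1n.
  have uB n : normc (u n) <= normc (u 0%N) + 2.
    have -> : u n = u 0%N + (u n - u 0%N) by ring.
    apply: le_trans (normcD _ _) _; rewrite lerD2l.
    apply: le_trans (close _ _) _; rewrite (_ : 2 = 1 + 1 :> K) //.
    exact: lerD.
  exists (ulim u) => e e0.
  have e40 : 0 < e / 4 by lra.
  pose N := Num.truncn (e / 4)^-1.
  have HN m : (N <= m)%N -> m.+1%:R^-1 <= e / 4.
    move=> Nm; rewrite -[leRHS]invrK lef_pV2 ?posrE ?invr_gt0 //.
    apply: ltW; apply: lt_le_trans (truncnS_gt _) _; by rewrite ler_nat ltnS.
  exists (An N) => A AN.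
  have [m /= [h1 h2]] := filter_ex (filterI (ulimP uB e40) (ultra_nat_ge N)).
  have -> : \sum_(i <- A) a i - ulim u =
    (\sum_(i <- A) a i - u N) + (u N - u m) + (u m - ulim u) by ring.
  apply: le_trans (normcD _ _) _; apply: le_trans (lerD (normcD _ _) (lexx _)) _.
  have hN := HN N (leqnn N); have hm := HN m h2.
  have a1 := le_trans (near N A AN) hN.
  have a2 := le_trans (close N m) (lerD hN hm).
  by apply: le_trans (lerD (lerD a1 a2) h1) _; lra.
suff -> : summability.sum (a : I -> C^o) = L by [].
suff cv : summability.partial_sum (a : I -> C^o) @ @summability.totally I --> (L : C^o).
  apply: (@cvg_lim C^o (@norm_hausdorff _ _) _ _ _ _ _ cv).
  exact: summability.totally_filter.
have FF := @summability.totally_filter I.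
apply/(@cvgrPdist_le _ C^o) => -[e e'] /=; rewrite ltcE => /andP[/eqP /= -> e0].
have [A0 HA0] := HL e e0; exists A0 => // A /= A0A.
by rewrite normcE lecR partial_sumE normc_distC; exact: HA0.
Qed.

Lemma sum_le a (W : K) : (forall A, \sum_(i <- A) normc (a i) <= W) ->
  normc (summability.sum (a : I -> C^o)) <= W.
Proof.
move=> HW; have aS : abs_summable a by exists W.
apply/ler_addgt0Pr => e e0; have [A0 HA0] := abs_summable_cvg aS e0.
have h1 := HA0 A0 (fsubset_refl _).
rewrite -[X in normc X](subrK (\sum_(i <- A0) a i)).
apply: le_trans (normcD _ _) _; rewrite addrC; apply: lerD.
  exact: le_trans (normc_sum _ _ _) (HW A0).
by rewrite normc_distC.
Qed.

Lemma sum_near a A0 (e : K) : abs_summable a ->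
  (forall B, [disjoint A0 & B]%fset -> \sum_(i <- B) normc (a i) <= e) ->
  normc (summability.sum (a : I -> C^o) - \sum_(i <- A0) a i) <= e.
Proof.
move=> aS HA; apply/ler_addgt0Pr => d d0; have [A1 HA1] := abs_summable_cvg aS d0.
have h1 := HA1 (A0 `|` A1)%fset (fsubsetUr _ _).
have h2 := fsum_near HA (fsubsetUl A0 A1).
have -> : summability.sum (a : I -> C^o) - \sum_(i <- A0) a i =
   (\sum_(i <- (A0 `|` A1)%fset) a i - \sum_(i <- A0) a i) -
   (\sum_(i <- (A0 `|` A1)%fset) a i - summability.sum (a : I -> C^o)) by ring.
by apply: le_trans (normcB _ _) _; exact: lerD.
Qed.

Lemma sum_linear a b (c : C) : abs_summable a -> abs_summable b ->
  summability.sum ((fun i => c * a i + b i) : I -> C^o) =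
  c * summability.sum (a : I -> C^o) + summability.sum (b : I -> C^o).
Proof.
move=> aS bS.
have abS : abs_summable (fun i => c * a i + b i).
  case: aS => W HW; case: bS => W' HW'; exists (normc c * W + W') => A.
  apply: le_trans (_ : \sum_(i <- A) (normc c * normc (a i) + normc (b i)) <= _).
    apply: ler_sum => i _; apply: le_trans (normcD _ _) _; by rewrite normcM.
  by rewrite big_split /= -mulr_sumr lerD // ler_wpM2l ?normc_ge0.
apply/eqP; rewrite -subr_eq0 -normc_eq0 eq_le normc_ge0 andbT.
apply/ler_addgt0Pr => e e0; rewrite add0r.
have c0 := normc_ge0 c.
have d0 : 0 < e / (normc c + 2) by rewrite divr_gt0 //; lra.
have [A1 H1] := abs_summable_cvg aS d0; have [A2 H2] := abs_summable_cvg bS d0.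
have [A3 H3] := abs_summable_cvg abS d0.
pose A := (A1 `|` A2 `|` A3)%fset.
have {}H1 := H1 A (fsubset_trans (fsubsetUl _ _) (fsubsetUl _ _)).
have {}H2 := H2 A (fsubset_trans (fsubsetUr _ _) (fsubsetUl _ _)).
have {}H3 := H3 A (fsubsetUr _ _).
move: H1 H2 H3; rewrite big_split /= -mulr_sumr.
set sa := \sum_(i <- A) a i; set sb := \sum_(i <- A) b i.
set x := summability.sum _; set y := summability.sum _; set z := summability.sum _.
move=> H1 H2 H3.
have -> : z - (c * x + y) = c * (sa - x) + (sb - y) - (c * sa + sb - z) by ring.
apply: le_trans (normcB _ _) _; apply: le_trans (lerD (normcD _ _) (lexx _)) _.
rewrite normcM.
have : normc c * normc (sa - x) <= normc c * (e / (normc c + 2)) by rewrite ler_wpM2l.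
have : (normc c + 2) * (e / (normc c + 2)) = e by rewrite mulrCA divff ?mulr1 // gt_eqF //; lra.
lra.
Qed.

Lemma Re_sum_ge a (i0 : I) : abs_summable a -> (forall i, 0 <= Re (a i)) ->
  Re (a i0) <= Re (summability.sum (a : I -> C^o)).
Proof.
move=> aS a0; apply/ler_addgt0Pr => e e0; have [A0 HA0] := abs_summable_cvg aS e0.
have h1 := HA0 (i0 |` A0)%fset (fsubsetUr _ _).
have := le_trans (Re_normc _) h1; rewrite ReB ler_norml => /andP[_ h2].
have : Re (a i0) <= Re (\sum_(i <- (i0 |` A0)%fset) a i).
  rewrite Re_sum -[leLHS]addr0.
  have sub : ([fset i0] `<=` i0 |` A0)%fset by exact: fsubsetUl.
  rewrite (fsum_split (fun i => Re (a i)) sub) big_seq_fset1 lerD2l.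
  by apply: sumr_ge0.
lra.
Qed.

Lemma Im_sum_eq0 a : abs_summable a -> (forall i, Im (a i) = 0) ->
  Im (summability.sum (a : I -> C^o)) = 0.
Proof.
move=> aS a0; apply/eqP; rewrite -normr_le0; apply/ler_addgt0Pr => e e0.
rewrite add0r; have [A0 HA0] := abs_summable_cvg aS e0.
apply: le_trans (HA0 A0 (fsubset_refl _)); rewrite normc_distC.
apply: le_trans (Im_normc _); rewrite ImB Im_sum (eq_bigr (fun=> 0)) // big1_eq.
by rewrite subr0.
Qed.

End UnorderedSum.

(** * The transfer operator *)

Section Hnorm.
Context {K : realType}.
Local Notation C := K[i].
Implicit Types (f : C -> C) (R M : K).

Lemma ellipse0 R : 0 < R -> ellipse R (0 : C).
Proof. by move=> R0; apply: (@ellipse_real K R 0) => //; lra. Qed.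

Lemma Hnorm_ge f R M z : (forall z, ellipse R z -> normc (f z) <= M) ->
  ellipse R z -> normc (f z) <= Hnorm R f.
Proof.
move=> fM Ez; apply: ub_le_sup; last by exists z.
by exists M => _ [y Ey <-]; exact: fM.
Qed.

Lemma Hnorm_le f R M : 0 < R -> (forall z, ellipse R z -> normc (f z) <= M) ->
  Hnorm R f <= M.
Proof.
move=> R0 fM; apply: ge_sup; first by exists (normc (f 0)), 0; first exact: ellipse0.
by move=> _ [y Ey <-]; exact: fM.
Qed.

Lemma inH_hol R f : 0 < R -> inH R f <->
  (forall z, ellipse R z -> hol f z) /\
  exists M, forall z, ellipse R z -> normc (f z) <= M.
Proof.
move=> R0; split=> -[fa fb]; split=> //; first exact: analytic_hol.
by apply: hol_analytic => //; exact: ellipse_open.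
Qed.

Lemma inH_bound R f z : inH R f -> ellipse R z -> normc (f z) <= Hnorm R f.
Proof. by case=> _ [M fM]; exact: Hnorm_ge fM. Qed.

Lemma inH_sub r R f : 0 < r -> r < R -> inH R f -> inH r f.
Proof.
move=> r0 rR [fa [M fM]]; split=> [z Ez|].
  by apply: fa; apply: ellipse_sub Ez.
by exists M => z Ez; apply: fM; apply: ellipse_sub Ez.
Qed.

End Hnorm.

Section Transfer.
Context {K : realType} {I : choiceType}.
Local Notation C := K[i].
Variables (g w : I -> C -> C) (r R : K) (S : C -> C).
Hypotheses (r_gt0 : 0 < r) (rR : r < R)
  (g_analytic : forall i, analytic_on (ellipse R) (g i))
  (weights_sum : H_has_sum R (fun i z => expC (w i z)) S)
  (branch_image : forall i z, ellipse R z -> ellipse r (g i z)).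

Let R_gt0 : 0 < R. Proof. exact: lt_trans rR. Qed.

Let weight_inH i : inH R (fun z => expC (w i z)).
Proof. by case: weights_sum. Qed.

(** By [abs_sum_le], convergence in norm of the finite partial sums is uniform
    absolute convergence. *)
Lemma weights_tail (e : K) : 0 < e -> exists A0 : {fset I},
  forall z (B : {fset I}), ellipse R z -> [disjoint A0 & B]%fset ->
    \sum_(i <- B) normc (expC (w i z)) <= e.
Proof.
move=> e0; have e8 : 0 < e / 8 by lra.
have [_ SH HS] := weights_sum; have [A0 HA0] := HS _ e8.
exists A0 => z B Ez dAB.
have near A : (A0 `<=` A)%fset ->
    normc (\sum_(i <- A) expC (w i z) - S z) <= e / 8.
  move=> A0A; apply: le_trans (HA0 A A0A).
  have -> : \sum_(i <- A) expC (w i z) - S z =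
     summability.partial_sum ((fun i z => expC (w i z))^~ z) A - S z.
    by rewrite partial_sumE.
  apply: (@Hnorm_ge _ (fun z => summability.partial_sum
    ((fun i z => expC (w i z))^~ z) A - S z) R
    (\sum_(i <- A) Hnorm R (fun z => expC (w i z)) + Hnorm R S)) => // y Ey.
  apply: le_trans (normcB _ _) _; apply: lerD; last exact: inH_bound.
  rewrite partial_sumE; apply: normc_sum_le => i _; exact: (inH_bound (weight_inH i)).
have -> : e = 4 * (e / 8 + e / 8) by field.
apply: abs_sum_le => B' B'B.
have dAB' : [disjoint A0 & B']%fset by exact: fdisjointWr B'B dAB.
have h1 := near A0 (fsubset_refl _).
have h2 := near (A0 `|` B')%fset (fsubsetUl _ _).
have E : \sum_(i <- (A0 `|` B')%fset) expC (w i z) =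
   \sum_(i <- A0) expC (w i z) + \sum_(i <- B') expC (w i z).
  rewrite (fsum_split _ (fsubsetUl A0 B')); congr (_ + _).
  congr (\sum_(i <- enum_fset _) _); rewrite fsetDUl fsetDv fset0U.
  by apply/fsetDidPl; rewrite fdisjoint_sym.
have -> : \sum_(i <- B') expC (w i z) =
   (\sum_(i <- (A0 `|` B')%fset) expC (w i z) - S z) -
   (\sum_(i <- A0) expC (w i z) - S z) by rewrite E; ring.
by apply: le_trans (normcB _ _) _; exact: lerD.
Qed.

Lemma weights_bounded : exists2 W : K, 0 <= W & forall z (A : {fset I}),
  ellipse R z -> \sum_(i <- A) normc (expC (w i z)) <= W.
Proof.
have [A0 HA0] := weights_tail ltr01.
have s0 : 0 <= \sum_(i <- A0) Hnorm R (fun z => expC (w i z)).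
  apply: sumr_ge0 => i _; apply: le_trans (normc_ge0 (expC (w i 0))) _.
  by apply: (inH_bound (weight_inH i)); exact: ellipse0.
exists (\sum_(i <- A0) Hnorm R (fun z => expC (w i z)) + 1); first by lra.
move=> z A Ez.
have F0 i : 0 <= normc (expC (w i z)) by exact: normc_ge0.
apply: le_trans (ler_fsum F0 (fsubsetUr A0 A)) _.
rewrite (fsum_split _ (fsubsetUl A0 A)); apply: lerD.
  by apply: ler_sum => i _; exact: (inH_bound (weight_inH i)).
by apply: HA0 => //; rewrite fdisjoint_sym; apply/fdisjointP => i; rewrite inE => /andP[].
Qed.

Section Bounded.
Variables (u : C -> C) (B : K).
Hypothesis uB : forall z, ellipse r z -> normc (u z) <= B.

Let B0 : 0 <= B.
Proof. by apply: le_trans (normc_ge0 _) (uB (ellipse0 r_gt0)). Qed.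

Let a z i : C := expC (w i z) * u (g i z).

Let a_le z i : ellipse R z -> normc (a z i) <= normc (expC (w i z)) * B.
Proof.
move=> Ez; rewrite normcM ler_wpM2l ?normc_ge0 //; exact/uB/branch_image.
Qed.

Lemma transfer_summable z : ellipse R z -> abs_summable (a z).
Proof.
have [W _ HW] := weights_bounded => Ez; exists (W * B) => A.
apply: le_trans (_ : \sum_(i <- A) normc (expC (w i z)) * B <= _).
  by apply: ler_sum => i _; exact: a_le.
by rewrite -mulr_suml ler_wpM2r // HW.
Qed.

(** By [weights_tail] the finite partial sums converge uniformly. *)
Lemma transfer_hol : (forall z, ellipse r z -> hol u z) ->
  forall z, ellipse R z -> hol (transfer g w u) z.
Proof.
move=> uh; apply: analytic_hol; apply: uniform_limit_analytic.
  exact: ellipse_open.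
move=> e e0; have B1 : 0 < B + 1 by exact: ltr_wpDl.
have [A0 HA0] := weights_tail (divr_gt0 e0 B1).
exists (fun z => \sum_(i <- A0) expC (w i z) * u (g i z)) => z Ez.
  apply: hol_sum => i _; apply: holM.
    by have [/analytic_hol h _] := weight_inH i; exact: h.
  apply: hol_comp; first exact: (analytic_hol (g_analytic i)).
  exact/uh/branch_image.
apply: sum_near; first exact: transfer_summable.
move=> A dA; apply: le_trans (_ : \sum_(i <- A) normc (expC (w i z)) * B <= _).
  by apply: ler_sum => i _; exact: a_le.
rewrite -mulr_suml; apply: le_trans (ler_wpM2r B0 (HA0 z A Ez dA)) _.
by rewrite mulrAC ler_pdivrMr // ler_wpM2l ?(ltW e0) // lerDl.
Qed.

End Bounded.

Lemma transfer_bounded : exists2 W : K, 0 <= W & forall u (B : K),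
  (forall z, ellipse r z -> normc (u z) <= B) ->
  forall z, ellipse R z -> normc (transfer g w u z) <= W * B.
Proof.
have [W W0 HW] := weights_bounded; exists W => // u B uB z Ez.
have B0 : 0 <= B by apply: le_trans (normc_ge0 _) (uB _ (ellipse0 r_gt0)).
apply: sum_le => A.
apply: le_trans (_ : \sum_(i <- A) normc (expC (w i z)) * B <= _).
  apply: ler_sum => i _; rewrite normcM ler_wpM2l ?normc_ge0 //.
  exact/uB/branch_image.
by rewrite -mulr_suml ler_wpM2r // HW.
Qed.

Lemma transfer_linear c u v (B B' : K) z :
  (forall z, ellipse r z -> normc (u z) <= B) ->
  (forall z, ellipse r z -> normc (v z) <= B') -> ellipse R z ->
  transfer g w (fun y => c * u y + v y) z =
  c * transfer g w u z + transfer g w v z.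
Proof.
move=> uB vB Ez.
rewrite /transfer -(sum_linear c (transfer_summable uB Ez) (transfer_summable vB Ez)).
by apply: f_equal; apply/funext => i; rewrite mulrDr mulrCA.
Qed.

Lemma eq_transfer u v z : (forall y, ellipse r y -> u y = v y) -> ellipse R z ->
  transfer g w u z = transfer g w v z.
Proof.
move=> uv Ez; rewrite /transfer; apply: f_equal; apply/funext => i.
by rewrite uv //; exact: branch_image.
Qed.

Lemma transfer_inH u : inH r u -> inH R (transfer g w u).
Proof.
move=> /(inH_hol _ r_gt0)[uh [B uB]]; apply/inH_hol => //; split.
  exact: transfer_hol uB uh.
by have [W _ HW] := transfer_bounded; exists (W * B); exact: HW.
Qed.

End Transfer.

(** * The Banach space of the operators *)

Section HardySpace.
Context {K : realType} (R : K).
Local Notation C := K[i].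

(** The representatives of the elements of [H_R] that vanish outside the
    ellipse: on these, equality in [H_R] is equality. *)
Definition hardy_pred : {pred (C -> C^o)} := fun f : C -> C =>
  `[< [/\ forall z, ellipse R z -> hol f z,
          exists M, forall z, ellipse R z -> normc (f z) <= M &
          forall z, ~ ellipse R z -> f z = 0] >].

Lemma hardy_submod_closed : subsemimod_closed hardy_pred.
Proof.
split; first split.
- apply/asboolP; split=> [z _||z _] //; first exact: hol_const.
  by exists 0 => z _; rewrite normc0.
- move=> u v /asboolP[uh [M uM] u0] /asboolP[vh [M' vM] v0]; apply/asboolP; split.
  + by move=> z Ez; apply: holD; [exact: uh|exact: vh].
  + exists (M + M') => z Ez; apply: le_trans (normcD _ _) _.
    by apply: lerD; [exact: uM|exact: vM].
  + by move=> z nE; rewrite /= [LHS](_ : _ = u z + v z) // u0 // v0 // addr0.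
- move=> a u /asboolP[uh [M uM] u0]; apply/asboolP; split.
  + by move=> z Ez; apply: holZ; exact: uh.
  + exists (normc a * M) => z Ez; rewrite [X in normc X](_ : _ = a * u z) //.
    by rewrite normcM ler_wpM2l ?normc_ge0 // uM.
  + by move=> z nE; rewrite [LHS](_ : _ = a * u z) // u0 // mulr0.
Qed.

HB.instance Definition _ :=
  GRing.isSubmodClosed.Build C (C -> C^o) hardy_pred hardy_submod_closed.

Record hardy := Hardy { hardy_fun : C -> C^o; hardy_funP : hardy_fun \in hardy_pred }.

HB.instance Definition _ := [isSub for hardy_fun].
HB.instance Definition _ := [Choice of hardy by <:].
HB.instance Definition _ := [SubChoice_isSubLmodule of hardy by <:].

Definition hval (u : hardy) : C -> C := hardy_fun u.

End HardySpace.

Arguments hval {K R} u z : simpl never.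
Coercion hval : hardy >-> Funclass.

Section HardyNorm.
Context {K : realType} (R : K) (R_gt0 : 0 < R).
Local Notation C := K[i].
Local Notation X := (hardy R).
Implicit Types (u v : X) (f : C -> C).

Lemma hardy_add u v z : (u + v) z = u z + v z. Proof. by []. Qed.
Lemma hardy_sub u v z : (u - v) z = u z - v z. Proof. by []. Qed.
Lemma hardy_scale (a : C) u z : (a *: u) z = a * u z. Proof. by []. Qed.
Lemma hardy0 z : (0 : X) z = 0. Proof. by []. Qed.

Lemma hardy_sum (J : Type) (s : seq J) (Q : pred J) (F : J -> X) z :
  (\sum_(j <- s | Q j) F j) z = \sum_(j <- s | Q j) F j z.
Proof. by apply: (big_morph (fun u : X => u z)). Qed.

Lemma hardyP u : [/\ forall z, ellipse R z -> hol u z,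
  exists M, forall z, ellipse R z -> normc (u z) <= M &
  forall z, ~ ellipse R z -> u z = 0].
Proof. exact/asboolP/(hardy_funP u). Qed.

Lemma hardy_hol u z : ellipse R z -> hol u z.
Proof. by case: (hardyP u) => h _ _; exact: h. Qed.

Lemma hardy_inH u : inH R u.
Proof. by apply/inH_hol => //; case: (hardyP u). Qed.

Lemma hardy_eq u v : (forall z, ellipse R z -> u z = v z) -> u = v.
Proof.
move=> uv; apply: val_inj; apply/funext => z.
have [Ez|nE] := pselect (ellipse R z); first exact: uv.
have [_ _ u0] := hardyP u; have [_ _ v0] := hardyP v.
by rewrite [LHS](u0 z nE) [RHS](v0 z nE).
Qed.

Lemma hardy_le u z : ellipse R z -> normc (u z) <= Hnorm R u.
Proof. exact/inH_bound/hardy_inH. Qed.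

Definition hardy_trunc f z : C^o := if `[< ellipse R z >] then f z else 0.

(** The element of the space represented by a function; [0] if the function is
    not a bounded holomorphic function on the ellipse. *)
Definition to_hardy f : X := insubd 0 (hardy_trunc f).

Lemma to_hardyE f z : (forall z, ellipse R z -> hol f z) ->
  (exists M, forall z, ellipse R z -> normc (f z) <= M) ->
  ellipse R z -> to_hardy f z = f z.
Proof.
move=> fh [M fM] Ez.
have tE y : ellipse R y -> hardy_trunc f y = f y.
  by move=> Ey; rewrite /hardy_trunc asboolT.
have P : hardy_trunc f \in hardy_pred R.
  apply/asboolP; split=> [y Ey||y nE]; last by rewrite /hardy_trunc asboolF.
    have [e e0 He] := ellipse_open R_gt0 Ey; apply: (eq_hol e0 _ (fh y Ey)).
    by move=> x /He Ex; rewrite tE.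
  by exists M => y Ey; rewrite tE // fM.
by rewrite -[RHS](tE z Ez) /hval /to_hardy [hardy_fun _](insubdK _ P).
Qed.

Lemma hardy_norm : banach_norm (fun u : X => Hnorm R u).
Proof.
split=> [u v|a u|u u0|u c q /andP[q0 q1] Hu].
- apply: Hnorm_le => // z Ez; apply: le_trans (normcD _ _) _.
  by apply: lerD; exact: hardy_le.
- have le b v : Hnorm R (b *: v) <= normc b * Hnorm R v.
    apply: Hnorm_le => // z Ez; rewrite hardy_scale normcM.
    by rewrite ler_wpM2l ?normc_ge0 // hardy_le.
  apply/eqP; rewrite eq_le le andTb.
  have [->|a0] := eqVneq a 0.
    rewrite normc0 mul0r; apply: le_trans (hardy_le _ (ellipse0 R_gt0)).
    exact: normc_ge0.
  rewrite -{1}[u](scalerK a0) -ler_pdivlMl ?normc_gt0 //.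
  apply: le_trans (le _ _) _.
  have -> // : normc a^-1 = (normc a)^-1.
  by apply: (mulIf (x := normc a)); rewrite ?gt_eqF ?normc_gt0 // -normcM mulVf // normc1 mulVf // gt_eqF ?normc_gt0.
- apply: hardy_eq => z Ez; apply/eqP; rewrite -normc_eq0 eq_le normc_ge0 andbT.
  by rewrite -u0 hardy_le.
have c0 : 0 <= c.
  have := Hu 0%N; rewrite expr0 mulr1; apply: le_trans.
  by apply: le_trans (hardy_le _ (ellipse0 R_gt0)); exact: normc_ge0.
have q'0 : 0 < 1 - q by rewrite subr_gt0.
have near n m z : ellipse R z ->
    normc (u (n + m)%N z - u n z) <= c / (1 - q) * q ^+ n.
  move=> Ez.
  have -> : u (n + m)%N z - u n z =
      \sum_(0 <= k < m) (u (n + k).+1 z - u (n + k)%N z).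
    rewrite (eq_bigr (fun k => u (n + k.+1)%N z - u (n + k)%N z)); last first.
      by move=> k _; rewrite addnS.
    by rewrite (telescope_sumr (fun k => u (n + k)%N z)) // addn0.
  apply: le_trans (normc_sum _ _ _) _.
  apply: le_trans (_ : \sum_(0 <= k < m) c * q ^+ n * q ^+ k <= _).
    apply: ler_sum => k _; rewrite -mulrA -exprD; apply: le_trans (Hu _).
    by rewrite -hardy_sub; exact: hardy_le.
  rewrite -mulr_sumr [leRHS]mulrAC; apply: ler_wpM2l; first by rewrite mulr_ge0 ?exprn_ge0.
  exact: geom_le.
have uB z : ellipse R z -> forall n, normc (u n z) <= normc (u 0%N z) + c / (1 - q).
  move=> Ez n; have -> : u n z = u 0%N z + (u n z - u 0%N z) by ring.
  apply: le_trans (normcD _ _) _; rewrite lerD2l.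
  by have := near 0%N n z Ez; rewrite expr0 mulr1 add0n.
pose f z := ulim (fun n => u n z).
have fu n z : ellipse R z -> normc (f z - u n z) <= c / (1 - q) * q ^+ n.
  move=> Ez.
  have E : ulim (fun m => 1 * u m z + (- u n z)) = f z - u n z.
    rewrite (ulimD (B := normc (u 0%N z) + c / (1 - q)) (B' := normc (u n z))).
    - by rewrite (ulimZ _ (uB z Ez)) mul1r ulim_const.
    - by move=> m; rewrite mul1r uB.
    - by move=> m; rewrite normcN.
  rewrite -E; apply: (ulim_le (B := normc (u 0%N z) + c / (1 - q) + normc (u n z))).
    move=> m; rewrite mul1r; apply: le_trans (normcB _ _) _.
    by rewrite lerD2r uB.
  apply: filterS (ultra_nat_ge n) => m /= nm; rewrite mul1r.
  by rewrite -(subnKC nm) near.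
have fE z : ellipse R z -> to_hardy f z = f z.
  move=> Ez; apply: to_hardyE => //.
    apply: analytic_hol; apply: uniform_limit_analytic; first exact: ellipse_open.
    move=> e e0.
    have e'0 : 0 < e / (c / (1 - q) + 1).
      by rewrite divr_gt0 // ltr_wpDl // divr_ge0 // ltW.
    have [n Hn] : exists n, q ^+ n <= e / (c / (1 - q) + 1).
      apply: contrapT => nex; move: e'0; rewrite ltNge => /negP; apply.
      apply: (@le_geom_eq0 _ _ 1 q) => [|n]; first by rewrite q0.
      by rewrite mul1r leNgt; apply/negP => /ltW lt; apply: nex; exists n.
    exists (u n) => y Ey; first exact: hardy_hol.
    apply: le_trans (fu n y Ey) _.
    have : c / (1 - q) * q ^+ n <= c / (1 - q) * (e / (c / (1 - q) + 1)).
      by rewrite ler_wpM2l // divr_ge0 // ltW.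
    move/le_trans; apply; have A0 : 0 <= c / (1 - q) by rewrite divr_ge0 // ltW.
    rewrite mulrCA ger_pMr // ler_pdivrMr ?mul1r ?lerDl //.
    by rewrite ltr_wpDl.
  exists (Hnorm R (u 0%N) + c / (1 - q)) => y Ey.
  rewrite -[X in normc X](subrK (u 0%N y)) addrC; apply: le_trans (normcD _ _) _.
  apply: lerD; first exact: hardy_le.
  by have := fu 0%N y Ey; rewrite expr0 mulr1.
exists (to_hardy f) => n; apply: Hnorm_le => // z Ez.
by rewrite hardy_sub fE //; exact: fu.
Qed.
End HardyNorm.

Section BoundedAlgebra.
Context {K : realType} (r : K) (r_gt0 : 0 < r).
Local Notation C := K[i].
Implicit Types (u v : C -> C).

Lemma inH_const c : inH r (fun=> c : C).
Proof.
apply/inH_hol => //; split=> [z _|]; first exact: hol_const.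
by exists (normc c).
Qed.

Lemma inH_id : inH r (fun z : C => z).
Proof.
apply/inH_hol => //; split=> [z _|]; first exact: hol_id.
exists (cosh r + sinh r) => z; rewrite /ellipse /= => Ez.
have c_gt1 := cosh_gt1 r_gt0; have c0 : 0 < cosh r by exact: lt_trans c_gt1.
have s0 := sinh_gt0 r_gt0.
have le (x c : K) : 0 < c -> (x / c) ^+ 2 < 1 -> `|x| <= c.
  move=> c1; rewrite -ltr_sqrt // sqrtr_sqr sqrtr1 normrM normfV (gtr0_norm c1).
  by rewrite ltr_pdivrMr // mul1r => /ltW.
apply: le_trans (normc_ReIm _) _; apply: lerD; apply: le => //.
  by apply: le_lt_trans Ez; rewrite lerDl sqr_ge0.
by apply: le_lt_trans Ez; rewrite lerDr sqr_ge0.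
Qed.

Lemma inHD u v : inH r u -> inH r v -> inH r (fun z => u z + v z).
Proof.
move=> /(inH_hol _ r_gt0)[uh [M uM]] /(inH_hol _ r_gt0)[vh [M' vM]].
apply/inH_hol => //; split=> [z Ez|]; first by apply: holD; [exact: uh|exact: vh].
exists (M + M') => z Ez; apply: le_trans (normcD _ _) _.
by apply: lerD; [exact: uM|exact: vM].
Qed.

Lemma inHM u v : inH r u -> inH r v -> inH r (fun z => u z * v z).
Proof.
move=> /(inH_hol _ r_gt0)[uh [M uM]] /(inH_hol _ r_gt0)[vh [M' vM]].
apply/inH_hol => //; split=> [z Ez|]; first by apply: holM; [exact: uh|exact: vh].
exists (M * M') => z Ez; rewrite normcM.
by apply: ler_pM; rewrite ?normc_ge0 ?uM ?vM.
Qed.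

Lemma inHZ (a : C) u : inH r u -> inH r (fun z => a * u z).
Proof. by move=> uH; apply: inHM => //; exact: inH_const. Qed.

Lemma inH_sum (J : Type) (s : seq J) (Q : pred J) (F : J -> C -> C) :
  (forall j, Q j -> inH r (F j)) -> inH r (fun z => \sum_(j <- s | Q j) F j z).
Proof.
move=> FH; elim: s => [|j s IH].
  by rewrite (_ : (fun z => _) = fun=> 0); [exact: inH_const|apply/funext => z; rewrite big_nil].
have [Qj|nQ] := boolP (Q j).
  rewrite (_ : (fun z => _) = fun z => F j z + \sum_(j <- s | Q j) F j z).
    by apply: inHD IH; exact: FH.
  by apply/funext => z; rewrite big_cons Qj.
rewrite (_ : (fun z => _) = fun z => \sum_(j <- s | Q j) F j z) //.
by apply/funext => z; rewrite big_cons (negPf nQ).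
Qed.

Lemma inH_prod (J : Type) (s : seq J) (Q : pred J) (F : J -> C -> C) :
  (forall j, Q j -> inH r (F j)) -> inH r (fun z => \prod_(j <- s | Q j) F j z).
Proof.
move=> FH; elim: s => [|j s IH].
  by rewrite (_ : (fun z => _) = fun=> 1); [exact: inH_const|apply/funext => z; rewrite big_nil].
have [Qj|nQ] := boolP (Q j).
  rewrite (_ : (fun z => _) = fun z => F j z * \prod_(j <- s | Q j) F j z).
    by apply: inHM IH; exact: FH.
  by apply/funext => z; rewrite big_cons Qj.
rewrite (_ : (fun z => _) = fun z => \prod_(j <- s | Q j) F j z) //.
by apply/funext => z; rewrite big_cons (negPf nQ).
Qed.

Lemma inH_lagrange N (k : 'I_N) : inH r (lagrange k).
Proof.
apply: inH_prod => m _.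
rewrite (_ : (fun z => _) = fun z => (z + - toC (cheb_node m : K)) *
  (toC (cheb_node k - cheb_node m))^-1) //.
apply: inHM; last exact: inH_const.
by apply: inHD; [exact: inH_id|exact: inH_const].
Qed.

Lemma inH_interp N u : inH r (interp N u).
Proof. by apply: inH_sum => j _; apply: inHZ; exact: inH_lagrange. Qed.

End BoundedAlgebra.

Lemma expR_decay (K : realType) (r R c e : K) : r < R -> 0 <= c -> 0 < e -> exists N0, forall N,
  (N0 <= N)%N -> c * expR (- ((R - r) * N%:R)) <= e.
Proof.
move=> rR c0 e0; have d0 : 0 < R - r by rewrite subr_gt0.
exists (Num.truncn (c / e / (R - r))).+1 => N HN.
rewrite expRN ler_pdivrMr ?expR_gt0 // mulrC -ler_pdivrMr //.
apply: le_trans (_ : (R - r) * N%:R <= _); last first.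
  apply: le_trans (expR_ge1Dx _); by rewrite lerDr.
rewrite [leRHS]mulrC -ler_pdivrMr //; apply/ltW/(lt_le_trans (truncnS_gt _)).
by rewrite ler_nat.
Qed.

Section HardyTransfer.
Context {K : realType} {I : choiceType}.
Local Notation C := K[i].
Variables (g w : I -> C -> C) (r R : K) (S : C -> C).
Hypotheses (r_gt0 : 0 < r) (rR : r < R)
  (g_analytic : forall i, analytic_on (ellipse R) (g i))
  (weights_sum : H_has_sum R (fun i z => expC (w i z)) S)
  (branch_image : forall i z, ellipse R z -> ellipse r (g i z)).
Local Notation X := (hardy R).
Local Notation nrm := (fun u : X => Hnorm R u).

Let R_gt0 : 0 < R. Proof. exact: lt_trans rR. Qed.
Let hX := hardy_norm R_gt0.
Let sub z : ellipse r z -> ellipse R z. Proof. exact: ellipse_sub. Qed.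

Lemma hardy_inHr (u : X) : inH r u.
Proof. exact/(inH_sub r_gt0 rR)/hardy_inH. Qed.

(** As the branches map the large ellipse into the small one, the transfer
    operator maps functions on the small one to functions on the large one. *)
Definition lift_transfer (v : C -> C) : X := to_hardy R (transfer g w v).
Local Notation lift := lift_transfer.

Lemma lift_transferE v z : inH r v -> ellipse R z -> lift v z = transfer g w v z.
Proof.
move=> vH Ez.
have /(inH_hol _ R_gt0)[h b] := transfer_inH r_gt0 rR g_analytic weights_sum branch_image vH.
exact: to_hardyE.
Qed.

Lemma lift_transfer_lin (a : C) u v : inH r u -> inH r v ->
  lift (fun z => a * u z + v z) = a *: lift u + lift v.
Proof.
move=> uH vH; apply: hardy_eq => z Ez; rewrite hardy_add hardy_scale.
have [_ [M uM]] := uH; have [_ [M' vM]] := vH.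
rewrite !lift_transferE //; last by apply: inHD => //; exact: inHZ.
exact: (transfer_linear r_gt0 rR weights_sum branch_image a uM vM).
Qed.

Lemma lift_transfer_bound : exists2 W : K, 0 <= W & forall v (B : K), inH r v ->
  (forall z, ellipse r z -> normc (v z) <= B) -> nrm (lift v) <= W * B.
Proof.
have [W W0 HW] := transfer_bounded r_gt0 rR weights_sum branch_image.
exists W => // v B vH vB; apply: Hnorm_le => // z Ez.
by rewrite lift_transferE // HW.
Qed.

Lemma eq_lift_transfer u v : inH r u -> inH r v ->
  (forall z, ellipse r z -> u z = v z) -> lift u = lift v.
Proof.
move=> uH vH uv; apply: hardy_eq => z Ez; rewrite !lift_transferE //.
exact: (eq_transfer w branch_image).
Qed.

Definition hardy_transfer (u : X) : X := lift u.
(** In the basis of the images of the Lagrange polynomials this operator of finite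
    rank acts by the matrix of the discretisation. *)
Definition hardy_transferN N (u : X) : X := lift (interp N u).

Lemma hardy_transfer_lin : lin_op hardy_transfer.
Proof.
move=> a u v; rewrite /hardy_transfer -lift_transfer_lin //; exact: hardy_inHr.
Qed.

Lemma hardy_transferE (u : X) z : ellipse R z -> hardy_transfer u z = transfer g w u z.
Proof. by move=> Ez; rewrite lift_transferE //; exact: hardy_inHr. Qed.

Lemma hardy_transfer_bounded : exists2 W : K, 0 <= W &
  forall u, nrm (hardy_transfer u) <= W * nrm u.
Proof.
have [W W0 HW] := lift_transfer_bound; exists W => // u.
by apply: HW => [|z Ez]; [exact: hardy_inHr|apply: hardy_le => //; exact: sub].
Qed.

Lemma hardy_transferN_lin N : lin_op (hardy_transferN N).
Proof.
move=> a u v; rewrite /hardy_transferN -lift_transfer_lin; [|exact: inH_interp..].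
congr lift; apply/funext => z; rewrite /interp mulr_sumr -big_split /=.
by apply: eq_bigr => j _; rewrite hardy_add hardy_scale; ring.
Qed.

Lemma lift_transfer_sum (J : Type) (s : seq J) (c : J -> C) (F : J -> C -> C) :
  (forall j, inH r (F j)) ->
  lift (fun y => \sum_(j <- s) c j * F j y) = \sum_(j <- s) c j *: lift (F j).
Proof.
move=> FH; elim: s => [|j s IH].
  have c0 := inH_const r_gt0 (0 : C).
  rewrite big_nil (_ : (fun y => _) = fun y => -1 * 0 + 0).
    by rewrite lift_transfer_lin // scaleN1r addNr.
  by apply/funext => y; rewrite big_nil mulr0 addr0.
rewrite big_cons -IH -lift_transfer_lin //; last first.
  by apply: inH_sum => // k _; exact: inHZ.
by congr lift; apply/funext => y; rewrite big_cons.
Qed.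

Lemma hardy_transferN_sum N u :
  hardy_transferN N u = \sum_(j < N) u (toC (cheb_node j)) *: lift (lagrange j).
Proof.
rewrite -lift_transfer_sum // => j; exact: inH_lagrange.
Qed.

(** The interpolation error is only needed on the small ellipse, where it is
    exponentially small for functions bounded on the large one. *)
Lemma hardy_transferN_near : exists2 c : K, 0 <= c & forall N u, (0 < N)%N ->
  nrm (hardy_transferN N u - hardy_transfer u) <= c * expR (- ((R - r) * N%:R)) * nrm u.
Proof.
have [W W0 HW] := lift_transfer_bound.
exists (W * (4 / (1 - expR (- (R - r))))).
  rewrite mulr_ge0 // divr_ge0 // subr_ge0 -expR0 ler_expR oppr_le0 subr_ge0.
  exact: ltW.
move=> N u N0.
have -> : hardy_transferN N u - hardy_transfer u = lift (fun z => -1 * u z + interp N u z).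
  rewrite lift_transfer_lin ?scaleN1r 1?addrC //; first exact: hardy_inHr.
  exact: inH_interp.
rewrite -!mulrA; apply: HW.
  apply: inHD; [by []| |exact: inH_interp].
  by apply: inHZ => //; exact: hardy_inHr.
move=> z Ez; rewrite mulN1r addrC.
have := interp_err r_gt0 rR (@hardy_hol _ R u) (fun z Ez => hardy_le R_gt0 u Ez) N0 Ez.
move/le_trans; apply; rewrite le_eqVlt; apply/orP; left; apply/eqP; ring.
Qed.

Lemma node_bounded N (j : 'I_N) :
  bounded_fun nrm (fun u : X => u (toC (cheb_node j))).
Proof.
split=> [a u v|]; first by [].
by exists 1 => u; rewrite mul1r; apply: hardy_le => //; exact: ellipse_node.
Qed.

Lemma hardy_transfer_approximable : approximable nrm hardy_transfer.
Proof.
move=> e e0; have [c c0 Hc] := hardy_transferN_near; have [N0 HN] := expR_decay rR c0 e0.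
pose N := N0.+1; exists N, (fun u => hardy_transfer u - hardy_transferN N u),
  (fun j (u : X) => u (toC (cheb_node j))), (fun j => lift (lagrange j)).
split=> [a u v|u|j|u]; last by rewrite -hardy_transferN_sum subrK.
- by rewrite hardy_transfer_lin hardy_transferN_lin scalerBr opprD addrACA.
- rewrite (nrm_distC hX); apply: le_trans (Hc N u (ltn0Sn _)) _.
  rewrite ler_wpM2r ?HN //; exact: (nrm_ge0 hX).
exact: node_bounded.
Qed.

Section Eigenvectors.
Variables (lam : K) (h : C -> C) (nu : (C -> C) -> C).
Hypotheses (lam_gt0 : 0 < lam)
  (simple : simple_eigenvalue r (transfer g w) (toC lam))
  (h_eigen : right_eigenfunction r (transfer g w) (toC lam) h)
  (nu_eigen : left_eigenvector r (transfer g w) (toC lam) nu).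

Let lamC : toC lam != 0. Proof. by rewrite -normc_eq0 normc_real normr_eq0 gt_eqF. Qed.

(** An eigenfunction on the small ellipse extends to the large one, as the
    transfer operator only looks at values on the small one. *)
Definition extend_eigen (z : C) (u : C -> C) : X := z^-1 *: lift u.

Lemma extend_eigenE z u : z != 0 -> inH r u ->
  eqH r (transfer g w u) (fun y => z * u y) ->
  eqH r (extend_eigen z u) u.
Proof.
move=> z0 uH Tu y Ey; rewrite /extend_eigen hardy_scale lift_transferE //; last exact: sub.
by rewrite Tu // mulKf.
Qed.

Lemma extend_eigen_transfer z u : z != 0 -> inH r u ->
  eqH r (transfer g w u) (fun y => z * u y) ->
  hardy_transfer (extend_eigen z u) = z *: extend_eigen z u.
Proof.
move=> z0 uH Tu; rewrite {2}/extend_eigen scalerA divff // scale1r.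
apply: eq_lift_transfer => //; first exact: hardy_inHr.
exact: extend_eigenE.
Qed.

Definition eigen : X := extend_eigen (toC lam) h.

Lemma eigenE : eqH r eigen h.
Proof. by case: h_eigen => hH _ Th; exact: extend_eigenE. Qed.

Lemma eigen_transfer : hardy_transfer eigen = toC lam *: eigen.
Proof. by case: h_eigen => hH _ Th; exact: extend_eigen_transfer. Qed.

Lemma eigen_neq0 : eigen != 0.
Proof.
case: h_eigen => _ h0 _; apply/eqP => E; apply: h0 => z Ez.
by rewrite -eigenE // E hardy0.
Qed.

Lemma hardy_transferE_eigen u : hardy_transfer u = toC lam *: u ->
  eqH r (transfer g w u) (fun y => toC lam * u y).
Proof. by move=> Tu y Ey; rewrite -hardy_transferE ?Tu //; exact: sub. Qed.

Lemma hardy_transfer_ext_eq u v : hardy_transfer u = toC lam *: u ->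
  hardy_transfer v = toC lam *: v ->
  eqH r u v -> u = v.
Proof.
move=> Tu Tv uv; apply: (scalerI lamC); rewrite -Tu -Tv.
by apply: eq_lift_transfer uv; exact: hardy_inHr.
Qed.

Lemma eigen_generates n (u : C -> C) : inH r u ->
  eqH r (iter n (fun v z => transfer g w v z - toC lam * v z) u) (fun=> 0) ->
  exists c, eqH r u (c *: eigen).
Proof.
have [h0 _ gen] := simple.
have [d hd] : exists c : C, eqH r eigen (fun z => c * h0 z).
  apply: (gen 1%N); first exact: hardy_inHr.
  by move=> y Ey /=; rewrite (hardy_transferE_eigen eigen_transfer) // subrr.
have d0 : d != 0.
  apply/eqP => E; case: h_eigen => _ hn _; apply: hn => z Ez.
  by rewrite -eigenE // hd // E mul0r.
move=> uH /(gen _ _ uH)[c uc]; exists (c / d) => z Ez.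
by rewrite uc // hardy_scale hd // mulrA divfK.
Qed.

Lemma eigen_simple u : hardy_transfer u = toC lam *: u -> exists c, u = c *: eigen.
Proof.
move=> Tu; have [|c uc] := @eigen_generates 1 u (hardy_inHr u).
  by move=> y Ey /=; rewrite (hardy_transferE_eigen Tu) // subrr.
exists c; apply: hardy_transfer_ext_eq => //.
by rewrite (lin_opZ hardy_transfer_lin) eigen_transfer !scalerA [c * _]mulrC.
Qed.

(** A solution would be a generalised eigenvector. *)
Lemma eigen_no_jordan u : hardy_transfer u <> toC lam *: u + eigen.
Proof.
move=> Tu.
have E1 : eqH r (fun z => transfer g w u z - toC lam * u z) eigen.
  by move=> z Ez; rewrite -hardy_transferE ?Tu ?hardy_add ?hardy_scale 1?addrC ?addKr //; exact: sub.
have [|c uc] := @eigen_generates 2 u (hardy_inHr u).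
  move=> y Ey; rewrite /= E1 // (eq_transfer w branch_image E1); last exact: sub.
  by rewrite (hardy_transferE_eigen eigen_transfer) // subrr.
have E2 : hardy_transfer u = hardy_transfer (c *: eigen).
  by apply: eq_lift_transfer uc; exact: hardy_inHr.
have := eigen_neq0; rewrite (_ : eigen = 0) ?eqxx //.
apply: hardy_transfer_ext_eq; [exact: eigen_transfer|by rewrite (lin_op0 hardy_transfer_lin) scaler0|].
move=> z Ez; rewrite hardy0 -E1 // -hardy_transferE; last exact: sub.
by rewrite E2 (lin_opZ hardy_transfer_lin) eigen_transfer uc // !hardy_scale mulrCA subrr.
Qed.

Let linnu a u v : inH r u -> inH r v ->
  nu (fun z => a * u z + v z) = a * nu u + nu v.
Proof. by case: nu_eigen => -[l _] _ _; exact: l. Qed.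

(** A bounded functional only sees the values on the ellipse. *)
Lemma dual_eq u v : inH r u -> inH r v -> eqH r u v -> nu u = nu v.
Proof.
move=> uH vH uv; apply/eqP; rewrite -subr_eq0 -normc_eq0 eq_le normc_ge0 andbT.
have [[_ [M HM]] _ _] := nu_eigen.
have -> : nu u - nu v = nu (fun z => -1 * v z + u z).
  by rewrite linnu // mulN1r addrC.
apply: le_trans (HM _ _) _; first by apply: inHD => //; exact: inHZ.
rewrite (_ : Hnorm r _ = 0) ?mulr0 //; apply/eqP; rewrite eq_le; apply/andP; split.
  by apply: Hnorm_le => // z Ez; rewrite uv // mulN1r addNr normc0.
apply: le_trans (normc_ge0 (-1 * v 0 + u 0)) _.
apply: (inH_bound (f := fun z => -1 * v z + u z)); last exact: ellipse0.
by apply: inHD => //; exact: inHZ.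
Qed.

Definition dual_eigen (u : X) : C := nu u.

Lemma dual_eigen_bounded : bounded_fun nrm dual_eigen.
Proof.
split=> [a u v|]; first by rewrite /dual_eigen -linnu //; exact: hardy_inHr.
have [[_ [M HM]] _ _] := nu_eigen; exists `|M| => u.
apply: le_trans (HM _ (hardy_inHr u)) _.
have n0 : 0 <= Hnorm r u.
  apply: le_trans (normc_ge0 (u 0)) _.
  by apply: inH_bound; [exact: hardy_inHr|exact: ellipse0].
apply: le_trans (_ : `|M| * Hnorm r u <= _); first by rewrite ler_wpM2r // ler_norm.
rewrite ler_wpM2l //; apply: Hnorm_le => // z Ez.
by apply: hardy_le => //; exact: sub.
Qed.

Lemma dual_eigen_transfer u : dual_eigen (hardy_transfer u) = toC lam * dual_eigen u.
Proof.
have [_ _ Tnu] := nu_eigen; rewrite /dual_eigen -(Tnu u (hardy_inHr u)).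
apply: dual_eq; first exact: hardy_inHr.
  apply: (inH_sub r_gt0 rR).
  exact: (transfer_inH r_gt0 rR g_analytic weights_sum branch_image (hardy_inHr u)).
by move=> z Ez; rewrite hardy_transferE //; exact: sub.
Qed.

Lemma dual_eigen_neq0 : exists u, dual_eigen u != 0.
Proof.
have [_ [u uH nu0] Tnu] := nu_eigen; exists (lift u).
have -> : dual_eigen (lift u) = nu (transfer g w u).
  apply: dual_eq; first exact: hardy_inHr.
    apply: (inH_sub r_gt0 rR).
    exact: (transfer_inH r_gt0 rR g_analytic weights_sum branch_image uH).
  by move=> z Ez; rewrite lift_transferE //; exact: sub.
by rewrite Tnu // mulf_neq0.
Qed.

End Eigenvectors.
End HardyTransfer.

(** * Positive operators *)

(** The setting is that of a positive operator in the sense of Perron and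
    Frobenius: [ev u] is the real part of [u] on the real interval, on which [T]
    acts as a weighted sum over the contractions [b i]. *)
Section PositiveOperator.
Context {K : realType} {X : lmodType K[i]} {I : Type}.
Local Notation C := K[i].
Variables (nrm : X -> K) (T : X -> X) (ev : X -> K -> K)
  (b p : I -> K -> K) (i0 : I) (one : X) (lam : K).
Hypotheses (bX : banach_norm nrm) (linT : lin_op T)
  (evD : forall u v x, ev (u + v) x = ev u x + ev v x)
  (evZ : forall (a : K) u x, ev (toC a *: u) x = a * ev u x)
  (ev_le : forall u x, -1 <= x <= 1 -> `|ev u x| <= nrm u)
  (ev_lip : forall u, exists2 L : K, 0 <= L & forall x y, -1 <= x <= 1 ->
     -1 <= y <= 1 -> `|ev u x - ev u y| <= L * `|x - y|)
  (ev_eq0 : forall u z, z != 0 -> T u = z *: u ->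
     (forall x, -1 <= x <= 1 -> ev u x = 0) ->
     (forall x, -1 <= x <= 1 -> ev ('i *: u) x = 0) -> u = 0)
  (ev_one : forall x, -1 <= x <= 1 -> ev one x = 1)
  (b_range : forall i x, -1 <= x <= 1 -> -1 <= b i x <= 1)
  (b_contraction : forall i, exists2 k : K, k < 1 & forall x y, -1 <= x <= 1 ->
     -1 <= y <= 1 -> `|b i x - b i y| <= k * `|x - y|)
  (p_gt0 : forall i x, 0 < p i x)
  (T_pos : forall u x, -1 <= x <= 1 -> (forall i, 0 <= ev u (b i x)) ->
     forall i, p i x * ev u (b i x) <= ev (T u) x)
  (lam_gt0 : 0 < lam).

Let lamC : toC lam != 0 :> C.
Proof. by rewrite -normc_eq0 normc_real normr_eq0 gt_eqF. Qed.

Lemma evN u x : ev (- u) x = - ev u x.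
Proof.
have -> : - u = toC (-1) *: u by rewrite rmorphN rmorph1 scaleN1r.
by rewrite evZ mulN1r.
Qed.

Lemma evB u v x : ev (u - v) x = ev u x - ev v x.
Proof. by rewrite evD evN. Qed.

Let ge_nrm u x : -1 <= x <= 1 -> - nrm u <= ev u x.
Proof. by move=> /(ev_le u); rewrite ler_norml => /andP[]. Qed.

Let le_nrm u x : -1 <= x <= 1 -> ev u x <= nrm u.
Proof. by move=> /(ev_le u); rewrite ler_norml => /andP[]. Qed.

Let nrm0 u : 0 <= nrm u. Proof. exact: nrm_ge0 bX u. Qed.

Lemma T_ge0 u x : -1 <= x <= 1 -> (forall i, 0 <= ev u (b i x)) -> 0 <= ev (T u) x.
Proof.
move=> x1 u0; apply: le_trans (T_pos x1 u0 i0).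
by rewrite mulr_ge0 // ltW.
Qed.

Definition branch_invariant (V : set K) := forall x, V x ->
  -1 <= x <= 1 /\ forall i, V (b i x).

(** Iterating the last inequality, [T ^ n] grows at most like [z ^ n] on [V]. *)
Definition supersolution (V : set K) (z : K) := exists v (c : K),
  [/\ 0 < c, forall x, V x -> c <= ev v x &
      forall x, V x -> ev (T v) x <= z * ev v x].

Lemma supersolution_mono V z z' : supersolution V z -> z <= z' -> supersolution V z'.
Proof.
move=> [v [c [c0 vc Tv]]] zz'; exists v, c; split=> // x Vx.
apply: le_trans (Tv x Vx) _; rewrite ler_wpM2r //.
by apply: ltW; apply: lt_le_trans (vc x Vx).
Qed.

(** Applying [T], a lower bound [- m v] for [u] improves to
    [- m (z0 / z) v]. *)
Lemma comparison V z0 z u : branch_invariant V -> supersolution V z0 -> z0 < z ->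
  (forall x, V x -> 0 <= ev (toC z *: u - T u) x) -> forall x, V x -> 0 <= ev u x.
Proof.
move=> Vb [v [c [c0 vc Tv]]] z0z Hu x Vx.
have v0 y : V y -> 0 < ev v y by move=> /vc; exact: lt_le_trans.
have z00 : 0 <= z0.
  have Tv0 : 0 <= ev (T v) x.
    apply: T_ge0 => [|i]; first by case: (Vb x Vx).
    by apply/ltW/v0; case: (Vb x Vx).
  by rewrite -(pmulr_lge0 _ (v0 x Vx)); exact: le_trans (Tv x Vx).
have zp : 0 < z by exact: le_lt_trans z0z.
have q01 : 0 <= z0 / z < 1 by rewrite divr_ge0 ?(ltW zp) //= ltr_pdivrMr // mul1r.
have A0 : 0 <= nrm u / c by rewrite divr_ge0 // ltW.
have claim n y : V y -> - (nrm u / c * (z0 / z) ^+ n * ev v y) <= ev u y.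
  elim: n y => [|n IH] y Vy.
    rewrite expr0 mulr1; apply: le_trans (ge_nrm u (Vb y Vy).1); rewrite lerN2.
    rewrite mulrAC ler_pdivlMr // ler_wpM2l //; exact: vc.
  have [m mE] : exists m, m = nrm u / c * (z0 / z) ^+ n by eexists.
  have m0 : 0 <= m by rewrite mE mulr_ge0 // exprn_ge0 //; case/andP: q01.
  have : 0 <= ev (T (u + toC m *: v)) y.
    apply: T_ge0 => [|i]; first by case: (Vb y Vy).
    rewrite evD evZ; have := IH _ ((Vb y Vy).2 i); rewrite -mE; lra.
  rewrite (lin_opD linT) (lin_opZ linT) evD evZ => h1.
  have := Hu y Vy; rewrite evB evZ => h2.
  have h3 : m * ev (T v) y <= m * (z0 * ev v y) by rewrite ler_wpM2l // Tv.
  rewrite -(ler_pM2l zp) exprS.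
  have -> : z * - (nrm u / c * (z0 / z * (z0 / z) ^+ n) * ev v y) =
     - (m * (z0 * ev v y)) by rewrite mE; field; rewrite gt_eqF // gt_eqF.
  lra.
rewrite -oppr_le0; apply: (@le_geom_eq0 _ _ (nrm u / c * ev v x) (z0 / z)) => // n.
by rewrite lerNl mulrAC; exact: claim.
Qed.

Lemma supersolution_eigen V z u : branch_invariant V -> supersolution V z ->
  z < lam -> T u = toC lam *: u -> forall x, V x -> ev u x = 0.
Proof.
move=> Vb ss zl Tu.
have pos v : T v = toC lam *: v -> forall x, V x -> 0 <= ev v x.
  by move=> Tv; apply: (comparison Vb ss zl) => y Vy; rewrite Tv evB subrr.
move=> x Vx; apply/eqP; rewrite eq_le pos // andbT -oppr_ge0 -evN; apply: pos => //.
by rewrite -[- u]scaleN1r (lin_opZ linT) Tu !scalerA mulrC.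
Qed.

Let D : set K := [set x | -1 <= x <= 1].

Let D_inv : branch_invariant D.
Proof. by move=> x Dx; split=> // i; exact: b_range. Qed.

(** The infimum of the admissible [z] is lowered by the solution of
    [z u - T u = 1], as long as that equation can be solved. *)
Lemma supersolution_above : (forall z, lam < z -> exists u, toC z *: u - T u = one) ->
  forall z, lam < z -> supersolution D z.
Proof.
move=> res z lz; apply: contrapT => nz.
pose E := [set t | lam < t /\ supersolution D t].
have zE t : E t -> z <= t.
  move=> [_ ss]; rewrite leNgt; apply/negP => tz; apply: nz.
  exact: supersolution_mono ss (ltW tz).
have E0 : E (Num.max (lam + 1) (nrm (T one))).
  split; first by rewrite lt_max ltrDl ltr01.
  exists one, 1; split=> // [x /ev_one ->|x Dx]; first exact: lexx.
  by rewrite (ev_one Dx) mulr1 le_max le_nrm // orbT.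
have Einf : has_inf E by split; [eexists; exact: E0|exists z].
have zs : z <= inf E by apply: lb_le_inf; [eexists; exact: E0|].
have [s sE] : exists s, s = inf E by eexists.
rewrite -sE in zs; have ls := lt_le_trans lz zs; have s0 := lt_trans lam_gt0 ls.
have [u Hu] := res s ls.
have n1 : 0 < nrm u + 1 by rewrite ltr_wpDl.
have [e eE] : exists e, e = (nrm u + 1)^-1 by eexists.
have e0 : 0 < e by rewrite eE invr_gt0.
have en : e * nrm u <= 1 by rewrite eE ler_pdivrMl // mulr1 lerDl.
have [t [lt sst] ts] := inf_adherent e0 Einf; rewrite -sE in ts.
have eu x : -1 <= x <= 1 -> - 1 <= e * ev u x <= 1.
  move=> x1; rewrite -ler_norml normrM (gtr0_norm e0).
  by apply: le_trans en; rewrite ler_wpM2l ?(ltW e0) ?ev_le.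
have u0 x : D x -> 0 <= ev u x.
  apply: (comparison D_inv sst ts) => y Dy.
  have -> : toC (s + e) *: u - T u = one + toC e *: u.
    by rewrite -Hu rmorphD scalerDl addrAC.
  by rewrite evD evZ (ev_one Dy); have /andP[] := eu y Dy; lra.
have sE' x : D x -> s * ev u x = 1 + ev (T u) x.
  by move=> Dx; rewrite -(ev_one Dx) -Hu evB evZ; ring.
have Tu0 x : D x -> 0 <= ev (T u) x.
  by move=> Dx; apply: T_ge0 => // i; apply: u0; exact: b_range.
have sse : supersolution D (s - e).
  exists u, s^-1; split=> [|x Dx|x Dx]; first by rewrite invr_gt0.
    rewrite -(ler_pM2l s0) mulfV ?gt_eqF // sE' //; have := Tu0 x Dx; lra.
  have := sE' x Dx; have /andP[_] := eu x Dx; lra.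
have : E (Num.max (s - e) ((lam + s) / 2)).
  split; first by rewrite lt_max; apply/orP; right; lra.
  by apply: supersolution_mono sse _; rewrite le_max lexx.
move=> /(ge_inf Einf.2); rewrite -sE le_max; have : (lam + s) / 2 < s by lra.
by rewrite ltNge => /negPf ->; rewrite orbF; lra.
Qed.

Section Eigenfunction.
Variables (h H y : X).
Hypotheses (ss_above : forall z, lam < z -> supersolution D z)
  (h_neq0 : h != 0) (Th : T h = toC lam *: h)
  (TH : T H = toC lam *: H) (Hy : toC lam *: y - T y = one - H).

(** Up to the small term [e y], the resolvent at [lam + e] maps [one] to [U e];
    [H] is the projection of [one] to the eigenspace. *)
Let U (e : K) := toC e^-1 *: H + y.

Let UE e : 0 < e -> toC (lam + e) *: U e - T (U e) = one + toC e *: y.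
Proof.
move=> e0; rewrite (lin_opD linT) (lin_opZ linT) TH.
have -> : toC (lam + e) *: U e = toC lam *: (toC e^-1 *: H) + toC lam *: y + (H + toC e *: y).
  rewrite rmorphD scalerDl !scalerDr; congr (_ + (_ + _)).
  by rewrite scalerA -rmorphM divff ?gt_eqF // rmorph1 scale1r.
rewrite scalerA [toC e^-1 *: _]scalerA [toC e^-1 * _]mulrC.
have -> : one = toC lam *: y - T y + H by rewrite Hy subrK.
by zmodule.
Qed.

Let e1 : K := (2 * (nrm y + 1))^-1.

Let e1_gt0 : 0 < e1. Proof. by rewrite invr_gt0 mulr_gt0 // ltr_wpDl. Qed.

Let e1_le e x : 0 < e <= e1 -> D x -> `|e * ev y x| <= 1 / 2.
Proof.
move=> /andP[e0 ee1] Dx; rewrite normrM (gtr0_norm e0).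
apply: le_trans (_ : e1 * (nrm y + 1) <= _).
  apply: ler_pM => //; first exact: ltW.
  by apply: le_trans (ev_le _ Dx) _; rewrite lerDl.
rewrite /e1 invfM -mulrA mulVf ?mulr1 ?div1r // gt_eqF // ltr_wpDl //.
Qed.

Let U_ge0 e x : 0 < e <= e1 -> D x -> 0 <= ev (U e) x.
Proof.
move=> ee Dx; have /andP[e0 _] := ee.
have l1 : lam < lam + e / 2 by lra.
have l2 : lam + e / 2 < lam + e by lra.
apply: (comparison D_inv (ss_above l1) l2) => // z Dz.
rewrite UE // evD evZ (ev_one Dz).
by have := e1_le ee Dz; rewrite ler_norml => /andP[]; lra.
Qed.

(** The functions [U e] are nonnegative, and so is the limit of [e U e]. *)
Lemma eigen_ge0 x : D x -> 0 <= ev H x.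
Proof.
move=> Dx; apply/ler_addgt0Pr => d d0.
have [e [e0 ee1 ed]] : exists e : K, [/\ 0 < e, e <= e1 & e * nrm y <= d].
  have n1 : 0 < nrm y + 1 by rewrite ltr_wpDl.
  exists (Num.min e1 (d / (nrm y + 1))); split.
  - by rewrite lt_min e1_gt0 divr_gt0.
  - by rewrite ge_min lexx.
  - apply: le_trans (_ : d / (nrm y + 1) * nrm y <= _).
      by rewrite ler_wpM2r // ge_min lexx orbT.
    by rewrite mulrAC ler_pdivrMr // ler_wpM2l ?(ltW d0) // lerDl.
have ee : 0 < e <= e1 by rewrite e0.
have := U_ge0 ee Dx; rewrite /U evD evZ => h1.
have : 0 <= e * (e^-1 * ev H x + ev y x) by rewrite mulr_ge0 // ltW.
rewrite mulrDr mulrA divff ?gt_eqF // mul1r.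
have : e * ev y x <= e * nrm y by rewrite ler_wpM2l ?(ltW e0) ?le_nrm.
lra.
Qed.

Let W := U e1.

Let W_ge : exists2 c : K, 0 < c & forall x, D x -> c <= ev W x.
Proof.
have l0 : 0 < lam + e1 by rewrite addr_gt0.
have ee : 0 < e1 <= e1 by rewrite e1_gt0 /=.
exists ((lam + e1)^-1 / 2) => [|x Dx]; first by rewrite divr_gt0 // invr_gt0.
rewrite -(ler_pM2l l0) mulrA mulfV ?gt_eqF //.
have : 0 <= ev (T W) x by apply: T_ge0 => // i; apply: U_ge0 => //; exact: b_range.
have := congr1 (ev^~ x) (UE e1_gt0).
rewrite /= evB evZ evD evZ (ev_one Dx) -/W.
by have := e1_le ee Dx; rewrite ler_norml => /andP[]; lra.
Qed.

Let TW x : D x -> ev (T W) x = lam * ev W x - 1 + ev H x.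
Proof.
move=> Dx; have := congr1 (ev^~ x) (UE e1_gt0).
rewrite /= evB evZ evD evZ (ev_one Dx) -/W.
have : e1 * ev W x = ev H x + e1 * ev y x.
  by rewrite /W /U evD evZ mulrDr mulrA divff ?gt_eqF // mul1r.
lra.
Qed.

(** Near the zeros of [H] the function [W] is a supersolution for a number
    below [lam], and a neighbourhood of the zeros is invariant under the
    contractions; so eigenfunctions vanish there and the zero set is all of the
    interval. *)
Lemma eigen_gt0 x : D x -> 0 < ev H x.
Proof.
move=> Dx; rewrite lt_def eigen_ge0 // andbT; apply/eqP => Hx.
pose Z := [set x | D x /\ ev H x = 0].
have Zb z i : Z z -> Z (b i z).
  move=> [Dz Hz]; split; first exact: b_range.
  have pos j : 0 <= ev H (b j z) by apply: eigen_ge0; exact: b_range.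
  have := T_pos Dz pos i; rewrite TH evZ Hz mulr0 pmulr_rle0 // => Hb.
  by apply/eqP; rewrite eq_le Hb pos.
have [L L0 HL] := ev_lip H.
have [eta etaE] : exists eta, eta = (2 * (L + 1))^-1 by eexists.
have L1 : 0 < L + 1 by rewrite ltr_wpDl.
have eta0 : 0 < eta by rewrite etaE invr_gt0 mulr_gt0.
have Leta : L * eta <= 1 / 2.
  rewrite etaE ler_pdivrMr ?mulr_gt0 //; lra.
pose V := [set x | D x /\ exists2 z, Z z & `|x - z| <= eta].
have Vinv : branch_invariant V.
  move=> v [Dv [z Zz vz]]; split=> // i; split; first exact: b_range.
  exists (b i z); first exact: Zb.
  have [k k1 Hk] := b_contraction i; apply: le_trans (Hk _ _ Dv Zz.1) _.
  by apply: le_trans vz; rewrite -[leRHS]mul1r ler_wpM2r // ltW.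
have [c c0 Wc] := W_ge.
have nW : 0 < nrm W + 1 by rewrite ltr_wpDl.
have [d dE] : exists d, d = (2 * (nrm W + 1))^-1 by eexists.
have d0 : 0 < d by rewrite dE invr_gt0 mulr_gt0.
have ssV : supersolution V (lam - d).
  exists W, c; split=> // [v [Dv _]|v [Dv [z [Dz Hz] vz]]]; first exact: Wc.
  rewrite TW //.
  have h1 : ev H v <= 1 / 2.
    have := HL v z Dv Dz; rewrite Hz subr0 => /(le_trans (ler_norm _)).
    have := ler_wpM2l L0 vz; lra.
  have : d * ev W v <= 1 / 2.
    apply: le_trans (_ : d * (nrm W + 1) <= _).
      rewrite ler_wpM2l ?(ltW d0) //; have := le_nrm W Dv; lra.
    by rewrite dE invfM -mulrA mulVf ?mulr1 ?div1r // gt_eqF.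
  lra.
have ld : lam - d < lam by lra.
have VZ v : V v -> Z v.
  by move=> Vv; split; [case: Vv|exact: (supersolution_eigen Vinv ssV ld TH)].
have Z_all n v : D v -> `|v - x| <= n%:R * eta -> Z v.
  elim: n v => [|n IH] v Dv.
    by rewrite mul0r normr_le0 subr_eq0 => /eqP ->; split.
  move=> vx.
  have n0 : 0 < (n.+1%:R : K) by rewrite ltr0n.
  have nn : (n.+1%:R : K) = n%:R + 1 by rewrite -natr1.
  have nge : 0 <= (n%:R : K) by rewrite ler0n.
  pose t : K := n%:R / n.+1%:R.
  have t0 : 0 <= t by rewrite divr_ge0 // ltW.
  have t1 : t <= 1 by rewrite ler_pdivrMr // mul1r nn lerDl.
  have vx' : `|v - x| / n.+1%:R <= eta by rewrite ler_pdivrMr // mulrC.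
  apply: VZ; split=> //; exists (x + t * (v - x)).
    apply: IH.
      by move: Dv Dx; rewrite /D /= => /andP[? ?] /andP[? ?]; apply/andP; split; nra.
    rewrite addrC addKr normrM (ger0_norm t0) /t mulrAC -mulrA.
    by rewrite ler_wpM2l.
  have -> : v - (x + t * (v - x)) = (v - x) / n.+1%:R.
    by rewrite /t nn; field; rewrite -nn gt_eqF.
  by rewrite normrM normfV (gtr0_norm n0).
have VD v : D v -> V v.
  move=> Dv; have [n Hn] : exists n : nat, `|v - x| <= n%:R * eta.
    exists (Num.truncn (`|v - x| / eta)).+1; rewrite -ler_pdivrMr //.
    by apply/ltW; exact: truncnS_gt.
  by split=> //; exists v; [exact: Z_all Hn|rewrite subrr normr0 ltW].
move/eqP: h_neq0; apply; apply: (ev_eq0 lamC Th) => v /VD Vv.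
  exact: (supersolution_eigen Vinv ssV ld Th).
apply: (supersolution_eigen Vinv ssV ld _ Vv).
by rewrite (lin_opZ linT) Th !scalerA mulrC.
Qed.

Lemma ev_min u : exists2 x, D x & forall v, D v -> ev u x <= ev u v.
Proof.
pose E := [set ev u v | v in D].
have D0 : D 0 by rewrite /D /=; lra.
have Einf : has_inf E.
  split; first by exists (ev u 0), 0.
  by exists (- nrm u) => _ [v Dv <-]; exact: ge_nrm.
have ex (n : nat) : exists v, D v /\ ev u v <= inf E + n.+1%:R^-1.
  have [|_ [v Dv <-] /ltW Hv] := @inf_adherent _ E n.+1%:R^-1 _ Einf.
    by rewrite invr_gt0 ltr0n.
  by exists v.
have [s Hs] := choice ex.
have sB n : `|s n| <= 1 by rewrite ler_norml; case: (Hs n).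
have Dx : D (rulim s).
  by apply: (rulim_range _).1 => n; case: (Hs n).
exists (rulim s) => // v Dv.
apply: le_trans (ge_inf Einf.2 (ex_intro2 _ _ v Dv erefl)).
apply/ler_addgt0Pr => e e0; have [L L0 HL] := ev_lip u.
have e'0 : 0 < e / (2 * (L + 1)) by rewrite divr_gt0 // mulr_gt0 // ltr_wpDl.
pose N := Num.truncn (e / 2)^-1.
have [n /= [h1 h2]] := filter_ex (filterI (rulimP sB e'0) (ultra_nat_ge N)).
have [Dn Hn] := Hs n.
have hn : (n.+1%:R : K)^-1 <= e / 2.
  rewrite -[leRHS]invrK lef_pV2 ?posrE ?invr_gt0 ?divr_gt0 //.
  by apply: ltW; apply: lt_le_trans (truncnS_gt _) _; rewrite ler_nat ltnS.
have h3 : L * `|s n - rulim s| <= e / 2.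
  apply: le_trans (_ : L * (e / (2 * (L + 1))) <= _); first by rewrite ler_wpM2l.
  rewrite mulrA ler_pdivrMr ?mulr_gt0 ?ltr_wpDl //; nra.
have h4 : ev u (s n) <= inf E + e / 2 by apply: le_trans Hn _; rewrite lerD2l.
have h5 : ev u (rulim s) - ev u (s n) <= e / 2.
  apply: le_trans h3; apply: le_trans (ler_norm _) _; rewrite distrC.
  exact: HL.
rewrite -(subrK (ev u (s n)) (ev u (rulim s))) addrC.
by apply: le_trans (lerD h4 h5) _; rewrite -addrA -splitr.
Qed.

(** An eigenfunction for [- lam] touches the graph of a multiple of the positive
    one from one side, then from the other side along the orbit of the contact
    point under a contraction; the orbit converges, so they touch at zero. *)
Lemma no_negative_eigenvalue u : T u = - toC lam *: u -> u = 0.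
Proof.
have [x0 Dx0 Hmin] := ev_min H.
have [c [c0 Hc]] : exists c, 0 < c /\ forall x, D x -> c <= ev H x.
  by exists (ev H x0); split=> //; exact: eigen_gt0.
have touch (v : X) (m : K) x : 0 < m -> T v = - toC lam *: v ->
    (forall x, D x -> `|ev v x| <= m * ev H x) -> D x ->
    ev v x = m * ev H x -> False.
  move=> m0 Tv vH Dx vx.
  have step (u' : X) z : T u' = - toC lam *: u' ->
      (forall x, D x -> `|ev u' x| <= m * ev H x) -> D z ->
      ev u' z = m * ev H z -> ev u' (b i0 z) = - (m * ev H (b i0 z)).
    move=> Tu' u'H Dz u'z.
    have pos j : 0 <= ev (toC m *: H + u') (b j z).
      have := u'H _ (b_range j Dz); rewrite ler_norml evD evZ => /andP[]; lra.
    have := T_pos Dz pos i0.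
    have TE : T (toC m *: H + u') = toC lam *: (toC m *: H - u').
      rewrite (lin_opD linT) (lin_opZ linT) TH Tu' scalerBr !scalerA mulrC.
      by rewrite scaleNr.
    rewrite TE evZ evB evZ u'z subrr mulr0 pmulr_rle0 // => le0.
    have : ev (toC m *: H + u') (b i0 z) = 0 by apply/eqP; rewrite eq_le le0 pos.
    by rewrite evD evZ; lra.
  pose xs n := iter n (b i0) x.
  have Dxs n : D (xs n) by elim: n => [|n IH] //=; exact: b_range.
  have [k k1 Hk] := b_contraction i0.
  pose q := Num.max k 0.
  have q01 : 0 <= q < 1 by rewrite le_max lexx orbT /= gt_max k1 ltr01.
  have xs_close n : `|xs n.+1 - xs n| <= 2 * q ^+ n.
    elim: n => [|n IH].
      rewrite expr0 mulr1; have := Dxs 1%N; have := Dxs 0%N.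
      by rewrite /D /= => /andP[? ?] /andP[? ?]; rewrite ler_norml; apply/andP; split; lra.
    apply: le_trans (Hk _ _ (Dxs n.+1) (Dxs n)) _.
    apply: le_trans (_ : q * `|xs n.+1 - xs n| <= _).
      by rewrite ler_wpM2r // le_max lexx.
    by rewrite exprS mulrCA ler_wpM2l //; case/andP: q01.
  have alt n : ev v (xs n) = (-1) ^+ n * (m * ev H (xs n)).
    elim: n => [|n IH]; first by rewrite expr0 mul1r.
    have sg : ((-1) ^+ n : K) * (-1) ^+ n = 1 by rewrite -expr2 sqrr_sign.
    have := @step (toC ((-1) ^+ n) *: v) (xs n).
    rewrite !evZ (lin_opZ linT) Tv !scalerA mulrC IH mulrA sg mul1r => st.
    have {}st : (-1) ^+ n * ev v (b i0 (xs n)) = - (m * ev H (b i0 (xs n))).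
      apply: st => // z Dz; rewrite evZ normrM normrX normrN1 expr1n mul1r.
      exact: vH.
    have -> : xs n.+1 = b i0 (xs n) by [].
    by rewrite exprS mulN1r mulNr -mulrN -st mulrA sg mul1r.
  have [L L0 HL] := ev_lip v.
  suff : m * c <= 0 by rewrite leNgt mulr_gt0.
  apply: (@le_geom_eq0 _ _ L q) => // n.
  have h1 : 2 * (m * c) <= `|ev v (xs n.+1) - ev v (xs n)|.
    rewrite !alt exprS.
    have -> : -1 * (-1) ^+ n * (m * ev H (xs n.+1)) - (-1) ^+ n * (m * ev H (xs n)) =
      - ((-1) ^+ n * (m * ev H (xs n.+1) + m * ev H (xs n))) by ring.
    rewrite normrN normrM normrX normrN1 expr1n mul1r.
    apply: le_trans (ler_norm _).
    have h1 : m * c <= m * ev H (xs n.+1) by rewrite ler_pM2l // Hc.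
    have h2 : m * c <= m * ev H (xs n) by rewrite ler_pM2l // Hc.
    lra.
  have h2 := HL _ _ (Dxs n.+1) (Dxs n).
  have h3 := ler_wpM2l L0 (xs_close n); nra.
have real v : T v = - toC lam *: v -> forall x, D x -> ev v x = 0.
  move=> Tv.
  pose E := [set m : K | 0 <= m /\ forall x, D x -> `|ev v x| <= m * ev H x].
  have Enrm : E (nrm v / c).
    split=> [|x Dx]; first by rewrite divr_ge0 // ltW.
    apply: le_trans (ev_le v Dx) _; rewrite mulrAC ler_pdivlMr // ler_wpM2l //.
    exact: Hc.
  have Einf : has_inf E by split; [exists (nrm v / c)|exists 0 => m []].
  have [m mE] : exists m, m = inf E by eexists.
  have mH x : D x -> `|ev v x| <= m * ev H x.
    move=> Dx; rewrite -ler_pdivrMr ?eigen_gt0 // mE.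
    apply: lb_le_inf; first by exists (nrm v / c).
    by move=> t [_ Ht]; rewrite ler_pdivrMr ?eigen_gt0 // Ht.
  have m0 : 0 <= m by rewrite mE; apply: lb_le_inf; [exists (nrm v / c)|move=> t []].
  move: m0; rewrite le_eqVlt => /predU1P[m0|m0].
    by move=> x Dx; apply/eqP; rewrite -normr_le0 (le_trans (mH x Dx)) // -m0 mul0r.
  exfalso.
  have [x1 Dx1 min1] := ev_min (toC m *: H + v).
  have [x2 Dx2 min2] := ev_min (toC m *: H - v).
  have p1 := mH x1 Dx1; have p2 := mH x2 Dx2.
  have [z1|n1] := eqVneq (ev (toC m *: H + v) x1) 0.
    apply: (touch (- v) m x1) => //; last by move: z1; rewrite evD evZ evN; lra.
      by rewrite -scaleN1r (lin_opZ linT) Tv !scalerA mulrC.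
    by move=> z Dz; rewrite evN normrN mH.
  have [z2|n2] := eqVneq (ev (toC m *: H - v) x2) 0.
    by apply: (touch v m x2) => //; move: z2; rewrite evB evZ; lra.
  have s1 : 0 < ev (toC m *: H + v) x1.
    rewrite lt_def n1 evD evZ /=; move: p1; rewrite ler_norml => /andP[]; lra.
  have s2 : 0 < ev (toC m *: H - v) x2.
    rewrite lt_def n2 evB evZ /=; move: p2; rewrite ler_norml => /andP[]; lra.
  have hH : 0 < nrm H + 1 by rewrite ltr_wpDl.
  have [d [d0 dm d1 d2]] : exists d : K, [/\ 0 < d, d <= m,
      d * (nrm H + 1) <= ev (toC m *: H + v) x1 &
      d * (nrm H + 1) <= ev (toC m *: H - v) x2].
    exists (Num.min m (Num.min (ev (toC m *: H + v) x1) (ev (toC m *: H - v) x2) / (nrm H + 1))).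
    split.
    - by rewrite lt_min m0 divr_gt0 // lt_min s1 s2.
    - by rewrite ge_min lexx.
    - by rewrite -ler_pdivlMr // ge_min ler_pM2r ?invr_gt0 // ge_min lexx orbT.
    - by rewrite -ler_pdivlMr // ge_min ler_pM2r ?invr_gt0 // ge_min lexx !orbT.
  have : E (m - d).
    split=> [|x Dx]; first by rewrite subr_ge0.
    have a1 := min1 x Dx; have a2 := min2 x Dx; rewrite !evB !evD !evZ in a1 a2.
    have a3 : d * ev H x <= d * (nrm H + 1).
      by rewrite ler_wpM2l ?(ltW d0) //; have := le_nrm H Dx; lra.
    rewrite !evB !evD !evZ in d1 d2.
    rewrite ler_norml; apply/andP; split; lra.
  by move=> /(ge_inf Einf.2); rewrite -mE; lra.
move=> Tu; have lamN : - toC lam != 0 :> C by rewrite oppr_eq0.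
apply: (ev_eq0 lamN Tu); first exact: real.
by apply: real; rewrite (lin_opZ linT) Tu !scalerA mulrC.
Qed.

End Eigenfunction.

(** The spectral radius leaves the real eigenvalues [lam] and [- lam], and
    positivity excludes the latter. *)
Lemma peripheral_resolvent (nu : X -> C) (h : X) (M : K) :
  approximable nrm T -> bounded_fun nrm nu -> nu h = 1 -> T h = toC lam *: h ->
  spectral_gap nrm T nu (toC lam) M ->
  (forall (z : K) u, u != 0 -> T u = toC z *: u -> `|z| <= lam) ->
  forall z : K, lam <= `|z| -> z != lam -> exists2 M : K, 0 < M &
    forall u, nrm u <= M * nrm (toC z *: u - T u).
Proof.
move=> Tapp [linnu _] nuh Th [_ [gap _]] rad.
have h0 : h != 0.
  by apply/eqP => E; move: nuh; rewrite E (lin_fun0 linnu) => /eqP; rewrite eq_sym oner_eq0.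
have res (z : K) : lam <= `|z| -> (forall u, T u = toC z *: u -> u = 0) ->
    exists2 M : K, 0 < M & (forall chi, exists u, toC z *: u - T u = chi) /\
      forall u, nrm u <= M * nrm (toC z *: u - T u).
  move=> lz inj; apply: fredholm_inverse => //.
  by rewrite -normc_eq0 normc_real gt_eqF // (lt_le_trans lam_gt0).
have ss : forall z, lam < z -> supersolution D z.
  apply: supersolution_above => z lz; have z0 := lt_trans lam_gt0 lz.
  have [| u Tu|_ _ [sol _]] := res z; last exact: sol.
    by rewrite gtr0_norm // ltW.
  apply/eqP; apply: contraT => /rad/(_ Tu); rewrite gtr0_norm // => zl.
  by move: lz; rewrite ltNge zl.
have nu0 : nu (one - nu one *: h) = 0.
  by rewrite (lin_funB linnu) (lin_funZ linnu) nuh mulr1 subrr.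
have [y [_ Hy _]] := gap _ nu0.
have TH : T (nu one *: h) = toC lam *: (nu one *: h).
  by rewrite (lin_opZ linT) Th !scalerA mulrC.
have Hy' : toC lam *: (- y) - T (- y) = one - nu one *: h.
  have -> : T (- y) = - T y by rewrite -scaleN1r (lin_opZ linT) scaleN1r.
  by rewrite -Hy scalerN opprK addrC.
move=> z lz zl; have [|M' M'0 [_ HM]] := res z lz; last by exists M'.
move=> u Tu; apply/eqP; apply: contraT => u0.
have ez : `|z| = lam by apply/eqP; rewrite eq_le lz (rad _ _ u0 Tu).
have zN : z = - lam.
  move: ez zl; case: (lerP 0 z) => [z0|z0]; first by rewrite ger0_norm // => ->; rewrite eqxx.
  by rewrite ltr0_norm // => <-; rewrite opprK.
have := no_negative_eigenvalue ss h0 Th TH Hy' (u := u).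
by rewrite Tu zN rmorphN => /(_ erefl) uE; rewrite uE eqxx in u0.
Qed.

End PositiveOperator.

(** * The peripheral spectrum of the transfer operator *)

Lemma interval_ucompact (K : realType) :
  ucompact [set (toC x : K[i]) | x in [set x : K | -1 <= x <= 1]].
Proof.
split; first by exists 1 => _ [x x1 <-]; rewrite normc_real ler_norml.
move=> s Hs; have ex n : exists x, -1 <= x <= 1 /\ toC x = s n.
  by have [x x1 E] := Hs n; exists x.
have [x Hx] := choice ex.
have -> : s = fun n => toC (x n) by apply/funext => n; case: (Hx n).
have [|x1 ->] := @rulim_range K x (-1) 1; first by move=> n; case: (Hx n).
by exists (rulim x).
Qed.

Section RealPart.
Context {K : realType} {I : choiceType}.
Local Notation C := K[i].
Local Notation Re := (@complex.Re K).
Local Notation Im := (@complex.Im K).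
Variables (g w : I -> C -> C) (r R : K) (S : C -> C).
Hypotheses (r_gt0 : 0 < r) (rR : r < R)
  (g_analytic : forall i, analytic_on (ellipse R) (g i))
  (weights_sum : H_has_sum R (fun i z => expC (w i z)) S)
  (branch_image : forall i z, ellipse R z -> ellipse r (g i z))
  (branch_real : forall i x, x \in `[(-1)%R, 1%R] ->
    exists2 y, y \in `[(-1)%R, 1%R] & g i (toC x) = toC y)
  (weight_real : forall i x, x \in `[(-1)%R, 1%R] -> Im (w i (toC x)) = 0)
  (branch_contraction : forall i, exists2 k : K, k < 1 &
    forall x y, x \in `[(-1)%R, 1%R] -> y \in `[(-1)%R, 1%R] ->
      `|on_reals (g i) x - on_reals (g i) y| <= k * `|x - y|).
Local Notation X := (hardy R).
Local Notation nrm := (fun u : X => Hnorm R u).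
Local Notation T := (hardy_transfer (R := R) g w).
Local Notation ev := (fun u : X => on_reals u).

Let R_gt0 : 0 < R. Proof. exact: lt_trans rR. Qed.
Let hX := hardy_norm R_gt0.
Let sub z : ellipse r z -> ellipse R z. Proof. exact: ellipse_sub. Qed.

Let realE x : -1 <= x <= 1 -> ellipse R (toC x : C).
Proof. exact: ellipse_real. Qed.

Let hardy_transferE := hardy_transferE r_gt0 rR g_analytic weights_sum branch_image.
Let linT := hardy_transfer_lin r_gt0 rR g_analytic weights_sum branch_image.

Lemma on_reals_lip (u : X) : exists2 L : K, 0 <= L & forall x y, -1 <= x <= 1 ->
  -1 <= y <= 1 -> `|on_reals u x - on_reals u y| <= L * `|x - y|.
Proof.
have [t [t1 Ht]] : exists t : K, 1 <= t /\ forall z,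
    [set (toC x : C) | x in [set x : K | -1 <= x <= 1]] z -> quad u t z.
  apply: hol_ucompact; first exact: interval_ucompact.
  by move=> _ [x x1 <-]; apply: hardy_hol; exact: realE.
have t0 : 0 < t by exact: lt_le_trans t1.
have n0 := nrm_ge0 hX u.
have L0 : 0 <= 2 * t by rewrite mulr_ge0 // ltW.
exists (2 * t + 2 * Hnorm R u * t).
  by rewrite addr_ge0 // mulr_ge0 ?(ltW t0) // mulr_ge0.
move=> x y x1 y1; rewrite /on_reals -ReB; apply: le_trans (Re_normc _) _.
rewrite mulrDl; have [xy|xy] := lerP `|x - y| t^-1.
  have Qy : quad u t (toC y) by apply: Ht; exists y.
  have nE : normc (toC x - toC y : C) = `|x - y| by rewrite -rmorphB normc_real.
  have := quad_lip t1 Qy (y := toC x); rewrite nE => /(_ xy) h.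
  apply: le_trans h _; rewrite lerDl.
  by rewrite mulr_ge0 // mulr_ge0 ?(ltW t0) // mulr_ge0.
apply: le_trans (normcB _ _) _.
apply: le_trans (_ : 2 * Hnorm R u * 1 <= _).
  rewrite mulr1 mulrDl mul1r.
  by apply: lerD; apply: hardy_le => //; exact: realE.
apply: (@le_trans _ _ (2 * Hnorm R u * t * `|x - y|)); last first.
  by rewrite lerDr mulr_ge0.
rewrite -[leRHS]mulrA ler_wpM2l ?mulr_ge0 // -(mulfV (lt0r_neq0 t0)).
by rewrite ler_pM2l // ltW.
Qed.

Let weightE i x : -1 <= x <= 1 -> expC (w i (toC x)) = toC (expR (on_reals (w i) x)).
Proof.
move=> x1; rewrite /expC weight_real ?in_itv // cos0 sin0 mulr1 mulr0.
by [].
Qed.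

Let branchE i x : -1 <= x <= 1 ->
  -1 <= on_reals (g i) x <= 1 /\ g i (toC x) = toC (on_reals (g i) x).
Proof.
move=> x1; have [|y] := branch_real i (x := x); first by rewrite in_itv.
by rewrite in_itv /on_reals /= => y1 ->.
Qed.

Lemma on_reals_transfer (i0 : I) (u : X) x : -1 <= x <= 1 ->
  (forall i, 0 <= on_reals u (on_reals (g i) x)) ->
  forall i, expR (on_reals (w i) x) * on_reals u (on_reals (g i) x) <=
            on_reals (T u) x.
Proof.
move=> x1 u0 i.
have aE j : Re (expC (w j (toC x)) * u (g j (toC x))) =
    expR (on_reals (w j) x) * on_reals u (on_reals (g j) x).
  by rewrite weightE // (branchE j x1).2 Re_real_mul.
rewrite -aE [leRHS]/on_reals hardy_transferE; last exact: realE.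
apply: (@Re_sum_ge _ _ (fun j => expC (w j (toC x)) * u (g j (toC x)))) => [|j].
  2: by rewrite aE mulr_ge0 ?expR_ge0.
apply: (transfer_summable r_gt0 rR weights_sum branch_image (B := Hnorm R u)).
  by move=> z Ez; apply: hardy_le => //; exact: sub.
exact: realE.
Qed.

Lemma transfer_real v x : inH r v -> -1 <= x <= 1 ->
  (forall y, -1 <= y <= 1 -> Im (v (toC y)) = 0) ->
  Im (transfer g w v (toC x)) = 0.
Proof.
move=> [_ [B vB]] x1 v0; apply: Im_sum_eq0 => [|i].
  by apply: (transfer_summable r_gt0 rR weights_sum branch_image vB); exact: realE.
have [b1 ->] := branchE i x1.
by rewrite weightE // Im_mul /= v0 // mul0r mulr0 addr0.
Qed.

(** The interpolants vanish, so the function vanishes on the small ellipse; on the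
    large one the eigenvalue equation determines it. *)
Lemma eigen_eq0 (u : X) z : z != 0 -> T u = z *: u ->
  (forall x, -1 <= x <= 1 -> on_reals u x = 0) ->
  (forall x, -1 <= x <= 1 -> on_reals ('i *: u) x = 0) -> u = 0.
Proof.
move=> z0 Tu u1 u2.
have uz x : -1 <= x <= 1 -> u (toC x) = 0.
  move=> x1; apply/complexP; first exact: u1.
  have := u2 x x1; rewrite /on_reals hardy_scale Re_mul /= mul0r mul1r sub0r.
  by move/eqP; rewrite oppr_eq0 => /eqP.
have ur y : ellipse r y -> u y = 0.
  move=> Ey; apply/eqP; rewrite -normc_eq0 eq_le normc_ge0 andbT.
  apply: (@le_geom_eq0 _ _ (4 * Hnorm R u / (1 - expR (- (R - r))) * expR (- (R - r))) (expR (- (R - r)))).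
    by rewrite expR_ge0 /= -expR0 ltr_expR oppr_lt0 subr_gt0.
  move=> m.
  have := interp_err r_gt0 rR (@hardy_hol _ R u) (fun z Ez => hardy_le R_gt0 u Ez) (ltn0Sn m) Ey.
  have -> : interp m.+1 u y = 0.
    by rewrite /interp big1 // => j _; rewrite uz ?mul0r //; exact: cheb_node_bounds.
  rewrite sub0r normcN => /le_trans; apply.
  rewrite le_eqVlt; apply/orP; left; apply/eqP.
  rewrite -mulNr [(_ * m.+1%:R)]mulrC expRM_natl exprS; ring.
have E : T u = 0.
  apply: hardy_eq => y Ey; rewrite hardy_transferE // hardy0.
  rewrite (eq_transfer w branch_image (v := fun=> 0)) //.
  by have := lin_op0 linT => /(congr1 (fun v : X => v y)); rewrite hardy_transferE //.
by apply: (scalerI z0); rewrite -Tu E scaler0.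
Qed.

(** Uniqueness in the resolvent equation fails at an eigenvalue. *)
Lemma eigenvalue_radius (z : C) (u : X) : 0 < spectral_radius r (transfer g w) ->
  z != 0 -> u != 0 -> T u = z *: u -> normc z <= spectral_radius r (transfer g w).
Proof.
move=> rad0 z0 u0 Tu; set E := [set normc x | x in spectrum r (transfer g w)].
have Esup : has_sup E by apply: contrapT => /sup_out E0; move: rad0; rewrite /spectral_radius -/E E0 ltxx.
apply: (ub_le_sup Esup.2); exists z => // -[M HM].
have zeroH : inH r (fun=> 0 : C) by exact: inH_const.
have [psi [psiH _ _ uniq]] := HM _ zeroH.
have e1 : eqH r u psi.
  apply: uniq; first exact: hardy_inHr.
  move=> y Ey; rewrite -hardy_transferE; last exact: sub.
  by rewrite Tu hardy_scale subrr.
have e2 : eqH r (0 : X) psi.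
  apply: uniq; first exact: hardy_inHr.
  move=> y Ey; rewrite -hardy_transferE; last exact: sub.
  rewrite (lin_op0 linT).
  by rewrite hardy0 mulr0 subrr.
move/eqP: u0; apply; apply: (scalerI z0); rewrite scaler0 -Tu.
have ur y : ellipse r y -> u y = (0 : X) y by move=> Ey; rewrite e1 // e2.
rewrite -[RHS](lin_op0 linT).
exact: (eq_lift_transfer r_gt0 rR g_analytic weights_sum branch_image
  (hardy_inHr r_gt0 rR u) (hardy_inHr r_gt0 rR 0) ur).
Qed.

Lemma peripheral (nu : X -> C) (h : X) (M lam : K) : 0 < lam ->
  lam = spectral_radius r (transfer g w) ->
  bounded_fun nrm nu -> nu h = 1 -> T h = toC lam *: h ->
  spectral_gap nrm T nu (toC lam) M ->
  forall z : K, lam <= `|z| -> z != lam -> exists2 M : K, 0 < M &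
    forall u, nrm u <= M * nrm (toC z *: u - T u).
Proof.
move=> lam0 lamE nuB nuh Th gap.
have Tapp := hardy_transfer_approximable r_gt0 rR g_analytic weights_sum branch_image.
have h0 : h != 0.
  apply/eqP => E; case: nuB => linnu _.
  by move: nuh; rewrite E (lin_fun0 linnu) => /eqP; rewrite eq_sym oner_eq0.
have [[i0 _]|noI] := pselect (exists i : I, True); last first.
  (* without branches the operator vanishes *)
  have T0 : T h = 0.
    apply: hardy_eq => z Ez; rewrite hardy_transferE // hardy0.
    apply/eqP; rewrite -normc_eq0 eq_le normc_ge0 andbT; apply: sum_le => A.
    by rewrite big1 // => i; case: noI; exists i.
  move: Th; rewrite T0 => /esym/eqP; rewrite scaler_eq0 (negPf h0) orbF.
  by rewrite -normc_eq0 normc_real normr_eq0 gt_eqF.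
have one1 x : -1 <= x <= 1 -> on_reals (to_hardy R (fun=> 1 : C)) x = 1.
  move=> x1; rewrite /on_reals to_hardyE //; last exact: realE.
    by move=> z _; exact: hol_const.
  by exists (normc 1).
apply: (@peripheral_resolvent _ _ _ nrm T ev (fun i => on_reals (g i))
  (fun i x => expR (on_reals (w i) x)) i0 (to_hardy R (fun=> 1)) lam
  hX linT _ _ _ on_reals_lip eigen_eq0 one1 _ _ _ (on_reals_transfer i0) lam0
  nu h M Tapp nuB nuh Th gap).
- by move=> u v x; rewrite /on_reals hardy_add ReD.
- by move=> a u x; rewrite /on_reals hardy_scale Re_real_mul.
- move=> u x x1; apply: le_trans (Re_normc _) _; apply: hardy_le => //; exact: realE.
- by move=> i x x1; case: (branchE i x1).
- by move=> i; have [k k1 Hk] := branch_contraction i; exists k.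
- by move=> i x; exact: expR_gt0.
move=> z u u0 Tu; have [->|z0] := eqVneq z 0; first by rewrite normr0 ltW.
rewrite lamE -normc_real; apply: (eigenvalue_radius _ _ u0 Tu).
  by rewrite -lamE.
by rewrite -normc_eq0 normc_real normr_eq0.
Qed.

End RealPart.

(** * The discretised operator *)

Section Matrix.
Context {K : realType} {I : choiceType}.
Local Notation C := K[i].
Variables (g w : I -> C -> C) (r R : K) (S : C -> C).
Hypotheses (r_gt0 : 0 < r) (rR : r < R)
  (g_analytic : forall i, analytic_on (ellipse R) (g i))
  (weights_sum : H_has_sum R (fun i z => expC (w i z)) S)
  (branch_image : forall i z, ellipse R z -> ellipse r (g i z)).
Local Notation X := (hardy R).
Local Notation nrm := (fun u : X => Hnorm R u).
Local Notation lift := (lift_transfer g w R).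
Variable N : nat.
Local Notation A := (transfer_matrix g w N).
Local Notation node j := (toC (cheb_node j)).

Let R_gt0 : 0 < R. Proof. exact: lt_trans rR. Qed.

Lemma transfer_matrixE j k : A j k = lift (lagrange k) (node j).
Proof.
rewrite mxE (lift_transferE r_gt0 rR g_analytic weights_sum branch_image) //.
  exact: inH_lagrange.
exact: ellipse_node.
Qed.

Lemma hardy_transferN_node (u : X) (j : 'I_N) : hardy_transferN g w N u (node j) =
  \sum_k A j k * u (node k).
Proof.
rewrite (hardy_transferN_sum r_gt0 rR g_analytic weights_sum branch_image) hardy_sum.
by apply: eq_bigr => k _; rewrite hardy_scale transfer_matrixE mulrC.
Qed.

Definition matrix_function (v : 'cV[C]_N) : X := \sum_k v k 0 *: lift (lagrange k).

Lemma matrix_function_node (v : 'cV[C]_N) z (j : 'I_N) : A *m v = z *: v ->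
  matrix_function v (node j) = z * v j 0.
Proof.
move=> /(congr1 (fun B : 'cV_N => B j 0)); rewrite !mxE => <-.
rewrite hardy_sum; apply: eq_bigr => k _.
by rewrite hardy_scale -transfer_matrixE mulrC.
Qed.

Lemma hardy_transferN_matrix_function (v : 'cV[C]_N) z : A *m v = z *: v ->
  hardy_transferN g w N (matrix_function v) = z *: matrix_function v.
Proof.
move=> Av; rewrite (hardy_transferN_sum r_gt0 rR g_analytic weights_sum branch_image).
rewrite scaler_sumr; apply: eq_bigr => j _.
by rewrite (matrix_function_node _ Av) scalerA.
Qed.

Definition node_functional (v : 'rV[C]_N) (u : X) : C := \sum_j v 0 j * u (node j).

Lemma node_functional_bounded v : bounded_fun nrm (node_functional v).
Proof.
split=> [a u u'|].
  rewrite /node_functional mulr_sumr -big_split /=; apply: eq_bigr => j _.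
  by rewrite hardy_add hardy_scale; ring.
exists (\sum_j normc (v 0 j)) => u; rewrite mulr_suml; apply: normc_sum_le => j _.
rewrite normcM ler_wpM2l ?normc_ge0 //; apply: hardy_le => //; exact: ellipse_node.
Qed.

Lemma node_functional_transferN v z u : v *m A = z *: v ->
  node_functional v (hardy_transferN g w N u) = z * node_functional v u.
Proof.
move=> vA; rewrite /node_functional mulr_sumr.
rewrite (eq_bigr (fun j => \sum_k v 0 j * (A j k * u (node k)))); last first.
  by move=> j _; rewrite hardy_transferN_node mulr_sumr.
rewrite exchange_big; apply: eq_bigr => k _ /=.
have := congr1 (fun B : 'rV_N => B 0 k) vA; rewrite !mxE mulrA => <-.
by rewrite mulr_suml; apply: eq_bigr => j _; rewrite mulrA.
Qed.

Lemma node_functional_neq0 v : v != 0 -> exists u, node_functional v u != 0.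
Proof.
move=> v0; have [j vj] : exists j, v 0 j != 0.
  apply: contrapT => no; move/eqP: v0; apply; apply/rowP => j; rewrite mxE.
  by apply/eqP; apply: contraT => vj; case: no; exists j.
exists (to_hardy R (lagrange j)).
have E k : to_hardy R (lagrange j) (node k) = (k == j)%:R.
  have /(inH_hol _ R_gt0)[lh lb] := inH_lagrange R_gt0 j.
  by rewrite to_hardyE ?lagrange_node //; exact: ellipse_node.
rewrite /node_functional (bigD1 j) //= E eqxx mulr1 big1 ?addr0 // => k kj.
by rewrite E (negPf kj) mulr0.
Qed.

Lemma hardy_transferN_eigenvalue (u : X) z : z != 0 -> u != 0 -> hardy_transferN g w N u = z *: u ->
  eigenvalue A z.
Proof.
move=> z0 u0 Tu; pose v : 'cV[C]_N := \col_j u (node j).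
have v0 : v != 0.
  apply/eqP => E; move/eqP: u0; apply; apply: (scalerI z0).
  rewrite scaler0 -Tu (hardy_transferN_sum r_gt0 rR g_analytic weights_sum branch_image).
  rewrite big1 // => j _; have := congr1 (fun B : 'cV_N => B j 0) E.
  by rewrite !mxE => ->; rewrite scale0r.
have Av : (A - z%:M) *m v = 0.
  rewrite mulmxBl mul_scalar_mx; apply/eqP; rewrite subr_eq0; apply/eqP.
  apply/colP => j; rewrite !mxE -hardy_scale -Tu hardy_transferN_node.
  by apply: eq_bigr => k _; rewrite !mxE.
rewrite /eigenvalue /eigenspace kermx_eq0 row_free_unit; apply/negP => Au.
by move/eqP: v0; apply; rewrite -(mulKmx Au v) Av mulmx0.
Qed.

End Matrix.

Lemma lagrange_real (K : realType) N (k : 'I_N) (x : K) :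
  complex.Im (lagrange k (toC x)) = 0.
Proof.
rewrite /lagrange (eq_bigr (fun m => toC ((x - cheb_node m) / (cheb_node k - cheb_node m)))).
  by rewrite -rmorph_prod.
by move=> m _; rewrite -fmorphV -rmorphB -rmorphM.
Qed.

Unset Implicit Arguments.

Theorem theorem1 (K : realType) (I : choiceType)
  (g w : I -> K[i] -> K[i]) (f phi : K -> K) (r R Phi : K) (S : K[i] -> K[i])
  (P : K) (h : K[i] -> K[i]) (nu : (K[i] -> K[i]) -> K[i])
  (mu : probability (measurableTypeR K) K)
  (r_gt0 : 0 < r) (rR : r < R)
  (system : full_branch_system R g w f phi)
  (weights_sum : H_has_sum R (fun i z => expC (w i z)) S)
  (weights_bound : Hnorm R S <= Phi)
  (branch_image : forall i z, ellipse R z -> ellipse r (g i z))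
  (P_pressure : pressure (branch_domain g) f phi = P%:E)
  (radius : spectral_radius r (transfer g w) = expR P)
  (simple : simple_eigenvalue r (transfer g w) (toC (expR P)))
  (isolated : isolated_in_spectrum r (transfer g w) (toC (expR P)))
  (h_eigen : right_eigenfunction r (transfer g w) (toC (expR P)) h)
  (nu_eigen : left_eigenvector r (transfer g w) (toC (expR P)) nu)
  (mu_equilibrium : equilibrium (branch_domain g) f phi mu)
  (mu_formula : forall psi, inH r psi ->
     cintegral mu psi = nu (fun z => psi z * h z) / nu h) :
  exists (K' : K) (N0 : nat), forall N : nat, (N0 <= N)%N ->
    forall (nuN : 'rV[K]_N) (hN : 'cV[K]_N),
      leading_eigenvectors (transfer_matrix g w N) nuN hN ->
    forall psi, inH R psi ->
      normc (cintegral mu psi -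
        \sum_(j < N) toC (discrete_measure nuN hN j) * psi (toC (cheb_node j)))
      <= K' * expR (- ((R - r) * N%:R)) * Hnorm R psi.
Proof.
have R_gt0 : 0 < R by exact: lt_trans rR.
have bX := hardy_norm R_gt0.
have [lam lamE] : exists lam, lam = expR P by eexists.
rewrite -lamE in radius simple h_eigen nu_eigen.
have lam0 : 0 < lam by rewrite lamE expR_gt0.
have lamC : toC lam != 0 by rewrite -normc_eq0 normc_real normr_eq0 gt_eqF.
have g_an := branch_analytic system.
have linT := hardy_transfer_lin r_gt0 rR g_an weights_sum branch_image.
have Tapp := hardy_transfer_approximable r_gt0 rR g_an weights_sum branch_image.
have [e eE] : exists e, e = eigen g w R lam h by eexists.
have Te : hardy_transfer g w e = toC lam *: e.
  by rewrite eE; exact: (eigen_transfer r_gt0 rR g_an weights_sum branch_image lam0 h_eigen).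
have eh : eqH r e h.
  by rewrite eE; exact: (eigenE r_gt0 rR g_an weights_sum branch_image lam0 h_eigen).
have e_neq0 : e != 0.
  by rewrite eE; exact: (eigen_neq0 r_gt0 rR g_an weights_sum branch_image lam0 h_eigen).
have dB := dual_eigen_bounded r_gt0 rR nu_eigen.
have dT := dual_eigen_transfer r_gt0 rR g_an weights_sum branch_image nu_eigen.
have S1 : forall u, hardy_transfer g w u = toC lam *: u -> exists c, u = c *: e.
  by rewrite eE; exact: (eigen_simple r_gt0 rR g_an weights_sum branch_image lam0 simple h_eigen).
have nue : dual_eigen nu e != 0.
  have [k nuk] := dual_eigen_neq0 r_gt0 rR g_an weights_sum branch_image lam0 nu_eigen.
  have [z Ez ez] : exists2 z, ellipse R z & e z != 0.
    apply: contrapT => no; move/eqP: e_neq0; apply; apply: hardy_eq => z Ez.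
    by apply/eqP; apply: contraT => ez; case: no; exists z.
  apply: (left_right_eigen_neq0 bX lamC dB dT (xi := fun u : hardy R => u z) Tapp _ ez nuk S1).
    by split=> //; exists 1 => u; rewrite mul1r; exact: hardy_le.
  by rewrite eE; exact: (eigen_no_jordan r_gt0 rR g_an weights_sum branch_image lam0 simple h_eigen).
have [xi xiE] : exists xi, xi = fun u : hardy R => dual_eigen nu u / dual_eigen nu e by eexists.
have xiB : bounded_fun (fun u : hardy R => Hnorm R u) xi.
  case: dB => lin [c Hc]; rewrite xiE; split=> [a u v|].
    by rewrite lin mulrDl mulrA.
  exists (normc (dual_eigen nu e)^-1 * c) => u; rewrite normcM mulrC -mulrA.
  by rewrite ler_wpM2l ?normc_ge0.
have xiT u : xi (hardy_transfer g w u) = toC lam * xi u by rewrite xiE dT mulrA.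
have xie : xi e = 1 by rewrite xiE divff.
have [M gap] := spectral_gap_exists bX linT lamC xiB xiT xie Tapp S1.
have [c c0 xi_le] := bounded_fun_gt0 bX xiB.
have [d0 [C0 [d00 C00 ev_near]]] := eigenvalue_near bX linT Te xiB xie gap.
have [d1 [e1 [K1 [d10 e10 quot]]]] := eigen_quotient_near bX linT Te xiB xiT xie gap c0 xi_le.
have [k k0 Tnear] := hardy_transferN_near r_gt0 rR g_an weights_sum branch_image.
have [W W0 TW] := hardy_transfer_bounded r_gt0 rR g_an weights_sum branch_image.
have [del delE] : exists del, del = fun N : nat => k * expR (- ((R - r) * N%:R)) by eexists.
have del0 N : 0 <= del N by rewrite delE mulr_ge0 // expR_ge0.
have del_lim (t : K) : 0 < t -> exists N, forall n, (N <= n)%N -> del n.+1 <= t.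
  move=> t0; have [N HN] := expR_decay rR k0 t0; exists N => n Nn.
  by rewrite delE; apply: HN; exact: leqW.
have TnT n (u : hardy R) : Hnorm R (hardy_transferN g w n.+1 u - hardy_transfer g w u) <= del n.+1 * Hnorm R u.
  by rewrite delE; exact: Tnear.
have periph := peripheral r_gt0 rR g_an weights_sum branch_image
  (branch_real system) (weight_real system) (branch_contraction system)
  lam0 (esym radius) xiB xie Te gap.
have [N1 HN1] := real_eigenvalue_limit bX TW TnT del_lim (ltW C00) periph e10.
have t0 : 0 < Num.min d0 (Num.min d1 (lam / (2 * C0))).
  by rewrite !lt_min d00 d10 divr_gt0 // mulr_gt0.
have [N2 HN2] := del_lim _ t0.
exists (K1 * k), (maxn N1 N2).+1 => -[//|n]; rewrite ltnS geq_max => /andP[/HN1 {}HN1 /HN2].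
rewrite !le_min => /and3P[dd0 dd1 dC].
move=> nuN hN [nuN0 [hN0 [z [[zA zlead] nuA Ah]]]] psi psiH.
have linTN := hardy_transferN_lin r_gt0 rR g_an weights_sum branch_image n.+1.
have Cdel : C0 * del n.+1 <= lam / 2.
  apply: le_trans (_ : C0 * (lam / (2 * C0)) <= _); first by rewrite ler_wpM2l // ltW.
  by rewrite le_eqVlt; apply/orP; left; apply/eqP; field; rewrite gt_eqF.
(* the matrix has some eigenvalue near [lam], and [z] is not smaller *)
have zlow : lam - C0 * del n.+1 <= normc z.
  have [|z' [u [u0 Tu zz]]] := ev_near _ (del n.+1) linTN _ (TnT n); first by rewrite del0.
  have h1 : lam - C0 * del n.+1 <= normc z'.
    have := normcB (z' - toC lam) z'; rewrite addrAC subrr add0r normcN normc_real gtr0_norm //.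
    move: zz; lra.
  have z'0 : z' != 0 by rewrite -normc_eq0 gt_eqF //; lra.
  apply: le_trans h1 (zlead _ _).
  exact: (hardy_transferN_eigenvalue r_gt0 rR g_an weights_sum branch_image z'0 u0 Tu).
have z0 : z != 0 by rewrite -normc_eq0 gt_eqF //; lra.
have nuC0 : map_mx toC nuN != 0 by rewrite map_mx_eq0.
have hC0 : map_mx toC hN != 0 by rewrite map_mx_eq0.
have [v vE] : exists v, v = matrix_function g w R (map_mx toC hN) by eexists.
have vnode (j : 'I_n.+1) : v (toC (cheb_node j)) = z * toC (hN j 0).
  rewrite vE (matrix_function_node r_gt0 rR g_an weights_sum branch_image j Ah).
  by rewrite mxE.
have Tv : hardy_transferN g w n.+1 v = z *: v.
  by rewrite vE; exact: (hardy_transferN_matrix_function r_gt0 rR g_an weights_sum branch_image Ah).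
have v0 : v != 0.
  apply/eqP => E; move/eqP: hN0; apply; apply/colP => j; rewrite mxE.
  have := vnode j; rewrite E hardy0 => /esym/eqP.
  by rewrite mulf_eq0 (negPf z0) /= fmorph_eq0 => /eqP.
(* the matrix and its left eigenvector are real, hence so is the eigenvalue *)
have Imz : complex.Im z = 0.
  have [j nuj] : exists j, nuN 0 j != 0.
    apply: contrapT => no; move/eqP: nuN0; apply; apply/rowP => j; rewrite mxE.
    by apply/eqP; apply: contraT => vj; case: no; exists j.
  have := congr1 (fun B : 'rV_n.+1 => complex.Im (B 0 j)) nuA.
  rewrite /= !mxE Im_sum big1 => [|i _].
    rewrite Im_mul /= mulr0 add0r => /esym/eqP.
    by rewrite mulf_eq0 (negPf nuj) orbF => /eqP.
  rewrite !mxE Im_mul /= mul0r addr0.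
  rewrite (transfer_real r_gt0 rR weights_sum branch_image (branch_real system)
    (weight_real system)) ?mulr0 //; [exact: inH_lagrange|exact: cheb_node_bounds|].
  by move=> y _; exact: lagrange_real.
have zE : z = toC (complex.Re z) by apply/complexP => //=; rewrite Imz.
have znear : normc (z - toC lam) <= e1.
  rewrite zE -rmorphB normc_real; apply: (HN1 _ v v0); first by rewrite -zE.
  by rewrite -normc_real -zE.
(* both integrals are quotients of pairings of left and right eigenvectors *)
pose m (u : hardy R) : hardy R := to_hardy R (fun y => psi y * u y).
have mE u y : ellipse R y -> m u y = psi y * u y.
  have /(inH_hol _ R_gt0)[mh mb] := inHM R_gt0 psiH (hardy_inH R_gt0 u).
  exact: to_hardyE.
have mlin : lin_op m.
  move=> a u u'; apply: hardy_eq => y Ey.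
  rewrite hardy_add hardy_scale !mE // hardy_add hardy_scale; ring.
have mB u : Hnorm R (m u) <= Hnorm R psi * Hnorm R u.
  apply: Hnorm_le => // y Ey; rewrite mE // normcM.
  by apply: ler_pM; rewrite ?normc_ge0 ?hardy_le //; exact: inH_bound.
have psi0 : 0 <= Hnorm R psi.
  by apply: le_trans (normc_ge0 (psi 0)) _; apply: inH_bound => //; exact: ellipse0.
have := quot _ (del n.+1) z v (node_functional (map_mx toC nuN)) linTN _
  (TnT n) znear v0 Tv (node_functional_bounded r_gt0 rR _)
  (node_functional_neq0 r_gt0 rR nuC0)
  (fun u => node_functional_transferN r_gt0 rR g_an weights_sum branch_image u nuA)
  m _ mlin psi0 mB.
rewrite del0 dd1 => /(_ isT).
have -> : xi (m e) = cintegral mu psi.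
  have psir := inH_sub r_gt0 rR psiH; have [hr _ _] := h_eigen.
  rewrite xiE mu_formula //; congr (_ / _).
    apply: (dual_eq r_gt0 nu_eigen); first exact: hardy_inHr.
      exact: inHM.
    by move=> y Ey; rewrite mE ?eh //; exact: ellipse_sub Ey.
  by apply: (dual_eq r_gt0 nu_eigen) => //; exact: hardy_inHr.
have -> : node_functional (map_mx toC nuN) (m v) /
    node_functional (map_mx toC nuN) v =
    \sum_j toC (discrete_measure nuN hN j) * psi (toC (cheb_node j)).
  have -> : node_functional (map_mx toC nuN) (m v) =
      z * \sum_j toC (nuN 0 j) * toC (hN j 0) * psi (toC (cheb_node j)).
    rewrite mulr_sumr; apply: eq_bigr => j _.
    by rewrite !mxE mE ?vnode; [ring|exact: ellipse_node].
  have -> : node_functional (map_mx toC nuN) v =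
      z * toC (\sum_j nuN 0 j * hN j 0).
    rewrite rmorph_sum mulr_sumr; apply: eq_bigr => j _.
    by rewrite !mxE vnode rmorphM; ring.
  rewrite -mulf_div divff // mul1r mulr_suml; apply: eq_bigr => j _.
  by rewrite /discrete_measure !rmorphM fmorphV; ring.
by move=> bound; apply: le_trans bound _; rewrite delE mulrA.
Qed.
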